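(* For the Gaussian MIMO cognitive channel with channel matrices $H_{p,p},H_{c,p},H_{p,c},H_{c,c}$ and power constraints $P_p,P_c$, the region $\mathcal{R}_{in}$ is achievable, i.e. $\mathcal{R}_{in}\subseteq \mathcal{C}_{MCC}$.
   Context: Gaussian MIMO cognitive channel (MCC): a primary transmitter with $n_{p,t}$ antennas, a cognitive transmitter with $n_{c,t}$ antennas, a primary receiver with $n_{p,r}$ antennas and a cognitive receiver with $n_{c,r}$ antennas. Fixed (static) complex matrices $H_{p,p}\in\mathbb{C}^{n_{p,r}\times n_{p,t}}$, $H_{c,p}\in\mathbb{C}^{n_{p,r}\times n_{c,t}}$, $H_{p,c}\in\mathbb{C}^{n_{c,r}\times n_{p,t}}$, $H_{c,c}\in\mathbb{C}^{n_{c,r}\times n_{c,t}}$. At time $i$: $Y_p(i)=H_{p,p}X_p(i)+H_{c,p}X_c(i)+Z_p(i)$, $Y_c(i)=H_{p,c}X_p(i)+H_{c,c}X_c(i)+Z_c(i)$, where $Z_p(i)\sim\mathcal{N}(0,I_{n_{p,r}})$, $Z_c(i)\sim\mathcal{N}(0,I_{n_{c,r}})$ are (circularly symmetric complex) Gaussian, i.i.d. over time, with arbitrary mutual correlation. A code of length $n$ and rates $(R_p,R_c)$: messages $m_p\in\{1,\dots,2^{nR_p}\}$, $m_c\in\{1,\dots,2^{nR_c}\}$ (independent, uniform); encoders $X_p^n=E_p^n(m_p)$ and $X_c^n=E_c^n(m_p,m_c)$ (the cognitive transmitter knows both messages) satisfying $\sum_{i=1}^n\mathrm{Tr}(\Sigma_p(i))\le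 nP_p$ and $\sum_{i=1}^n\mathrm{Tr}(\Sigma_c(i))\le nP_c$, where $\Sigma_p(i),\Sigma_c(i)$ are the covariances of $X_p(i),X_c(i)$; decoders $\hat m_p=D_p^n(Y_p^n)$, $\hat m_c=D_c^n(Y_c^n)$. $(R_p,R_c)$ is achievable if for every $\epsilon>0$ there is, for all sufficiently large $n$, a code with $\Pr(\hat m_p\ne m_p)\le\epsilon$ and $\Pr(\hat m_c\ne m_c)\le\epsilon$. $\mathcal{C}_{MCC}$ denotes the set of achievable rate pairs (capacity region). $A^\dagger$ is conjugate transpose, $|\cdot|$ determinant, $\succeq 0$ positive semidefinite. Let $G=[H_{p,p}\ \ H_{c,p}]$. $\mathcal{R}_{ach}$ is the set of tuples $((R_p,R_c),\Sigma_p,\Sigma_{c,p},\Sigma_{c,c},Q)$ with $R_p,R_c\ge0$, $\Sigma_p\in\mathbb{C}^{n_{p,t}\times n_{p,t}}$, $\Sigma_{c,p},\Sigma_{c,c}\in\mathbb{C}^{n_{c,t}\times n_{c,t}}$ all $\succeq0$, $Q\in\mathbb{C}^{n_{p,t}\times n_{c,t}}$, such that $\Sigma_{p,net}=\begin{pmatrix}\Sigma_p&Q\\Q^\dagger&\Sigma_{c,p}\end{pmatrix}\succeq 0$, $\mathrm{Tr}(\Sigma_p)\le P_p$, $\mathrm{Tr}(\Sigma_{c,p}+\Sigma_{c,c})\le P_c$, and $R_p\le \log|I+G\Sigma_{p,net}G^\dagger+H_{c,p}\Sigma_{c,c}H_{c,p}^\dagger|-\log|I+H_{c,p}\Sigma_{c,c}H_{c,p}^\dagger|$,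 $R_c\le\log|I+H_{c,c}\Sigma_{c,c}H_{c,c}^\dagger|$. $\mathcal{R}_{in}$ is the closure of the convex hull of the set of $(R_p,R_c)$ for which some $\Sigma_p,\Sigma_{c,p},\Sigma_{c,c},Q$ give a tuple in $\mathcal{R}_{ach}$. *)

(* Defs.v *)
From mathcomp Require Import all_boot all_order all_algebra.
From mathcomp Require Import all_classical all_reals all_analysis.
From mathcomp Require Import complex.

Set Implicit Arguments.
Unset Strict Implicit.
Unset Printing Implicit Defensive.

Import Order.TTheory GRing.Theory Num.Theory.
Local Open Scope classical_set_scope.
Local Open Scope ring_scope.

Section MCC.
Variable R : realType.
Local Notation C := R[i].

Definition ctr (m n : nat) (A : 'M[C]_(m, n)) : 'M[C]_(n, m) :=
  (map_mx (@conjc R) A)^T.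

(** positive semidefinite (complex) matrix: v^dagger A v >= 0 for all v
    (in the order of C, i.e. v^dagger A v is real and nonnegative) *)
Definition psd (n : nat) (A : 'M[C]_n) : Prop :=
  forall v : 'cV[C]_n, 0 <= (ctr v *m A *m v) 0 0.

(** logarithm in base 2 (rates in bits, messages in {1..2^{nR}}) *)
Definition log2 (x : R) : R := ln x / ln 2.

(** log |A| for a matrix with real positive determinant *)
Definition logdet (n : nat) (A : 'M[C]_n) : R := log2 (complex.Re (\det A)).

Definition Rach_rates (npt nct npr ncr : nat)
  (Hpp : 'M[C]_(npr, npt)) (Hcp : 'M[C]_(npr, nct))
  (Hcc : 'M[C]_(ncr, nct)) (Pp Pc : R) (r : R * R) : Prop :=
  exists (Sp : 'M[C]_npt) (Scp Scc : 'M[C]_nct) (Q : 'M[C]_(npt, nct)),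
    let G : 'M[C]_(npr, npt + nct) := row_mx Hpp Hcp in
    let Snet : 'M[C]_(npt + nct) := block_mx Sp Q (ctr Q) Scp in
    [/\ 0 <= r.1, 0 <= r.2, psd Sp, psd Scp & psd Scc] /\
    [/\ psd Snet,
        complex.Re (\tr Sp) <= Pp,
        complex.Re (\tr (Scp + Scc)) <= Pc,
        r.1 <= logdet (1%:M + G *m Snet *m ctr G + Hcp *m Scc *m ctr Hcp)
               - logdet (1%:M + Hcp *m Scc *m ctr Hcp)
      & r.2 <= logdet (1%:M + Hcc *m Scc *m ctr Hcc)].

Definition conv_hull2 (S : set (R * R)) : set (R * R) :=
  [set z | exists (k : nat) (lam : 'I_k -> R) (s : 'I_k -> R * R),
      [/\ (forall i, 0 <= lam i), \sum_(i < k) lam i = 1,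
          (forall i, S (s i)) &
          z = (\sum_(i < k) lam i * (s i).1, \sum_(i < k) lam i * (s i).2)]].

Definition R_in (npt nct npr ncr : nat)
  (Hpp : 'M[C]_(npr, npt)) (Hcp : 'M[C]_(npr, nct))
  (Hcc : 'M[C]_(ncr, nct)) (Pp Pc : R) : set (R * R) :=
  closure (conv_hull2 (Rach_rates Hpp Hcp Hcc Pp Pc) : set (R^o * R^o)).

(** law of one real coordinate of a CN(0,1) variable: N(0, 1/2) *)
Definition cgauss1 := normal_prob (0 : R) (Num.sqrt (2^-1)).

(** law of K i.i.d. N(0,1/2) real coordinates, on K.-tuple R
    (defined as the iterated integral, i.e. the product measure on the
    measurable sets of the tuple sigma-algebra) *)
Fixpoint gauss_tuple (K : nat) : set (K.-tuple R) -> \bar R :=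
  match K return set (K.-tuple R) -> \bar R with
  | 0 => fun A => ((\1_A [tuple]) : R)%:E
  | K'.+1 => fun A =>
      (\int[cgauss1]_x @gauss_tuple K' [set t : K'.-tuple R | A (cons_tuple (x : R) t)])%E
  end.

(** the complex noise matrix (column i = Z(i), i.i.d. CN(0,I_k) columns)
    built from 2*k*n i.i.d. N(0,1/2) real coordinates *)
Definition noise_mx (k n : nat) (t : (k * n + k * n).-tuple R) : 'M[C]_(k, n) :=
  vec_mx (\row_a (Complex (tnth t (lshift (k * n) a)) (tnth t (rshift (k * n) a)))).

Definition avg (I : finType) (a b : nat) (f : I -> 'M[C]_(a, b)) : 'M[C]_(a, b) :=
  (#|I|%:R)^-1 *: \sum_(x : I) f x.

Definition cov_at (I : finType) (m n : nat) (X : I -> 'M[C]_(m, n)) (i : 'I_n)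
  : 'M[C]_m :=
  let mu := avg (fun x => col i (X x)) in
  avg (fun x => (col i (X x) - mu) *m ctr (col i (X x) - mu)).

Definition power_ok (I : finType) (m n : nat) (X : I -> 'M[C]_(m, n)) (P : R)
  : Prop :=
  complex.Re (\sum_(i < n) \tr (cov_at X i)) <= n%:R * P.

Definition meas_decoder (k n M : nat) (D : 'M[C]_(k, n) -> 'I_M) : Prop :=
  forall m : 'I_M, measurable [set t : (k * n + k * n).-tuple R | D (noise_mx t) = m].

Definition err_prob (k n Mp Mc M : nat) (clean : 'I_Mp -> 'I_Mc -> 'M[C]_(k, n))
  (D : 'M[C]_(k, n) -> 'I_M) (target : 'I_Mp -> 'I_Mc -> 'I_M) : \bar R :=
  (((Mp * Mc)%:R)^-1)%:E *
  (\sum_(mp < Mp) \sum_(mc < Mc)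
     gauss_tuple [set t | D (clean mp mc + noise_mx t)%R != target mp mc])%E.

Definition achievable (npt nct npr ncr : nat)
  (Hpp : 'M[C]_(npr, npt)) (Hcp : 'M[C]_(npr, nct))
  (Hpc : 'M[C]_(ncr, npt)) (Hcc : 'M[C]_(ncr, nct)) (Pp Pc : R) (r : R * R)
  : Prop :=
  forall eps : R, 0 < eps -> exists N0 : nat, forall n : nat, (N0 <= n)%N ->
  exists (Mp Mc : nat)
         (Ep : 'I_Mp -> 'M[C]_(npt, n)) (Ec : 'I_Mp -> 'I_Mc -> 'M[C]_(nct, n))
         (Dp : 'M[C]_(npr, n) -> 'I_Mp) (Dc : 'M[C]_(ncr, n) -> 'I_Mc),
    [/\ 2 `^ (n%:R * r.1) <= Mp%:R, 2 `^ (n%:R * r.2) <= Mc%:R,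
        power_ok Ep Pp,
        power_ok (fun m : 'I_Mp * 'I_Mc => Ec m.1 m.2) Pc
      & meas_decoder Dp /\ meas_decoder Dc] /\
    (err_prob (fun mp mc => (Hpp *m Ep mp + Hcp *m Ec mp mc)%R) Dp (fun mp _ => mp)
       <= eps%:E)%E /\
    (err_prob (fun mp mc => (Hpc *m Ep mp + Hcc *m Ec mp mc)%R) Dc (fun _ mc => mc)
       <= eps%:E)%E.

Definition C_MCC (npt nct npr ncr : nat)
  (Hpp : 'M[C]_(npr, npt)) (Hcp : 'M[C]_(npr, nct))
  (Hpc : 'M[C]_(ncr, npt)) (Hcc : 'M[C]_(ncr, nct)) (Pp Pc : R) : set (R * R) :=
  [set r | achievable Hpp Hcp Hpc Hcc Pp Pc r].

End MCC.

(* Main.v *)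
(** Everything reduces to counting points of a fine grid. Code letters are grid points
    carrying a discretised Gaussian law, and the number of grid words close to a received
    word is bounded by the volume of an ellipsoid. The primary codebook is drawn uniformly
    from the typical words [w]. The cognitive transmitter uses dirty-paper coding: its
    auxiliary words [u] are drawn uniformly from a large box of grid words, each message
    owning a bin of them, and it looks in the bin of its message for a [u] for which
    [u] minus the (quantised) linear estimate of the interference created by [w] is typical.
    Both receivers look for a codeword whose weighted distance to a linear
    estimate is at most a threshold. All typicality statements come from Chebyshev's
    inequality for quadratic forms, of the letters and of the Gaussian noise.

    Rate pairs of the convex hull are reached by letting the covariances depend on time, and
    closure points by spending a power larger by a factor [s ^+ 3 > 1]: this multiplies all
    achievable rates by a constant larger than one, and the average power constraint is
    restored by sending zero for a small fraction of the messages, at the price of a small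
    error probability. *)

From HB Require Import structures.
Require Import Defs.
From mathcomp Require Import all_boot all_order all_algebra.
From mathcomp Require Import all_classical all_reals all_analysis.
From mathcomp Require Import measurable_realfun complex spectral sesquilinear ring lra.

Set Implicit Arguments.
Unset Strict Implicit.
Unset Printing Implicit Defensive.

Import Order.TTheory GRing.Theory Num.Theory.
Import numFieldNormedType.Exports.
Local Open Scope classical_set_scope.
Local Open Scope ring_scope.

(** * Gaussian integrals and quadratic forms of the noise *)

(** The rates come out of a ratio of two counts. With unit variance per complex coordinate there are
    about (e pi / eta^2)^(nk) typical words of k coordinates on a grid of step eta. An ellipsoid
    with weights d and threshold about nk holds at most about that number divided by the product of
    the d. The ratio is exp of the sum of ln d, and the modes are built so that this sum is the
    log-determinant rate; eta disappears. The size of the box of auxiliary words disappears too: a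
    bin needs about |U|/G words, where G bounds from below the number of u compatible with w. The
    same G serves every typical w, because u is a translate of v. Hence the known interference costs
    no rate. The obstacle is uniformity: the estimates must hold for every time-sharing sequence and
    every typical w at one block length. Mode and letters are therefore treated as a state in a
    finite set, and the Chebyshev constants depend on that set only. The power factor is [s ^+ 3]
    because a mode spends [s ^+ 2] and the slack of typicality takes at most one more factor s. *)

Section GaussIntegral.
Variable R : realType.
Local Notation mu := (@lebesgue_measure R).

Lemma measurable_EFin_normal_pdf (m s : R) :
  measurable_fun setT (fun x => (normal_pdf m s x)%:E).
Proof. by apply/measurable_EFinP; exact: measurable_normal_pdf. Qed.

(** Read off from the total mass of the normal density with variance 1/(2d). *)
Lemma integral_gauss_scaled (d b : R) : 0 < d ->
  (\int[mu]_x (expR (- (d * (x - b) ^+ 2)))%:E = (Num.sqrt (pi / d))%:E)%E.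
Proof.
move=> d0; set s := Num.sqrt ((2 * d)^-1).
have s20 : 0 < (2 * d)^-1 by rewrite invr_gt0 mulr_gt0.
have s0 : s != 0 by rewrite gt_eqF// sqrtr_gt0.
have ss : s ^+ 2 = (2 * d)^-1 by rewrite sqr_sqrtr// ltW.
have pk : normal_peak s = (Num.sqrt (pi / d))^-1.
  rewrite /normal_peak ss; congr ((Num.sqrt _)^-1).
  by rewrite -mulr_natr; field; rewrite gt_eqF.
have sq0 : 0 < Num.sqrt (pi / d) by rewrite sqrtr_gt0 divr_gt0// pi_gt0.
transitivity (\int[mu]_x ((Num.sqrt (pi / d))%:E * (normal_pdf b s x)%:E))%E.
  apply: eq_integral => x _; rewrite normal_pdfE//= pk /normal_fun -EFinM; congr EFin.
  rewrite mulVKf ?gt_eqF//; congr expR.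
  by rewrite ss -mulr_natr; field; rewrite gt_eqF.
rewrite ge0_integralZl//=; last 2 first.
- exact: measurable_EFin_normal_pdf.
- by move=> x _; rewrite lee_fin normal_pdf_ge0.
by rewrite integral_normal_pdf mule1.
Qed.

Section density.
Variables (m s : R).
Import HBNNSimple.
Let P := normal_prob m s.

Let integral_indic_normal E : measurable E ->
  (\int[P]_x (\1_E x)%:E = \int[mu]_x ((\1_E x)%:E * (normal_pdf m s x)%:E))%E.
Proof.
move=> mE; rewrite integral_indic// setIT.
rewrite [LHS](_ : _ = \int[mu]_(x in E) (normal_pdf m s x)%:E)%E//.
rewrite [LHS]integral_mkcond; apply: eq_integral => x _; rewrite patchE indicE.
by case: (x \in E); rewrite ?mul1e ?mul0e.
Qed.

Let integral_nnsfun_normal (f : {nnsfun measurableTypeR R >-> R}) :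
  (\int[P]_x (f x)%:E = \int[mu]_x ((f x)%:E * (normal_pdf m s x)%:E))%E.
Proof.
under [LHS]eq_integral do rewrite fimfunE -fsumEFin//.
rewrite [LHS]ge0_integral_fsum//; last 2 first.
  - by move=> r; exact/measurable_EFinP/measurableT_comp.
  - by move=> n x _; rewrite EFinM nnfun_muleindic_ge0.
under [RHS]eq_integral.
  move=> x xD; rewrite fimfunE -fsumEFin// ge0_mule_fsuml; last first.
    by move=> r; rewrite EFinM nnfun_muleindic_ge0.
  over.
rewrite [RHS]ge0_integral_fsum//; last 2 first.
  - move=> r; apply: emeasurable_funM; first exact/measurable_EFinP/measurableT_comp.
    exact: measurable_EFin_normal_pdf.
  - move=> n x _; rewrite EFinM mule_ge0//; first by rewrite nnfun_muleindic_ge0.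
    by rewrite lee_fin normal_pdf_ge0.
apply: eq_fsbigr => r _.
rewrite integralZl_indic_nnsfun// integral_indic_normal//.
have [r0|r0] := leP 0 r.
  rewrite -ge0_integralZl//.
  - by apply: eq_integral => x _; rewrite EFinM muleA.
  - apply: emeasurable_funM; first exact/measurable_EFinP/measurable_indic.
    exact: measurable_EFin_normal_pdf.
  - by move=> x _; rewrite mule_ge0// lee_fin ?normal_pdf_ge0.
under [RHS]eq_integral do rewrite preimage_nnfun0// indic0 mulr0 mul0e.
rewrite integral0 preimage_nnfun0//; under eq_integral do rewrite indic0 mul0e.
by rewrite integral0 mule0.
Qed.

(** The usual passage from indicators to simple functions to monotone limits. It turns integrals
    against the noise law into Lebesgue integrals, where squares can be completed. *)
Lemma ge0_integral_normal_prob (f : measurableTypeR R -> \bar R) :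
  measurable_fun setT f -> (forall x, 0 <= f x)%E ->
  (\int[P]_x f x = \int[mu]_x (f x * (normal_pdf m s x)%:E))%E.
Proof.
move=> mf f0.
pose f_ := nnsfun_approx measurableT mf.
transitivity (lim (\int[P]_x (f_ n x)%:E @[n --> \oo])%E).
  rewrite -monotone_convergence//=.
  - apply: eq_integral => ? /[!inE] xD; apply/esym/cvg_lim => //=.
    exact: cvg_nnsfun_approx.
  - by move=> n; exact/measurable_EFinP/measurable_funTS.
  - by move=> n ? _; rewrite lee_fin.
  - by move=> ? _ ? ? mn; rewrite lee_fin; exact/lefP/nd_nnsfun_approx.
under eq_fun do rewrite integral_nnsfun_normal.
rewrite -monotone_convergence//=.
- apply: eq_integral => x /[!inE] xD; apply/cvg_lim => //.
  apply: cvgeZr => //; exact: cvg_nnsfun_approx.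
- move=> n; apply: emeasurable_funM; first exact/measurable_EFinP/measurable_funTS.
  exact: measurable_EFin_normal_pdf.
- by move=> n x _; rewrite mule_ge0// lee_fin ?normal_pdf_ge0.
- move=> x _ a b ab; rewrite lee_wpmul2r// ?lee_fin ?normal_pdf_ge0//.
  exact/lefP/nd_nnsfun_approx.
Qed.
End density.
End GaussIntegral.

Section CGauss.
Variable R : realType.
Local Notation P := (@cgauss1 R).

Lemma cgauss1_pdfE (x : R) : normal_pdf 0 (Num.sqrt 2^-1) x =
  (Num.sqrt pi)^-1 * expR (- x ^+ 2).
Proof.
have s0 : Num.sqrt (2^-1 : R) != 0 by rewrite gt_eqF// sqrtr_gt0 invr_gt0.
have ss : Num.sqrt (2^-1 : R) ^+ 2 = 2^-1 by rewrite sqr_sqrtr// invr_ge0.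
rewrite normal_pdfE//= /normal_peak /normal_fun ss subr0.
rewrite (_ : 2^-1 * pi *+ 2 = pi :> R); last by rewrite -mulr_natr; field.
by rewrite (_ : 2^-1 *+ 2 = 1 :> R) ?divr1//; lra.
Qed.

Lemma measurable_exp_quad (t c : R) :
  measurable_fun setT (fun x : R => (expR (t * x ^+ 2 + c * x))%:E).
Proof.
apply/measurable_EFinP; apply: measurableT_comp => //.
apply: measurable_funD; apply: measurable_funM => //.
Qed.

Lemma integral_cgauss1_exp (t c : R) : t < 1 ->
  (\int[P]_x (expR (t * x ^+ 2 + c * x))%:E =
   (expR (c ^+ 2 / (4 * (1 - t))) * Num.sqrt ((1 - t)^-1))%:E)%E.
Proof.
move=> t1; have t10 : 0 < 1 - t by rewrite subr_gt0.
have tn : 1 - t != 0 by rewrite gt_eqF.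
rewrite ge0_integral_normal_prob//; last exact: measurable_exp_quad.
have sp : 0 < Num.sqrt (pi : R) by rewrite sqrtr_gt0 pi_gt0.
set K := expR (c ^+ 2 / (4 * (1 - t))) * (Num.sqrt pi)^-1.
have E x : expR (t * x ^+ 2 + c * x) * ((Num.sqrt pi)^-1 * expR (- x ^+ 2)) =
    K * expR (- ((1 - t) * (x - c / (2 * (1 - t))) ^+ 2)).
  rewrite /K mulrCA -expRD mulrAC -expRD [RHS]mulrC; congr (_ * expR _).
  by field.
transitivity (\int[lebesgue_measure]_x
    (K%:E * (expR (- ((1 - t) * (x - c / (2 * (1 - t))) ^+ 2)))%:E))%E.
  by apply: eq_integral => x _; rewrite cgauss1_pdfE -!EFinM E.
rewrite ge0_integralZl//=; first last.
- by rewrite lee_fin /K mulr_ge0 ?expR_ge0// invr_ge0 ltW.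
- apply/measurable_EFinP; apply: measurableT_comp => //; apply: measurableT_comp => //.
  apply: measurable_funM => //; apply: measurable_funX; exact: measurable_funB.
rewrite integral_gauss_scaled// -EFinM /K sqrtrM ?pi_ge0//; congr EFin.
by rewrite -mulrA mulKf// gt_eqF.
Qed.

(** The square of 1 + x^2/4 <= exp(x^2/4). A multiple of this exponential is integrable and
    dominates the powers of x needed as moments. *)
Lemma expR_half_sqr_ge (x : R) : 1 + x ^+ 2 / 2 + x ^+ 4 / 16 <= expR (2^-1 * x ^+ 2).
Proof.
have -> : 2^-1 * x ^+ 2 = x ^+ 2 / 4 + x ^+ 2 / 4 by field.
rewrite expRD -expr2.
have h : 1 + x ^+ 2 / 4 <= expR (x ^+ 2 / 4) by exact: expR_ge1Dx.
have h0 : 0 <= 1 + x ^+ 2 / 4 by have := sqr_ge0 x; lra.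
apply: le_trans (ler_pM h0 h0 h h); rewrite -expr2.
by lra.
Qed.

Lemma integrable_cgauss1_dominated (f : measurableTypeR R -> R) : measurable_fun setT f ->
  (forall x, `|f x| <= 16 * expR (2^-1 * x ^+ 2)) ->
  P.-integrable setT (fun x => (f x)%:E).
Proof.
move=> mf fle.
apply: (@le_integrable _ _ _ _ _ measurableT _
  (fun x : measurableTypeR R => (16 * expR (2^-1 * x ^+ 2))%:E)) => //.
- exact/measurable_EFinP.
- by move=> x _ /=; rewrite lee_fin (le_trans (fle x))// ler_norm.
apply/integrableP; split.
  apply/measurable_EFinP; apply: measurable_funM => //.
  by apply: measurableT_comp => //; apply: measurable_funM.
under eq_integral => x _ do rewrite gee0_abs ?lee_fin ?mulr_ge0 ?expR_ge0// EFinM.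
rewrite ge0_integralZl//=; last first.
  by apply/measurable_EFinP; apply: measurableT_comp => //; exact: measurable_funM.
under eq_integral => x _ do rewrite -[2^-1 * x ^+ 2]addr0 -[X in _ + X](mul0r x).
by rewrite integral_cgauss1_exp ?ltry//; lra.
Qed.

Lemma integrable_cgauss1_exp (t c : R) : t < 1 ->
  P.-integrable setT (fun x => (expR (t * x ^+ 2 + c * x))%:E).
Proof.
move=> t1; apply/integrableP; split; first exact: measurable_exp_quad.
under eq_integral => x _ do rewrite gee0_abs ?lee_fin ?expR_ge0//.
by rewrite integral_cgauss1_exp ?ltry.
Qed.

(** The moments are not computed but bounded: an inequality of the form polynomial <= exp(t x^2 + c
    x) is integrated with the closed formula for the right-hand side. An upper bound on the variance
    is enough, since noise energy is only ever bounded from above. *)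
Lemma cgauss1_moments : exists m2 m4 : R, [/\ 0 <= m2, m2 <= 2^-1, 0 <= m4 &
  forall A B D G : R,
  (\int[P]_x (A + B * x + D * x ^+ 2 + G * x ^+ 4)%:E = (A + D * m2 + G * m4)%:E)%E].
Proof.
have [I1 I2 I4] : [/\ P.-integrable setT (fun x => (x : R)%:E),
    P.-integrable setT (fun x => ((x : R) ^+ 2)%:E) &
    P.-integrable setT (fun x => ((x : R) ^+ 4)%:E)].
  split; apply: integrable_cgauss1_dominated => //= x;
    have h := expR_half_sqr_ge x; have h2 := sqr_ge0 x;
    have h4 : 0 <= x ^+ 4 by rewrite exprn_even_ge0.
  - by rewrite ler_norml; nra.
  - by rewrite ger0_norm//; lra.
  - by rewrite ger0_norm//; lra.
pose m1 := fine (\int[P]_x (x : R)%:E); pose m2 := fine (\int[P]_x ((x : R) ^+ 2)%:E).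
pose m4 := fine (\int[P]_x ((x : R) ^+ 4)%:E).
have m1E : (\int[P]_x (x : R)%:E = m1%:E)%E by rewrite fineK// integrable_fin_num.
have m2E : (\int[P]_x ((x : R) ^+ 2)%:E = m2%:E)%E by rewrite fineK// integrable_fin_num.
have m4E : (\int[P]_x ((x : R) ^+ 4)%:E = m4%:E)%E by rewrite fineK// integrable_fin_num.
have IA (A : R) : P.-integrable setT (fun x => A%:E).
  exact: (finite_measure_integrable_cst P A).
have IZ (f : measurableTypeR R -> R) c : P.-integrable setT (fun x => (f x)%:E) ->
    P.-integrable setT (fun x => (c * f x)%:E).
  by move=> If; under eq_fun do rewrite EFinM; exact: integrableZl.
have ID (f g : measurableTypeR R -> R) : P.-integrable setT (fun x => (f x)%:E) ->
    P.-integrable setT (fun x => (g x)%:E) ->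
    P.-integrable setT (fun x => (f x + g x)%:E).
  by move=> If Ig; under eq_fun do rewrite EFinD; exact: integrableD.
have I01 (A B : R) := ID (fun=> A) (fun x => B * x) (IA A) (IZ (fun x => x) B I1).
have I012 (A B D : R) := ID (fun x => A + B * x) (fun x => D * x ^+ 2)
  (I01 A B) (IZ (fun x => x ^+ 2) D I2).
have Ip (A B D G : R) := ID (fun x => A + B * x + D * x ^+ 2) (fun x => G * x ^+ 4)
  (I012 A B D) (IZ (fun x => x ^+ 4) G I4).
have pE (A B D G : R) : (\int[P]_x (A + B * x + D * x ^+ 2 + G * x ^+ 4)%:E =
    (A + B * m1 + D * m2 + G * m4)%:E)%E.
  have DE (f g : measurableTypeR R -> R) c a b : P.-integrable setT (fun x => (f x)%:E) ->
      P.-integrable setT (fun x => (g x)%:E) ->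
      (\int[P]_x (f x)%:E = a%:E)%E -> (\int[P]_x (g x)%:E = b%:E)%E ->
      (\int[P]_x (f x + c * g x)%:E = (a + c * b)%:E)%E.
    move=> If Ig fa gb; under eq_integral do rewrite EFinD EFinM.
    by rewrite integralD//= ?integralZl// ?fa ?gb//; exact: integrableZl.
  apply: (DE _ _ _ _ _ (I012 A B D) I4) m4E.
  apply: (DE _ _ _ _ _ (I01 A B) I2) m2E.
  apply: (DE _ _ _ _ _ (IA A) I1) m1E.
  by rewrite integral_cst//= probability_setT mule1.
have le_exp (A B D t c : R) : t < 1 ->
    (forall x, A + B * x + D * x ^+ 2 <= expR (t * x ^+ 2 + c * x)) ->
    A + B * m1 + D * m2 <= expR (c ^+ 2 / (4 * (1 - t))) * Num.sqrt ((1 - t)^-1).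
  move=> t1 h; rewrite -lee_fin -integral_cgauss1_exp//.
  have := pE A B D 0; rewrite mul0r addr0 => <-.
  apply: le_integral => //; first exact: integrable_cgauss1_exp.
  by move=> x _; rewrite lee_fin mul0r addr0.
have m2_ge0 : 0 <= m2.
  by rewrite -lee_fin -m2E; apply: integral_ge0 => x _; rewrite lee_fin sqr_ge0.
have m1_0 : m1 = 0.
  apply/eqP/negPn/negP => m10.
  (* From 1 + c x <= exp(c x) one gets 1 + c m1 <= exp(c^2/4), which fails when c is a small
     multiple of m1; t makes it small enough. *)
  have a0 : 0 < m1 ^+ 2 by rewrite exprn_even_gt0.
  set a := m1 ^+ 2 in a0; pose t := (1 + a)^-1; pose c := m1 * t.
  have t0 : 0 < t by rewrite invr_gt0; lra.
  have ta : t * (1 + a) = 1 by rewrite mulVf// gt_eqF//; lra.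
  have h : 1 + c * m1 <= expR (c ^+ 2 / 4).
    have := le_exp 1 c 0 0 c ltr01; rewrite mul0r addr0 subr0 invr1 sqrtr1 !mulr1; apply.
    by move=> x; rewrite !mul0r addr0 add0r expR_ge1Dx.
  have hu : 1 - c ^+ 2 / 4 <= expR (- (c ^+ 2 / 4)).
    by have := expR_ge1Dx (- (c ^+ 2 / 4)).
  have cm : c * m1 = t * a by rewrite /c /a; ring.
  have cc : c ^+ 2 = t ^+ 2 * a by rewrite /c /a; ring.
  have t1 : t < 1 by nra.
  have h1 : (1 + t * a) * (1 - t ^+ 2 * a / 4) <= 1.
    rewrite -[leRHS](expRxMexpNx_1 (c ^+ 2 / 4)) -cm -cc; apply: ler_pM => //.
      by rewrite cm; nra.
    by rewrite cc; nra.
  have ta1 : t * a = 1 - t by lra.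
  have ta2 : t ^+ 2 * a = t * (1 - t) by rewrite expr2 -mulrA ta1.
  have h3 : 0 < (1 - t) * (1 - (2 - t) * t / 4) by rewrite mulr_gt0//; nra.
  suff : (1 : R) < 1 by rewrite ltxx.
  by rewrite ta1 ta2 in h1; lra.
have m2_le : m2 <= 2^-1.
  rewrite leNgt; apply/negP => m2h.
  (* The bound 1 + t m2 <= (1 - t)^(-1/2) forces 2 e <= 2 t m2, while t is chosen so that 2 t m2 =
     e. *)
  pose e := m2 - 2^-1; have e0 : 0 < e by rewrite subr_gt0.
  pose t := e / (1 + 2 * e).
  have te : t * (1 + 2 * e) = e by rewrite divfK// gt_eqF//; lra.
  have t0 : 0 < t by rewrite divr_gt0//; lra.
  have t1 : t < 1 by nra.
  have := le_exp 1 0 t t 0 t1; rewrite expr0n/= !mul0r expR0 mul1r addr0 => h.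
  have {}h : 1 + t * m2 <= Num.sqrt (1 - t)^-1.
    by apply: h => x; rewrite !mul0r !addr0 expR_ge1Dx.
  have h2 : (1 + t * m2) ^+ 2 <= (1 - t)^-1.
    have t10 : 0 <= (1 - t)^-1 by rewrite invr_ge0; lra.
    rewrite -[leRHS](sqr_sqrtr t10) ler_pXn2r// nnegrE ?sqrtr_ge0//.
    by rewrite addr_ge0// mulr_ge0// ltW.
  have h3 : (1 + t * m2) ^+ 2 * (1 - t) <= 1.
    by rewrite -ler_pdivlMr ?mul1r//; lra.
  have m2e : m2 = 2^-1 + e by rewrite /e; lra.
  suff : (1 : R) < 1 by rewrite ltxx.
  have h4 : 1 + 2 * (t * m2) <= (1 + t * m2) ^+ 2 by have := sqr_ge0 (t * m2); lra.
  have h5 : (1 + 2 * (t * m2)) * (1 - t) <= 1 by nra.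
  have tt : 0 < t * t by rewrite mulr_gt0.
  by rewrite m2e in h5; nra.
exists m2, m4; split => //.
  by rewrite -lee_fin -m4E; apply: integral_ge0 => x _; rewrite lee_fin exprn_even_ge0.
by move=> A B D G; rewrite pE m1_0 mulr0 addr0.
Qed.
End CGauss.

Section GaussTuple.
Variable R : realType.
Local Notation P := (@cgauss1 R).

(** Centring the diagonal products by m2 makes c the mean when the coordinates are independent,
    centred and of variance m2. *)
Definition quad_poly (m2 : R) (K : nat) (c : R) (l : 'I_K -> R) (q : 'I_K -> 'I_K -> R)
    (t : K.-tuple R) : R :=
  c + \sum_i l i * tnth t i
    + \sum_i \sum_j q i j * (tnth t i * tnth t j - (i == j)%:R * m2).

(** The class is stable under freezing the first coordinate, which is what an induction along the
    iterated integral requires. *)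
Lemma quad_poly_cons (m2 : R) K c (l : 'I_K.+1 -> R) (q : 'I_K.+1 -> 'I_K.+1 -> R)
    (x : R) (t : K.-tuple R) :
  quad_poly m2 c l q (cons_tuple x t) =
  quad_poly m2 (c + l ord0 * x + q ord0 ord0 * (x ^+ 2 - m2))
    (fun i => l (lift ord0 i) + (q ord0 (lift ord0 i) + q (lift ord0 i) ord0) * x)
    (fun i j => q (lift ord0 i) (lift ord0 j)) t.
Proof.
rewrite /quad_poly.
have -> : \sum_i l i * tnth (cons_tuple x t) i =
    l ord0 * x + \sum_i l (lift ord0 i) * tnth t i.
  by rewrite big_ord_recl tnth0; congr (_ + _); apply: eq_bigr => i _; rewrite tnthS.
pose S := \sum_i \sum_j q (lift ord0 i) (lift ord0 j)
  * (tnth t i * tnth t j - (i == j)%:R * m2).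
have -> : \sum_i \sum_j q i j * (tnth (cons_tuple x t) i * tnth (cons_tuple x t) j
      - (i == j)%:R * m2) =
    q ord0 ord0 * (x ^+ 2 - m2) + \sum_j q ord0 (lift ord0 j) * (x * tnth t j)
    + (\sum_i q (lift ord0 i) ord0 * (tnth t i * x) + S).
  rewrite big_ord_recl; congr (_ + _).
    rewrite big_ord_recl !tnth0 eqxx mul1r expr2; congr (_ + _).
    by apply: eq_bigr => j _; rewrite tnthS mul0r subr0.
  rewrite /S -big_split; apply: eq_bigr => i _ /=.
  rewrite big_ord_recl tnthS tnth0 mul0r subr0; congr (_ + _).
  by apply: eq_bigr => j _; rewrite tnthS (inj_eq lift_inj).
have -> : \sum_(i < K) (l (lift ord0 i) + (q ord0 (lift ord0 i) + q (lift ord0 i) ord0) * x)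
      * tnth t i = \sum_(i < K) l (lift ord0 i) * tnth t i
    + (\sum_(i < K) q ord0 (lift ord0 i) * (x * tnth t i)
    + \sum_(i < K) q (lift ord0 i) ord0 * (tnth t i * x)).
  by rewrite -!big_split; apply: eq_bigr => i _ /=; ring.
by rewrite -/S; ring.
Qed.

Lemma measurable_quad_poly m2 K c l q :
  measurable_fun setT (@quad_poly m2 K c l q).
Proof.
apply: measurable_funD; first apply: measurable_funD => //.
  apply: measurable_sum => i; apply: measurable_funM => //; exact: measurable_tnth.
apply: measurable_sum => i; apply: measurable_sum => j; apply: measurable_funM => //.
apply: measurable_funB => //; apply: measurable_funM; exact: measurable_tnth.
Qed.

(** [gauss_tuple] is a mere set function; on measurable sets it agrees with a probability, built by
    pushing the product of one coordinate and K coordinates along cons. The second-moment constant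
    is the same for all K: freezing one coordinate and integrating it last does not make it grow. *)
Lemma gauss_tuple_law : exists2 mC : R * R, 0 <= mC.1 <= 2^-1 /\ 0 < mC.2 &
  forall K, exists mu : probability (K.-tuple R) R,
  (forall A : set (K.-tuple R), measurable A -> gauss_tuple A = mu A) /\
  (forall c l q, (\int[mu]_t ((@quad_poly mC.1 K c l q t) ^+ 2)%:E <=
     (c ^+ 2 + mC.2 * (\sum_i l i ^+ 2 + \sum_i \sum_j q i j ^+ 2))%:E)%E).
Proof.
have [m2 [m4 [m2_ge0 m2_le m4_ge0 polyE]]] := cgauss1_moments R.
pose C0 := 2 + 2 * m4.
have C0_ge : 2 <= C0 by rewrite /C0; lra.
exists (m2, C0) => /=; first by split; [exact/andP|lra].
elim=> [|K [mu [muE IH]]].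
  exists (\d_([tuple] : 0.-tuple R)); split => [A mA//|c l q].
  rewrite integral_dirac//; last first.
    by apply/measurable_EFinP; apply: measurable_funX; exact: measurable_quad_poly.
  rewrite diracT mul1e lee_fin /quad_poly !big_ord0 /= !addr0.
  by rewrite mulr0 addr0.
pose phi (z : measurableTypeR R * K.-tuple R) : K.+1.-tuple R := cons_tuple z.1 z.2.
have mphi : measurable_fun setT phi.
  exact: (@measurable_cons _ _ _ (measurableTypeR R) fst K snd).
pose phi' : {mfun _ >-> _} := HB.pack phi (isMeasurableFun.Build _ _ _ _ phi mphi).
exists (distribution (P \x mu)%E phi'); split.
  move=> A mA; rewrite /distribution /pushforward /=.
  rewrite /product_measure1 /=; apply: eq_integral => x _.
  rewrite muE; last first.
    have := measurable_xsection x (mphi measurableT A mA); rewrite setTI.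
    by congr measurable; apply/seteqP; split => t; rewrite /xsection/= inE.
  by congr (mu _); apply/seteqP; split => t; rewrite /xsection/= inE.
move=> c l q.
have mf : measurable_fun setT (fun t : K.+1.-tuple R => (quad_poly m2 c l q t ^+ 2)%:E).
  by apply/measurable_EFinP; apply: measurable_funX; exact: measurable_quad_poly.
rewrite ge0_integral_distribution//; last by move=> x; rewrite lee_fin sqr_ge0.
rewrite fubini_tonelli1; last 2 first.
  exact: measurableT_comp.
  by move=> z; rewrite lee_fin sqr_ge0.
pose m (i : 'I_K) := q ord0 (lift ord0 i) + q (lift ord0 i) ord0.
pose Sl := \sum_(i < K) l (lift ord0 i) ^+ 2.
pose Slm := \sum_(i < K) l (lift ord0 i) * m i.
pose Sm := \sum_(i < K) m i ^+ 2.
pose Q := \sum_(i < K) \sum_(j < K) q (lift ord0 i) (lift ord0 j) ^+ 2.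
pose l0 := l ord0; pose q0 := q ord0 ord0.
pose A := c ^+ 2 - 2 * c * q0 * m2 + 2 * q0 ^+ 2 * m2 ^+ 2 + C0 * Sl + C0 * Q.
pose B := 2 * c * l0 + 2 * C0 * Slm.
pose D := 2 * c * q0 + 2 * l0 ^+ 2 + C0 * Sm.
pose G := 2 * q0 ^+ 2.
have inner (x : R) : (\int[mu]_t (quad_poly m2 c l q (cons_tuple x t) ^+ 2)%:E <=
    (A + B * x + D * x ^+ 2 + G * x ^+ 4)%:E)%E.
  under eq_integral do rewrite quad_poly_cons.
  apply: (le_trans (IH _ _ _)); rewrite lee_fin -/Q -/l0 -/q0.
  have -> : \sum_(i < K) (l (lift ord0 i) + (q ord0 (lift ord0 i) + q (lift ord0 i) ord0) * x) ^+ 2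
      = Sl + 2 * x * Slm + x ^+ 2 * Sm.
    rewrite /Sl /Slm /Sm !mulr_sumr -!big_split; apply: eq_bigr => i _ /=.
    by rewrite -/(m i); ring.
  have h1 : (l0 * x + q0 * (x ^+ 2 - m2)) ^+ 2 <=
      2 * l0 ^+ 2 * x ^+ 2 + 2 * q0 ^+ 2 * (x ^+ 4 + m2 ^+ 2).
    have h2 : (l0 * x + q0 * (x ^+ 2 - m2)) ^+ 2 <=
        2 * (l0 * x) ^+ 2 + 2 * (q0 * (x ^+ 2 - m2)) ^+ 2.
      by have := sqr_ge0 (l0 * x - q0 * (x ^+ 2 - m2)); nra.
    have h3 : 0 <= q0 ^+ 2 * (x ^+ 2 * m2) 
      by apply: mulr_ge0 (sqr_ge0 _) (mulr_ge0 (sqr_ge0 _) m2_ge0).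
    by nra.
  by rewrite /A /B /D /G; nra.
apply: (@le_trans _ _ (\int[P]_x (A + B * x + D * x ^+ 2 + G * x ^+ 4)%:E)%E).
  apply: ge0_le_integral => //.
  - by move=> x _; apply: integral_ge0 => t _; rewrite lee_fin sqr_ge0.
  - apply: measurable_fun_fubini_tonelli_F.
    + exact: measurableT_comp.
    + by move=> z; rewrite lee_fin sqr_ge0.
  - apply/measurable_EFinP; do ! apply: measurable_funD => //.
    + exact: measurable_funM.
    + exact: measurable_funM.
  - by move=> x _; exact: inner.
rewrite polyE lee_fin.
have -> : \sum_(i < K.+1) l i ^+ 2 = l0 ^+ 2 + Sl by rewrite big_ord_recl.
pose S0 := \sum_(i < K) (q ord0 (lift ord0 i) ^+ 2 + q (lift ord0 i) ord0 ^+ 2).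
have -> : \sum_(i < K.+1) \sum_(j < K.+1) q i j ^+ 2 = q0 ^+ 2 + S0 + Q.
  rewrite big_ord_recl big_ord_recl -/q0 /S0 /Q big_split /= -!addrA; congr (_ + (_ + _)).
  by rewrite -big_split; apply: eq_bigr => i _; rewrite big_ord_recl.
have Sm_le : Sm <= 2 * S0.
  rewrite /Sm /S0 mulr_sumr; apply: ler_sum => i _; rewrite /m.
  by have := sqr_ge0 (q ord0 (lift ord0 i) - q (lift ord0 i) ord0); nra.
have Sm_ge0 : 0 <= Sm by apply: sumr_ge0 => i _; exact: sqr_ge0.
have h1 : C0 * Sm * m2 <= C0 * S0.
  by rewrite -mulrA ler_pM2l; [nra|lra].
have h2 : 2 * l0 ^+ 2 * m2 <= C0 * l0 ^+ 2 by have := sqr_ge0 l0; nra.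
have h3 : 2 * q0 ^+ 2 * m2 ^+ 2 + 2 * q0 ^+ 2 * m4 <= C0 * q0 ^+ 2.
  have h4 : m2 ^+ 2 <= 1 by nra.
  by have := sqr_ge0 q0; rewrite /C0; nra.
by rewrite /A /D /G; nra.
Qed.
End GaussTuple.

Section RealForms.
Variable R : realType.
Local Notation C := R[i].

Definition nsq (x : C) : R := (complex.Re x) ^+ 2 + (complex.Im x) ^+ 2.

Lemma nsq_ge0 x : 0 <= nsq x.
Proof. by rewrite addr_ge0 ?sqr_ge0. Qed.

Definition cpart (b : bool) (x : C) : R := if b then complex.Im x else complex.Re x.

(** [ccoef z b b'] is the coefficient of the [b']-part of [x] in the [b]-part of
    [z * x], where [false] and [true] stand for the real and imaginary parts. *)
Definition ccoef (z : C) (b b' : bool) : R :=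
  match b, b' with
  | false, false => complex.Re z
  | false, true => - complex.Im z
  | true, false => complex.Im z
  | true, true => complex.Re z
  end.

Lemma cpartD b x y : cpart b (x + y) = cpart b x + cpart b y.
Proof. by case: b x y => -[? ?] [? ?]. Qed.

Lemma cpart_sum b (I : finType) (F : I -> C) : cpart b (\sum_i F i) = \sum_i cpart b (F i).
Proof.
apply: (big_morph (cpart b)) => [x y|]; first exact: cpartD.
by case: b.
Qed.

Lemma cpartM b z x : cpart b (z * x) = \sum_b' ccoef z b b' * cpart b' x.
Proof. by rewrite big_bool; case: b z x => -[? ?] [? ?] /=; ring. Qed.

Lemma nsqE x : nsq x = \sum_b cpart b x ^+ 2.
Proof. by rewrite big_bool /nsq addrC. Qed.

Lemma sum_ccoef2 z : \sum_b \sum_b' ccoef z b b' ^+ 2 = 2 * nsq z.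
Proof. by rewrite !big_bool /nsq /=; ring. Qed.

Lemma ccoef2_le z b b' : ccoef z b b' ^+ 2 <= nsq z.
Proof. by rewrite /nsq; case: b; case: b'; rewrite /= ?sqrrN ?lerDl ?lerDr sqr_ge0. Qed.

Lemma cpart2_le z b : cpart b z ^+ 2 <= nsq z.
Proof. by rewrite /nsq; case: b; rewrite /= ?lerDl ?lerDr sqr_ge0. Qed.

Lemma nsq_affine k (h : C) (L : 'I_k -> C) (x : 'I_k -> C) :
  nsq (h + \sum_a L a * x a) =
  \sum_b (cpart b h + \sum_(s : 'I_k * bool) ccoef (L s.1) b s.2 * cpart s.2 (x s.1)) ^+ 2.
Proof.
rewrite nsqE; apply: eq_bigr => b _; rewrite cpartD cpart_sum.
under eq_bigr do rewrite cpartM.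
by rewrite pair_bigA.
Qed.

Lemma sum_ccoef2_vec k (L : 'I_k -> C) :
  \sum_b \sum_(s : 'I_k * bool) ccoef (L s.1) b s.2 ^+ 2 = 2 * \sum_a nsq (L a).
Proof.
rewrite mulr_sumr; under [RHS]eq_bigr do rewrite -sum_ccoef2.
rewrite exchange_big/= (eq_bigr (fun s : 'I_k * bool => \sum_b ccoef (L s.1) b s.2 ^+ 2))//.
rewrite -(pair_bigA _ (fun a b' => \sum_b ccoef (L a) b b' ^+ 2)) /=.
by apply: eq_bigr => a _; rewrite exchange_big.
Qed.
End RealForms.

Section GaussProb.
Variable R : realType.

Let mC : R * R := s2val (cid2 (gauss_tuple_law R)).

Definition gauss_prob (K : nat) : probability (K.-tuple R) R :=
  sval (cid (s2valP' (cid2 (gauss_tuple_law R)) K)).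

Definition gauss_var : R := mC.1.
Definition gauss_cst : R := mC.2.

Lemma gauss_var_le : gauss_var <= 2^-1.
Proof. by rewrite /gauss_var /mC; case: cid2 => -[m c] /= [/andP[]]. Qed.

Lemma gauss_cst_gt0 : 0 < gauss_cst.
Proof. by rewrite /gauss_cst /mC; case: cid2 => -[m c] /= []. Qed.

Lemma gauss_tupleE K (A : set (K.-tuple R)) : measurable A ->
  gauss_tuple A = gauss_prob K A.
Proof. by rewrite /gauss_prob; case: cid => mu [+ _] /=; apply. Qed.

Lemma integral_quad_poly_sqr K c l q :
  (\int[gauss_prob K]_t (quad_poly gauss_var c l q t ^+ 2)%:E <=
     (c ^+ 2 + gauss_cst * (\sum_i l i ^+ 2 + \sum_i \sum_j q i j ^+ 2))%:E)%E.
Proof. by rewrite /gauss_prob; case: cid => mu [_ +] /=; apply. Qed.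

Lemma quad_poly_tail K l q (e : R) : 0 < e ->
  (gauss_prob K [set t | (e <= quad_poly gauss_var 0 l q t)%R] <=
    (gauss_cst * (\sum_i l i ^+ 2 + \sum_i \sum_j q i j ^+ 2) / e ^+ 2)%:E)%E.
Proof.
move=> e0; set A := [set t | _].
have mA : measurable A.
  rewrite /A -[X in measurable X]setTI.
  by apply: measurable_fun_le => //; exact: measurable_quad_poly.
have e20 : 0 < e ^+ 2 by rewrite exprn_gt0.
rewrite mulrC EFinM lee_pdivlMl// -integral_cst//.
apply: le_trans (_ : _ <= \int[gauss_prob K]_t (quad_poly gauss_var 0 l q t ^+ 2)%:E)%E _;
  last first.
  by apply: le_trans (integral_quad_poly_sqr _ _ _) _; rewrite expr0n/= add0r.
apply: le_trans (_ : _ <= \int[gauss_prob K]_(t in A) (quad_poly gauss_var 0 l q t ^+ 2)%:E)%E _.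
  apply: ge0_le_integral => //.
  - by move=> t _; rewrite lee_fin ltW.
  - apply/measurable_EFinP; apply: measurable_funTS; apply: measurable_funX.
    exact: measurable_quad_poly.
  - by move=> t At; rewrite lee_fin ler_pXn2r// nnegrE ?(ltW e0)//; exact: le_trans (ltW e0) At.
apply: ge0_subset_integral => //.
- by apply/measurable_EFinP; apply: measurable_funX; exact: measurable_quad_poly.
- by move=> t _; rewrite lee_fin sqr_ge0.
Qed.
End GaussProb.

Section BlockChebyshev.
Variables (R : realType) (A J : finType).

Lemma sum_mul (I : finType) (F G : I -> R) :
  (\sum_i F i) * (\sum_i G i) = \sum_i \sum_j F i * G j.
Proof. by rewrite mulr_suml; apply: eq_bigr => i _; rewrite mulr_sumr. Qed.

Lemma sum_cst (I : finType) (c : R) : \sum_(i : I) c = #|I|%:R * c.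
Proof. by rewrite sumr_const mulr_natl. Qed.

Lemma sum_pair (I I' : finType) (F : I * I' -> R) :
  \sum_s F s = \sum_i \sum_j F (i, j).
Proof. by rewrite pair_bigA; apply: eq_bigr => -[]. Qed.

(** Sorts a weighted sum of squared affine forms by degree. With m2 the coordinate variance, the
    first sum is its mean and the rest is a centred quadratic polynomial, ready for Chebyshev. *)
Lemma block_quad_expand n (m2 : R) (om : 'I_n -> J -> R) (h : 'I_n -> J -> R)
    (l : 'I_n -> J -> A -> R) (z : 'I_n * A -> R) :
  \sum_t \sum_j om t j * (h t j + \sum_a l t j a * z (t, a)) ^+ 2 =
  \sum_t \sum_j om t j * (h t j ^+ 2 + m2 * \sum_a l t j a ^+ 2)
  + \sum_s (2 * \sum_j om s.1 j * h s.1 j * l s.1 j s.2) * z s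
  + \sum_s \sum_s' ((s.1 == s'.1)%:R * \sum_j om s.1 j * l s.1 j s.2 * l s.1 j s'.2)
      * (z s * z s' - (s == s')%:R * m2).
Proof.
rewrite !sum_pair /=.
rewrite -!big_split /=; apply: eq_bigr => t _.
have -> : \sum_a \sum_s' ((t == s'.1)%:R *
      \sum_j om t j * l t j a * l t j s'.2) * (z (t, a) * z s' - ((t, a) == s')%:R * m2) =
    \sum_a \sum_a' (\sum_j om t j * l t j a * l t j a')
      * (z (t, a) * z (t, a') - (a == a')%:R * m2).
  apply: eq_bigr => a _.
  rewrite sum_pair /=.
  rewrite (bigD1 t)//= [X in _ + X]big1 ?addr0; last first.
    by move=> t' /negbTE nt; apply: big1 => a' _; rewrite eq_sym nt mul0r mul0r.
  by apply: eq_bigr => a' _; rewrite eqxx mul1r xpair_eqE eqxx.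
have e1 : \sum_a (2 * \sum_j om t j * h t j * l t j a) * z (t, a) =
    \sum_j om t j * (2 * h t j * \sum_a l t j a * z (t, a)).
  under eq_bigr do rewrite -mulrA mulr_suml mulr_sumr.
  rewrite exchange_big; apply: eq_bigr => j _.
  rewrite mulr_sumr mulr_sumr; apply: eq_bigr => a _; ring.
have e2 : \sum_a \sum_a' (\sum_j om t j * l t j a * l t j a')
      * (z (t, a) * z (t, a') - (a == a')%:R * m2) =
    \sum_j om t j * ((\sum_a l t j a * z (t, a)) ^+ 2 - m2 * \sum_a l t j a ^+ 2).
  under eq_bigr do under eq_bigr do rewrite mulr_suml.
  under eq_bigr do rewrite exchange_big.
  rewrite exchange_big; apply: eq_bigr => j _ /=.
  rewrite expr2 sum_mul mulr_sumr -sumrB mulr_sumr; apply: eq_bigr => a _.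
  have -> : m2 * l t j a ^+ 2 = \sum_a' l t j a * l t j a' * ((a == a')%:R * m2).
    rewrite (bigD1 a)//= eqxx big1 ?addr0 => [|a' /negbTE na].
      by rewrite mul1r expr2 mulrC.
    by rewrite eq_sym na mul0r mulr0.
  rewrite -sumrB mulr_sumr; apply: eq_bigr => a' _; ring.
rewrite e1 e2 -!big_split /=; apply: eq_bigr => j _; ring.
Qed.

(** Coordinates of different times are not coupled, so the squared coefficients sum to O(n) rather
    than O(n^2); deviations linear in n thus have probability O(1/n). *)
Lemma block_quad_tail (Om H La : R) : 0 <= Om -> 0 <= H -> 0 <= La ->
  exists2 Cst : R, 0 <= Cst &
  forall n K (idx : 'I_n * A -> 'I_K), bijective idx ->
  forall (om h : 'I_n -> J -> R) (l : 'I_n -> J -> A -> R),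
  (forall t j, 0 <= om t j <= Om) -> (forall t j, h t j ^+ 2 <= H) ->
  (forall t j a, l t j a ^+ 2 <= La) -> forall e : R, 0 < e ->
  (gauss_prob R K [set z |
    \sum_t \sum_j om t j * (h t j ^+ 2 + gauss_var R * \sum_a l t j a ^+ 2) + e <=
    \sum_t \sum_j om t j * (h t j + \sum_a l t j a * tnth z (idx (t, a))) ^+ 2]%R
  <= (n%:R * Cst / e ^+ 2)%:E)%E.
Proof.
move=> Om0 H0 La0.
pose cJ : R := #|J|%:R; pose cA : R := #|A|%:R.
pose Cl := 2 * cJ * (Om * (H + La)); pose Cq := cJ * (Om * La).
have cJ0 : 0 <= cJ by rewrite ler0n.
have cA0 : 0 <= cA by rewrite ler0n.
pose Cst := gauss_cst R * (cA * Cl ^+ 2 + cA * (cA * Cq ^+ 2)).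
exists Cst.
  apply: mulr_ge0; first exact: ltW (gauss_cst_gt0 R).
  by apply: addr_ge0; [|apply: mulr_ge0 => //]; apply: mulr_ge0 (sqr_ge0 _).
move=> n K idx [g idxK gK] om h l om_b h_b l_b e e0.
pose lS (s : 'I_n * A) := 2 * \sum_j om s.1 j * h s.1 j * l s.1 j s.2.
pose qS (s s' : 'I_n * A) := (s.1 == s'.1)%:R * \sum_j om s.1 j * l s.1 j s.2 * l s.1 j s'.2.
have idxb : {on predT, bijective idx} by apply: onW_bij; exists g.
pose L i := lS (g i); pose Q i i' := qS (g i) (g i').
have quadE z : quad_poly (gauss_var R) 0 L Q z =
    \sum_s lS s * tnth z (idx s)
    + \sum_s \sum_s' qS s s' * (tnth z (idx s) * tnth z (idx s') - (s == s')%:R * gauss_var R).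
  rewrite /quad_poly add0r (reindex idx)//=; congr (_ + _).
    by apply: eq_bigr => s _; rewrite /L idxK.
  rewrite (reindex idx)//=; apply: eq_bigr => s _.
  rewrite (reindex idx)//=; apply: eq_bigr => s' _.
  by rewrite /Q !idxK (can_eq idxK).
have absle (x y : R) a b : x ^+ 2 <= a -> y ^+ 2 <= b -> `|x * y| <= a + b.
  move=> xa yb; rewrite ler_norml; have := sqr_ge0 (x - y); have := sqr_ge0 (x + y).
  by nra.
have sqr_bd (x c : R) : `|x| <= c -> x ^+ 2 <= c ^+ 2.
  by move=> xc; rewrite -real_normK ?num_real// ler_pXn2r// nnegrE (le_trans _ xc).
have sumJ (F : J -> R) c : (forall j, `|F j| <= c) -> `|\sum_j F j| <= cJ * c.
  move=> Fc; apply: le_trans (ler_norm_sum _ _ _) _.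
  apply: le_trans (ler_sum _ (fun j _ => Fc j)) _.
  by rewrite sum_cst.
have lS_b s : lS s ^+ 2 <= Cl ^+ 2.
  apply: sqr_bd; rewrite /lS /Cl normrM ger0_norm// -mulrA ler_pM2l//.
  apply: sumJ => j; rewrite -mulrA normrM.
  have /andP[p0 p1] := om_b s.1 j; rewrite (ger0_norm p0).
  by apply: ler_pM => //; exact: absle.
have qS_b t a a' : qS (t, a) (t, a') ^+ 2 <= Cq ^+ 2.
  apply: sqr_bd; rewrite /qS /Cq eqxx mul1r.
  apply: sumJ => j; rewrite -mulrA normrM /=.
  have /andP[p0 p1] := om_b t j; rewrite (ger0_norm p0).
  apply: ler_pM => //; rewrite ler_norml.
  have := l_b t j a; have := l_b t j a'.
  by have := sqr_ge0 (l t j a - l t j a'); have := sqr_ge0 (l t j a + l t j a'); nra.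
have sumL : \sum_i L i ^+ 2 <= n%:R * (cA * Cl ^+ 2).
  rewrite (reindex idx)//= sum_pair.
  apply: (@le_trans _ _ (\sum_(t < n) \sum_(a : A) Cl ^+ 2)).
    by apply: ler_sum => t _; apply: ler_sum => a _; rewrite /L idxK lS_b.
  by rewrite !sum_cst card_ord.
have sumQ : \sum_i \sum_j Q i j ^+ 2 <= n%:R * (cA * (cA * Cq ^+ 2)).
  rewrite (reindex idx)//= sum_pair.
  apply: (@le_trans _ _ (\sum_(t < n) \sum_(a : A) \sum_(a' : A) Cq ^+ 2)).
    apply: ler_sum => t _; apply: ler_sum => a _.
    rewrite (reindex idx)//= sum_pair (bigD1 t)//= [X in _ + X]big1 ?addr0.
      by apply: ler_sum => a' _; rewrite /Q !idxK qS_b.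
    move=> t' /negbTE nt; apply: big1 => a' _.
    by rewrite /Q !idxK /qS /= eq_sym nt mul0r expr0n.
  by rewrite !sum_cst card_ord.
apply: le_trans (_ : _ <= gauss_prob R K [set z | (e <= quad_poly (gauss_var R) 0 L Q z)%R])%E _.
  rewrite (_ : [set z | _] = [set z | e <= quad_poly (gauss_var R) 0 L Q z])//.
  apply/seteqP; split=> z /=; rewrite quadE.
    rewrite (block_quad_expand (gauss_var R) om h l (fun s => tnth z (idx s))).
    by rewrite -addrA lerD2l.
  rewrite (block_quad_expand (gauss_var R) om h l (fun s => tnth z (idx s))).
  by rewrite -addrA lerD2l.
apply: le_trans (quad_poly_tail _ _ e0) _.
rewrite lee_fin ler_pM2r ?invr_gt0 ?exprn_gt0// /Cst mulrCA ler_pM2l ?gauss_cst_gt0//.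
by rewrite mulrDr lerD.
Qed.
End BlockChebyshev.

Section Noise.
Variable R : realType.
Local Notation C := R[i].

Definition noise_idx (k n : nat) (s : 'I_n * ('I_k * bool)) : 'I_(k * n + k * n) :=
  if s.2.2 then rshift (k * n) (mxvec_index s.2.1 s.1)
  else lshift (k * n) (mxvec_index s.2.1 s.1).

Lemma mxvec_index_inj2 (k n : nat) (a a' : 'I_k) (t t' : 'I_n) :
  mxvec_index a t = mxvec_index a' t' -> a = a' /\ t = t'.
Proof. by move=> /cast_ord_inj /enum_rank_inj []. Qed.

Lemma noise_idx_bij k n : bijective (@noise_idx k n).
Proof.
apply: inj_card_bij; last first.
  by rewrite !card_prod !card_ord card_bool mulnA (mulnC n k) addnn -muln2.
move=> [t [a b]] [t' [a' b']]; rewrite /noise_idx /=.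
case: b; case: b' => /=.
- by move=> /rshift_inj /mxvec_index_inj2 [-> ->].
- by move=> /eqP; rewrite eq_rlshift.
- by move=> /eqP; rewrite eq_lrshift.
- by move=> /lshift_inj /mxvec_index_inj2 [-> ->].
Qed.

Lemma cpart_noise_mx k n (z : (k * n + k * n).-tuple R) a t b :
  cpart b (noise_mx z a t) = tnth z (noise_idx (t, (a, b))).
Proof. by rewrite /noise_mx !mxE /noise_idx; case: b. Qed.

Lemma noise_metricE m k n (om : 'I_n -> 'I_m -> R) (h : 'I_n -> 'I_m -> C)
    (L : 'I_n -> 'M[C]_(m, k)) (z : (k * n + k * n).-tuple R) :
  \sum_t \sum_j om t j * nsq (h t j + (L t *m col t (noise_mx z)) j 0) =
  \sum_t \sum_(s : 'I_m * bool) om t s.1 * (cpart s.2 (h t s.1)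
    + \sum_(a : 'I_k * bool) ccoef (L t s.1 a.1) s.2 a.2 * tnth z (noise_idx (t, a))) ^+ 2.
Proof.
apply: eq_bigr => t _; rewrite sum_pair; apply: eq_bigr => j _ /=.
rewrite mxE; under [X in _ + X]eq_bigr do rewrite mxE.
rewrite nsq_affine mulr_sumr; apply: eq_bigr => b _; congr (_ * (_ + _) ^+ 2).
by apply: eq_bigr => -[a b'] _; rewrite cpart_noise_mx.
Qed.

Lemma measurable_noise_metric m k n (om : 'I_n -> 'I_m -> R) (h : 'I_n -> 'I_m -> C)
    (L : 'I_n -> 'M[C]_(m, k)) :
  measurable_fun setT (fun z : (k * n + k * n).-tuple R =>
    \sum_t \sum_j om t j * nsq (h t j + (L t *m col t (noise_mx z)) j 0)).
Proof.
under eq_fun do rewrite noise_metricE.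
apply: measurable_sum => t; apply: measurable_sum => s; apply: measurable_funM => //.
apply: measurable_funX; apply: measurable_funD => //; apply: measurable_sum => a.
by apply: measurable_funM => //; exact: measurable_tnth.
Qed.

(** The real and imaginary parts of one noise entry contribute 2 [gauss_var] <= 1, whence the unit
    coefficient of the row energies of L. *)
Lemma noise_tail (m k : nat) (Om H La : R) : 0 <= Om -> 0 <= H -> 0 <= La ->
  exists2 Cst : R, 0 <= Cst &
  forall n (om : 'I_n -> 'I_m -> R) (h : 'I_n -> 'I_m -> C) (L : 'I_n -> 'M[C]_(m, k)),
  (forall t j, 0 <= om t j <= Om) -> (forall t j, nsq (h t j) <= H) ->
  (forall t j a, nsq (L t j a) <= La) -> forall e : R, 0 < e ->
  (gauss_prob R (k * n + k * n) [set z |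
    \sum_t \sum_j om t j * (nsq (h t j) + \sum_a nsq (L t j a)) + e <=
    \sum_t \sum_j om t j * nsq (h t j + (L t *m col t (noise_mx z)) j 0)]%R
  <= (n%:R * Cst / e ^+ 2)%:E)%E.
Proof.
move=> Om0 H0 La0.
have [Cst Cst0 HC] := @block_quad_tail R ('I_k * bool)%type ('I_m * bool)%type _ _ _ Om0 H0 La0.
exists Cst => // n om h L om_b h_b L_b e e0.
have {}HC := HC n (k * n + k * n)%N _ (noise_idx_bij k n) (fun t s => om t s.1)
  (fun t s => cpart s.2 (h t s.1)) (fun t s a => ccoef (L t s.1 a.1) s.2 a.2)
  (fun t s => om_b t s.1) (fun t s => le_trans (cpart2_le _ _) (h_b t s.1))
  (fun t s a => le_trans (ccoef2_le _ _ _) (L_b t s.1 a.1)) e e0.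
apply: le_trans HC; apply: le_measure; rewrite ?inE.
- rewrite -[X in measurable X]setTI; apply: measurable_fun_le => //.
  exact: measurable_noise_metric.
- rewrite -[X in measurable X]setTI; apply: measurable_fun_le => //.
  under eq_fun do rewrite -noise_metricE; exact: measurable_noise_metric.
move=> z /= hz; rewrite -noise_metricE; apply: le_trans hz; rewrite lerD2r.
apply: ler_sum => t _; rewrite sum_pair; apply: ler_sum => j _ /=.
rewrite -mulr_sumr; have /andP[p0 p1] := om_b t j; apply: ler_wpM2l => //.
rewrite big_split /= -nsqE lerD2l -mulr_sumr sum_ccoef2_vec mulrA.
have S0 : 0 <= \sum_(a < k) nsq (L t j a) by apply: sumr_ge0 => a _; exact: nsq_ge0.
have := gauss_var_le R; nra.
Qed.
End Noise.

(** * Discretised Gaussian laws on a grid *)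

Section RiemannCells.
Variable R : realType.
Local Notation mu := (@lebesgue_measure R).
Variables (o eta : R) (f : nat -> R) (g : R -> R).
Hypotheses (eta0 : 0 < eta) (f0 : forall i, 0 <= f i) (g0 : forall x, 0 <= g x).
Hypothesis mg : measurable_fun setT g.

Let cellS m : `[o, o + eta * m.+1%:R[%classic =
  `[o, o + eta * m%:R[ `|` `[o + eta * m%:R, o + eta * m.+1%:R[ :> set R.
Proof.
have h1 : o <= o + eta * m%:R by rewrite lerDl mulr_ge0// ltW.
have h2 : o + eta * m%:R <= o + eta * m.+1%:R.
  by rewrite lerD2l ler_pM2l// ler_nat.
by apply: itv_bndbnd_setU; rewrite bnd_simp.
Qed.

Let cell_disj m : [disjoint `[o, o + eta * m%:R[
  & (`[o + eta * m%:R, o + eta * m.+1%:R[ : set R)]%classic.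
Proof.
apply/disj_setPS => x /=; rewrite !in_itv /=.
by move=> [/andP[_ h1] /andP[h2 _]]; move: (lt_le_trans h1 h2); rewrite ltxx.
Qed.

Let cell_measure m : mu `[o + eta * m%:R, o + eta * m.+1%:R[ = eta%:E.
Proof.
rewrite lebesgue_measure_itv /= lte_fin ltrD2l ltr_pM2l// ltr_nat ltnSn -EFinB.
by congr EFin; rewrite -natr1; ring.
Qed.

Let mgE (D : set R) : measurable_fun D (EFin \o g).
Proof. by apply/measurable_EFinP; exact: measurable_funTS. Qed.

Lemma riemann_sum_le : (forall i x, o + eta * i%:R <= x < o + eta * i.+1%:R -> f i <= g x) ->
  forall m, ((\sum_(i < m) eta * f i)%:E <= \int[mu]_(x in `[o, (o + eta * m%:R)%R[) (g x)%:E)%E.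
Proof.
move=> fg; elim=> [|m IH].
  by rewrite big_ord0; apply: integral_ge0 => x _; rewrite lee_fin.
rewrite big_ord_recr /= cellS ge0_integral_setU//=; last 2 first.
- exact: mgE.
- by move=> x _; rewrite lee_fin.
rewrite EFinD; apply: leeD => //.
have -> : (eta * f m)%:E =
    ((f m)%:E * mu `[(o + eta * m%:R)%R, (o + eta * m.+1%:R)%R[)%E.
  by rewrite cell_measure -EFinM mulrC.
rewrite -integral_cst//.
apply: ge0_le_integral => //.
- by move=> x _; rewrite lee_fin.
- exact: mgE.
- by move=> x /=; rewrite in_itv /= => /fg; rewrite lee_fin.
Qed.

Lemma riemann_sum_ge : (forall i x, o + eta * i%:R <= x < o + eta * i.+1%:R -> g x <= f i) ->
  forall m, (\int[mu]_(x in `[o, (o + eta * m%:R)%R[) (g x)%:E <= (\sum_(i < m) eta * f i)%:E)%E.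
Proof.
move=> fg; elim=> [|m IH].
  by rewrite big_ord0 mulr0 addr0 set_itvco0 integral_set0.
rewrite big_ord_recr /= cellS ge0_integral_setU//=; last 2 first.
- exact: mgE.
- by move=> x _; rewrite lee_fin.
rewrite EFinD; apply: leeD => //.
have -> : (eta * f m)%:E =
    ((f m)%:E * mu `[(o + eta * m%:R)%R, (o + eta * m.+1%:R)%R[)%E.
  by rewrite cell_measure -EFinM mulrC.
rewrite -integral_cst//.
apply: ge0_le_integral => //.
- by move=> x _; rewrite lee_fin.
- exact: mgE.
- by move=> x /=; rewrite in_itv /= => /fg; rewrite lee_fin.
Qed.
End RiemannCells.

Section GridSums.
Variable R : realType.
Local Notation mu := (@lebesgue_measure R).

Lemma measurable_gauss_scaled (d b : R) :
  measurable_fun setT (fun x : R => expR (- (d * (x - b) ^+ 2))).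
Proof.
apply: measurableT_comp => //; apply: measurableT_comp => //.
by apply: measurable_funM => //; apply: measurable_funX; exact: measurable_funB.
Qed.

(** Each term is compared with a Gaussian wider by the factor 1 + r on the cell centred at its grid
    point, through (x-b)^2 <= (1+r)(a-b)^2 + (1+1/r)(x-a)^2. The bound is uniform in the centre b
    and the number of points, as counting around an arbitrary received word requires. *)
Lemma grid_sum_le (eta r d b : R) (m : nat) : 0 < eta -> 0 < r -> 0 < d ->
  eta * \sum_(i < m) expR (- (d * (eta * i%:R - b) ^+ 2)) <=
  expR (d * eta ^+ 2 / (4 * r)) * Num.sqrt (1 + r) * Num.sqrt (pi / d).
Proof.
move=> eta0 r0 d0.
pose K := expR (d * eta ^+ 2 / (4 * r)); pose d' := d / (1 + r).
have r1 : 0 < 1 + r by rewrite addr_gt0.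
have d'0 : 0 < d' by rewrite divr_gt0.
pose g (x : R) := K * expR (- (d' * (x - b) ^+ 2)).
have K0 : 0 < K by exact: expR_gt0.
have g0 x : 0 <= g x by rewrite mulr_ge0 ?expR_ge0 ?ltW.
have mg : measurable_fun setT g.
  by apply: measurable_funM => //; exact: measurable_gauss_scaled.
have := @riemann_sum_le R (- (eta / 2)) eta (fun i => expR (- (d * (eta * i%:R - b) ^+ 2)))
  g eta0 (fun i => expR_ge0 _) g0 mg _ m.
move=> /(_ _)/le_trans h.
have {h} h : ((\sum_(i < m) eta * expR (- (d * (eta * i%:R - b) ^+ 2)))%:E <=
    \int[mu]_x (g x)%:E)%E.
  apply: h; last first.
    apply: ge0_subset_integral => //; first exact/measurable_EFinP.
    by move=> x _; rewrite lee_fin.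
  move=> i x /andP[h1 h2]; rewrite /g /K -expRD ler_expR.
  set a := eta * i%:R in h1 *.
  have h3 : (x - a) ^+ 2 <= eta ^+ 2 / 4.
    have h2' : x < a + eta / 2 by move: h2; rewrite -[i.+1%:R]natr1 /a; lra.
    have : 0 <= (eta / 2 - (x - a)) * (eta / 2 + (x - a)) by apply: mulr_ge0; lra.
    by lra.
  have h4 : (x - b) ^+ 2 <= (1 + r) * (a - b) ^+ 2 + (1 + r) / r * (x - a) ^+ 2.
    rewrite -subr_ge0.
    have -> : (1 + r) * (a - b) ^+ 2 + (1 + r) / r * (x - a) ^+ 2 - (x - b) ^+ 2 =
      (r * (a - b) - (x - a)) ^+ 2 / r by field; rewrite gt_eqF.
    by rewrite divr_ge0 ?sqr_ge0 ?ltW.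
  have h5 : d' * (x - b) ^+ 2 <= d * (a - b) ^+ 2 + d / r * (eta ^+ 2 / 4).
    apply: (@le_trans _ _ (d' * ((1 + r) * (a - b) ^+ 2 + (1 + r) / r * (x - a) ^+ 2))).
      by rewrite ler_pM2l.
    have -> : d' * ((1 + r) * (a - b) ^+ 2 + (1 + r) / r * (x - a) ^+ 2) =
      d * (a - b) ^+ 2 + d / r * (x - a) ^+ 2 by rewrite /d'; field; rewrite !gt_eqF.
    by rewrite lerD2l ler_pM2l// divr_gt0.
  have -> : d * eta ^+ 2 / (4 * r) = d / r * (eta ^+ 2 / 4) by field; rewrite gt_eqF.
  by lra.
move: h; under eq_integral do rewrite /g EFinM.
rewrite ge0_integralZl//=; first last.
- by rewrite lee_fin ltW.
- by apply/measurable_EFinP; exact: measurable_gauss_scaled.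
rewrite integral_gauss_scaled// -EFinM lee_fin mulr_sumr => h.
apply: le_trans h _; rewrite -/K -mulrA ler_pM2l//.
rewrite -sqrtrM; last exact: ltW.
by rewrite (_ : pi / d' = (1 + r) * (pi / d))// /d'; field; rewrite !gt_eqF.
Qed.

Lemma gauss_tail_le (r M : R) : 0 < r -> 0 <= M ->
  ((Num.sqrt (pi / (1 + r)) - expR (- (r * M ^+ 2)) * Num.sqrt pi)%:E <=
   \int[mu]_(x in `[(- M)%R, M[) (expR (- ((1 + r) * (x - 0) ^+ 2)))%:E)%E.
Proof.
move=> r0 M0; have r1 : 0 < 1 + r by rewrite addr_gt0.
pose I : set R := `[- M, M[%classic.
have mI : measurable I by exact: measurable_itv.
pose f (x : R) := (expR (- ((1 + r) * (x - 0) ^+ 2)))%:E.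
have mf : measurable_fun setT f by apply/measurable_EFinP; exact: measurable_gauss_scaled.
have f0 x : (0 <= f x)%E by rewrite lee_fin expR_ge0.
have E : (\int[mu]_x f x = \int[mu]_(x in I) f x + \int[mu]_(x in ~` I) f x)%E.
  rewrite -ge0_integral_setU//=; last 3 first.
  - exact: measurableC.
  - by rewrite setUv.
  - by apply/disj_setPS; rewrite setICr.
  by rewrite setUv.
pose e := expR (- (r * M ^+ 2)).
have e0 : 0 < e by exact: expR_gt0.
have T : (\int[mu]_(x in ~` I) f x <= (e * Num.sqrt pi)%:E)%E.
  have -> : (e * Num.sqrt pi)%:E = (\int[mu]_x (e%:E * (expR (- (1 * (x - 0) ^+ 2)))%:E))%E.
    rewrite ge0_integralZl//=; first by rewrite integral_gauss_scaled// divr1.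
    - by apply/measurable_EFinP; exact: measurable_gauss_scaled.
    - by rewrite lee_fin ltW.
  have mh : measurable_fun setT (fun x : R => (e%:E * (expR (- (1 * (x - 0) ^+ 2)))%:E)%E).
    by apply: measurable_funeM; apply/measurable_EFinP; exact: measurable_gauss_scaled.
  have h0 x : (0 <= e%:E * (expR (- (1 * (x - 0) ^+ 2)))%:E)%E.
    by rewrite mule_ge0 ?lee_fin ?expR_ge0 ?ltW.
  apply: (@le_trans _ _ (\int[mu]_(x in ~` I) (e%:E * (expR (- (1 * (x - 0) ^+ 2)))%:E))%E).
    apply: ge0_le_integral => //.
    - exact: measurableC.
    - exact: measurable_funTS.
    - exact: measurable_funTS.
    move=> x /= xI; rewrite /f -EFinM lee_fin -expRD ler_expR !subr0 mul1r mulrDl mul1r.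
    have : M ^+ 2 <= x ^+ 2.
      move/negP : xI; rewrite in_itv /= negb_and -ltNge -leNgt => /orP[] h; nra.
    by rewrite -(ler_pM2l r0) => h; lra.
  by apply: ge0_subset_integral => //; exact: measurableC.
move: E; rewrite integral_gauss_scaled// => E.
by rewrite EFinB leeBlDr// E leeD2l.
Qed.

(** The converse comparison, with a narrower Gaussian; the subtracted term is the mass lost by
    truncating the grid. *)
Lemma grid_sum_ge (eta r : R) (B : nat) : 0 < eta -> 0 < r ->
  expR (- ((1 + r^-1) * eta ^+ 2 / 4)) *
    (Num.sqrt (pi / (1 + r)) - expR (- (r * (eta * (B%:R + 2^-1)) ^+ 2)) * Num.sqrt pi) <=
  eta * \sum_(i < (2 * B).+1) expR (- (eta * (i%:R - B%:R)) ^+ 2).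
Proof.
(* The cells of width eta centred at the 2B + 1 grid points tile [-M, M), whence the half. *)
move=> eta0 r0; set M := eta * (B%:R + 2^-1); have r1 : 0 < 1 + r by rewrite addr_gt0.
have M0 : 0 <= M by apply: mulr_ge0; [exact: ltW|rewrite addr_ge0// invr_ge0].
pose K := expR (- ((1 + r^-1) * eta ^+ 2 / 4)); have K0 : 0 < K by exact: expR_gt0.
pose g (x : R) := K * expR (- ((1 + r) * (x - 0) ^+ 2)).
have g0 x : 0 <= g x by rewrite mulr_ge0 ?expR_ge0 ?ltW.
have mg : measurable_fun setT g.
  by apply: measurable_funM => //; exact: measurable_gauss_scaled.
have h := @riemann_sum_ge R (- M) eta (fun i => expR (- (eta * (i%:R - B%:R)) ^+ 2))
  g eta0 g0 mg _ (2 * B).+1.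
have {h} h : (\int[mu]_(x in `[(- M)%R, (- M + eta * (2 * B).+1%:R)%R[) (g x)%:E <=
    (\sum_(i < (2 * B).+1) eta * expR (- (eta * (i%:R - B%:R)) ^+ 2))%:E)%E.
  apply: h => i x /andP[h1 h2]; rewrite /g /K -expRD ler_expR.
  set a := eta * (i%:R - B%:R).
  have h1' : a - eta / 2 <= x by move: h1; rewrite /M /a; lra.
  have h2' : x < a + eta / 2 by move: h2; rewrite -[i.+1%:R]natr1 /M /a; lra.
  have h3 : (x - a) ^+ 2 <= eta ^+ 2 / 4.
    have : 0 <= (eta / 2 - (x - a)) * (eta / 2 + (x - a)) by apply: mulr_ge0; lra.
    by lra.
  have h4 : a ^+ 2 <= (1 + r) * x ^+ 2 + (1 + r^-1) * (x - a) ^+ 2.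
    rewrite -subr_ge0.
    have -> : (1 + r) * x ^+ 2 + (1 + r^-1) * (x - a) ^+ 2 - a ^+ 2 =
      (r * x + (x - a)) ^+ 2 / r by field; rewrite gt_eqF.
    by rewrite divr_ge0 ?sqr_ge0 ?ltW.
  have r2 : 0 < 1 + r^-1 by rewrite addr_gt0// invr_gt0.
  have h5 : (1 + r^-1) * (x - a) ^+ 2 <= (1 + r^-1) * (eta ^+ 2 / 4) by rewrite ler_pM2l.
  by rewrite subr0; lra.
have eM : - M + eta * (2 * B).+1%:R = M.
  by rewrite -natr1 natrM /M; field.
rewrite eM -mulr_sumr in h.
rewrite -lee_fin; apply: le_trans h.
have -> : (\int[mu]_(x in `[(- M)%R, M[) (g x)%:E =
    K%:E * \int[mu]_(x in `[(- M)%R, M[) (expR (- ((1 + r) * (x - 0) ^+ 2)))%:E)%E.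
  rewrite -ge0_integralZl//=.
  - apply/measurable_EFinP; apply: measurable_funTS; exact: measurable_gauss_scaled.
  - by rewrite lee_fin ltW.
rewrite EFinM lee_pmul2l//; exact: gauss_tail_le.
Qed.

Lemma expR_le_inv (x : R) : x < 1 -> expR x <= (1 - x)^-1.
Proof.
move=> x1; rewrite -[expR x]invrK -expRN lef_pV2 ?posrE ?expR_gt0 ?subr_gt0//.
exact: expR_ge1Dx.
Qed.

Lemma sqrt1D_le (r : R) : 0 <= r -> Num.sqrt (1 + r) <= expR (r / 2).
Proof.
move=> r0; rewrite -[leRHS]ger0_norm ?expR_ge0// -sqrtr_sqr ler_sqrt ?sqr_ge0//.
by rewrite expr2 -expRD -splitr expR_ge1Dx.
Qed.

(** One grid must do three things: normalise almost like the Gaussian, have a letter variance close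
    to 1/2, and obey the upper sum bound for all weights up to D. The variance is estimated from
    both sides by the exponential moments of the squared letter. *)
Lemma ex_grid (del D : R) : 0 < del -> 2 <= D ->
  exists (eta : R) (B : nat),
  let a (i : nat) := eta * (i%:R - B%:R) in
  let Z := \sum_(i < (2 * B).+1) expR (- a i ^+ 2) in
  let v := (\sum_(i < (2 * B).+1) a i ^+ 2 * expR (- a i ^+ 2)) / Z in
  [/\ 0 < eta <= del, expR (- del) * Num.sqrt pi <= eta * Z,
      2^-1 - del <= v <= 2^-1 + del &
      forall d b m, 0 < d <= D ->
      eta * \sum_(i < m) expR (- (d * (eta * i%:R - b) ^+ 2)) <=
      expR del * Num.sqrt (pi / d)].
Proof.
move=> del0 D2.
pose tau := Num.min (del / 3) (1 / 4).
have tau0 : 0 < tau by rewrite lt_min !divr_gt0.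
have tau1 : tau <= del / 3 by rewrite ge_min lexx.
have tau2 : tau <= 1 / 4 by rewrite ge_min lexx orbT.
pose rho := Num.min del (tau ^+ 2 / 4).
have t20 : 0 < tau ^+ 2 by rewrite exprn_gt0.
have rho0 : 0 < rho by rewrite lt_min del0 divr_gt0.
have rho1 : rho <= del by rewrite ge_min lexx.
have rho2 : rho <= tau ^+ 2 / 4 by rewrite ge_min lexx orbT.
have erho : expR (2 * rho) <= 1 + tau ^+ 2.
  have s1 : tau ^+ 2 <= 1 by nra.
  have h1 : (1 + tau ^+ 2) * (2 * rho) <= (1 + tau ^+ 2) * (tau ^+ 2 / 2).
    by rewrite ler_wpM2l//; lra.
  have h2 : tau ^+ 2 * tau ^+ 2 <= tau ^+ 2 by rewrite ler_piMr// ltW.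
  apply: le_trans (expR_le_inv _) _; first by lra.
  by rewrite -[leLHS]mul1r ler_pdivrMr; lra.
have D0 : 0 < D by lra.
have [eta [eta0 eta1 eta2 eta3]] : exists eta : R, [/\ 0 < eta, eta <= del,
    D * eta ^+ 2 <= 2 * rho ^+ 2 & (1 + rho^-1) * eta ^+ 2 <= rho].
  have q0 : 0 < 1 + rho^-1 by rewrite addr_gt0// invr_gt0.
  pose w := Num.min 1 (Num.min (2 * rho ^+ 2 / D) (rho / (1 + rho^-1))).
  have w0 : 0 < w by rewrite !lt_min ltr01 !divr_gt0// mulr_gt0// exprn_gt0.
  have w1 : w <= 1 by rewrite ge_min lexx.
  have w2 : w <= 2 * rho ^+ 2 / D by rewrite !ge_min lexx !orbT.
  have w3 : w <= rho / (1 + rho^-1) by rewrite !ge_min lexx !orbT.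
  exists (Num.min w del).
  have m0 : 0 < Num.min w del by rewrite lt_min w0.
  have m1 : Num.min w del <= w by rewrite ge_min lexx.
  have m2 : Num.min w del ^+ 2 <= w by nra.
  split=> //; first by rewrite ge_min lexx orbT.
    by rewrite mulrC -ler_pdivlMr// (le_trans m2).
  by rewrite mulrC -ler_pdivlMr// (le_trans m2).
(* The loss exp(-rho) allowed in [lower] is shared out: rho/4 for the cells, rho/2 for the narrower
   Gaussian, and the gap for the truncation, which fixes B. *)
pose gap : R := expR (- (rho / 2)) - expR (- (3 * rho / 4)).
have gap0 : 0 < gap by rewrite subr_gt0 ltr_expR; lra.
have [B HB] : exists B : nat, (rho * gap)^-1 <= (eta * (B%:R + 2^-1)) ^+ 2.
  pose y := (rho * gap)^-1 + 1.
  have y1 : 1 <= y by rewrite lerDr invr_ge0; apply: mulr_ge0; exact: ltW.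
  pose B := Num.truncn (y / eta).
  exists B.+1.
  have hB : y <= eta * (B.+1%:R + 2^-1).
    rewrite mulrC -ler_pdivrMr//; apply: (@le_trans _ _ B.+1%:R).
      by apply/ltW/truncnS_gt.
    by rewrite lerDl invr_ge0.
  have : (rho * gap)^-1 <= y by rewrite lerDl.
  by nra.
exists eta, B => a Z v.
have upper d b m : 0 < d <= D ->
    eta * \sum_(i < m) expR (- (d * (eta * i%:R - b) ^+ 2)) <=
    expR rho * Num.sqrt (pi / d).
  move=> /andP[d0 dD]; apply: le_trans (grid_sum_le b m eta0 rho0 d0) _.
  apply: ler_wpM2r; first exact: sqrtr_ge0.
  have -> : expR rho = expR (rho / 2) * expR (rho / 2) by rewrite -expRD -splitr.
  apply: ler_pM; rewrite ?expR_ge0 ?sqrtr_ge0 ?sqrt1D_le ?(ltW rho0)// ler_expR.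
  rewrite ler_pdivrMr ?mulr_gt0//.
  have : d * eta ^+ 2 <= D * eta ^+ 2 by rewrite ler_pM2r ?exprn_gt0.
  by nra.
have sp0 : 0 < Num.sqrt (pi : R) by rewrite sqrtr_gt0 pi_gt0.
have lower : expR (- rho) * Num.sqrt pi <= eta * Z.
  apply: le_trans (grid_sum_ge B eta0 rho0).
  have -> : - rho = - (rho / 4) + - (3 * rho / 4) by field.
  rewrite expRD -mulrA; apply: ler_pM.
  - exact: expR_ge0.
  - by rewrite mulr_ge0 ?expR_ge0 ?ltW.
  - by rewrite ler_expR lerN2 ler_pM2r.
  rewrite sqrtrM ?pi_ge0// (mulrC (Num.sqrt pi)) -mulrBl ler_pM2r//.
  have h1 : expR (- (rho / 2)) <= Num.sqrt (1 + rho)^-1.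
    have r1 : 0 < 1 + rho by lra.
    rewrite sqrtrV ?(ltW r1)// expRN lef_pV2 ?posrE ?expR_gt0 ?sqrtr_gt0//.
    exact: sqrt1D_le (ltW rho0).
  have h2 : expR (- (rho * (eta * (B%:R + 2^-1)) ^+ 2)) <= gap.
    set M2 := _ ^+ 2 in HB *.
    have M20 : 0 <= M2 by exact: sqr_ge0.
    rewrite expRN -[leRHS]invrK lef_pV2 ?posrE ?expR_gt0 ?invr_gt0//.
    apply: le_trans (expR_ge1Dx _).
    have : rho * (rho * gap)^-1 <= rho * M2 by rewrite ler_pM2l.
    have -> : rho * (rho * gap)^-1 = gap^-1 by field; rewrite !gt_eqF.
    by lra.
  by rewrite /gap in h2 gap0 *; lra.
have Z0 : 0 < Z.
  rewrite -(pmulr_rgt0 _ eta0); apply: lt_le_trans lower.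
  by rewrite mulr_gt0// expR_gt0.
(* With d = 1 - c this bounds the expectation of exp(c a^2) under the grid law by almost (1 -
   c)^(-1/2); c = tau and c = -tau then give the two bounds on the variance. *)
have ratio d : 0 < d <= D ->
    (\sum_(i < (2 * B).+1) expR (- (d * a i ^+ 2))) / Z <= (1 + tau ^+ 2) * Num.sqrt d^-1.
  move=> dD; rewrite ler_pdivrMr// -(ler_pM2l eta0).
  have := upper d (eta * B%:R) (2 * B).+1 dD.
  under eq_bigr do rewrite -mulrBr -/(a _).
  move=> h; apply: le_trans h _.
  rewrite sqrtrM ?pi_ge0//.
  have -> : eta * ((1 + tau ^+ 2) * Num.sqrt d^-1 * Z) =
      (1 + tau ^+ 2) * (Num.sqrt d^-1 * (eta * Z)) by ring.
  have -> : expR rho * (Num.sqrt pi * Num.sqrt d^-1) =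
      expR (2 * rho) * (Num.sqrt d^-1 * (expR (- rho) * Num.sqrt pi)).
    rewrite (_ : 2 * rho = rho + rho); last by ring.
    by rewrite expRD expRN; field; rewrite gt_eqF ?expR_gt0.
  by apply: ler_pM => //; rewrite ler_wpM2l ?sqrtr_ge0.
pose v' := \sum_(i < (2 * B).+1) a i ^+ 2 * expR (- a i ^+ 2).
have vE : v * Z = v' by rewrite /v divfK// gt_eqF.
have lin c : Z + c * v' <= \sum_(i < (2 * B).+1) expR (- ((1 - c) * a i ^+ 2)).
  rewrite /Z /v' mulr_sumr -big_split; apply: ler_sum => i _ /=.
  have -> : - ((1 - c) * a i ^+ 2) = - a i ^+ 2 + c * a i ^+ 2 by ring.
  rewrite expRD mulrA -[X in X + _]mul1r -mulrDl mulrC ler_pM2l ?expR_gt0//.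
  exact: expR_ge1Dx.
have key c x : 0 < 1 - c <= D -> 0 <= x -> (1 - c)^-1 <= x ^+ 2 ->
    1 + c * v <= (1 + tau ^+ 2) * x.
  move=> cD x0 cx; apply: le_trans (_ : _ <= (1 + tau ^+ 2) * Num.sqrt (1 - c)^-1) _; last first.
    rewrite ler_pM2l ?addr_gt0// -[leRHS]ger0_norm// -sqrtr_sqr ler_sqrt ?sqr_ge0//.
  apply: le_trans (ratio _ cD); rewrite ler_pdivlMr// mulrDl mul1r -mulrA vE; exact: lin.
split.
- by rewrite eta0.
- apply: le_trans lower; rewrite ler_pM2r// ler_expR lerN2//.
- have c1 : 0 < 1 - - tau <= D by lra.
  have c2 : 0 < 1 - tau <= D by lra.
  have h1 := @key (- tau) (1 - tau / 2 + tau ^+ 2) c1.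
  have h2 := @key tau (1 + tau / 2 + tau ^+ 2) c2.
  have {}h1 : 1 + - tau * v <= (1 + tau ^+ 2) * (1 - tau / 2 + tau ^+ 2).
    by apply: h1; [nra|rewrite -[leLHS]mul1r ler_pdivrMr; nra].
  have {}h2 : 1 + tau * v <= (1 + tau ^+ 2) * (1 + tau / 2 + tau ^+ 2).
    by apply: h2; [nra|rewrite -[leLHS]mul1r ler_pdivrMr; nra].
  have t3 : 0 <= tau * tau ^+ 2 <= tau ^+ 2 / 4 by nra.
  have t4 : 0 <= tau ^+ 2 * tau ^+ 2 <= tau ^+ 2 / 4 by nra.
  have td : 3 * tau ^+ 2 <= tau * del by nra.
  by apply/andP; split; rewrite -(ler_pM2l tau0); lra.
- move=> d b m dD; apply: le_trans (upper d b m dD) _.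
  by rewrite ler_wpM2r ?sqrtr_ge0// ler_expR.
Qed.
End GridSums.

(** * Product laws, concentration and counting *)

Section ProdLaw.
Variables (R : realType) (I T : finType) (p : T -> R).
Hypothesis p0 : forall x, 0 <= p x.
Hypothesis p1 : \sum_x p x = 1.

Definition prodlaw (g : {ffun I -> T}) : R := \prod_i p (g i).

Lemma prodlaw_ge0 g : 0 <= prodlaw g.
Proof. exact: prodr_ge0. Qed.

Lemma sum_prodlaw_prod (F : I -> T -> R) :
  \sum_g prodlaw g * \prod_i F i (g i) = \prod_i \sum_x p x * F i x.
Proof.
rewrite bigA_distr_bigA; apply: eq_bigr => g _.
by rewrite /prodlaw -big_split.
Qed.

Lemma sum_prodlaw : \sum_g prodlaw g = 1.
Proof.
transitivity (\sum_g prodlaw g * \prod_(i : I) (fun _ : T => 1) (g i)).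
  by apply: eq_bigr => g _; rewrite big1 ?mulr1.
rewrite (sum_prodlaw_prod (fun _ _ => 1)) big1// => i _.
by under eq_bigr do rewrite mulr1.
Qed.

Lemma prodlaw_expect1 i (f : T -> R) :
  \sum_g prodlaw g * f (g i) = \sum_x p x * f x.
Proof.
pose F l x := if l == i then f x else 1.
transitivity (\sum_g prodlaw g * \prod_l F l (g l)).
  apply: eq_bigr => g _; rewrite (bigD1 i)//= /F eqxx big1 ?mulr1// => l /negbTE ->//.
rewrite sum_prodlaw_prod (bigD1 i)//= [X in _ * X]big1 ?mulr1.
  by apply: eq_bigr => x _; rewrite /F eqxx.
by move=> l /negbTE li; rewrite -[RHS]p1; apply: eq_bigr => x _; rewrite /F li mulr1.
Qed.

Lemma prodlaw_expect2 i j (f h : T -> R) : i != j ->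
  \sum_g prodlaw g * (f (g i) * h (g j)) = (\sum_x p x * f x) * (\sum_x p x * h x).
Proof.
move=> ij; have ji : j != i by rewrite eq_sym.
pose F l x := if l == i then f x else if l == j then h x else 1.
transitivity (\sum_g prodlaw g * \prod_l F l (g l)).
  apply: eq_bigr => g _; rewrite (bigD1 i)//= (bigD1 j)//= /F !eqxx (negbTE ji).
  by rewrite big1 ?mulr1// => l /andP[/negbTE -> /negbTE ->].
rewrite sum_prodlaw_prod (bigD1 i)//= (bigD1 j)//= [X in _ * (_ * X)]big1 ?mulr1.
  congr (_ * _); apply: eq_bigr => x _; rewrite /F ?eqxx ?(negbTE ji)//.
move=> l /andP[/negbTE li /negbTE lj]; rewrite -[RHS]p1.
by apply: eq_bigr => x _; rewrite /F li lj mulr1.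
Qed.

Lemma prodlaw_markov (S : pred {ffun I -> T}) (F : {ffun I -> T} -> R) (c : R) :
  0 < c -> (forall g, 0 <= F g) -> (forall g, S g -> c <= F g) ->
  \sum_(g | S g) prodlaw g <= (\sum_g prodlaw g * F g) / c.
Proof.
move=> c0 F0 SF; rewrite ler_pdivlMr// mulr_suml.
apply: (@le_trans _ _ (\sum_(g | S g) prodlaw g * F g)).
  by apply: ler_sum => g Sg; rewrite ler_wpM2l ?prodlaw_ge0// SF.
rewrite [leRHS](bigID S)/= lerDl; apply: sumr_ge0 => g _.
by rewrite mulr_ge0 ?prodlaw_ge0.
Qed.
End ProdLaw.

Section DiscreteChebyshev.
Variables (R : realType) (X : finType) (p : X -> R).
Hypothesis p0 : forall x, 0 <= p x.
Hypothesis p1 : \sum_x p x = 1.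

Lemma discrete_chebyshev n (Y : 'I_n -> X -> R) (c e : R) : (0 < n)%N -> 0 < e ->
  (forall t, \sum_x p x * Y t x = 0) -> (forall t x, `|Y t x| <= c) ->
  \sum_(g : {ffun 'I_n -> X} | n%:R * e <= `|\sum_t Y t (g t)|) prodlaw p g
    <= c ^+ 2 / (n%:R * e ^+ 2).
Proof.
move=> n0 e0 EY Yc; have nr0 : 0 < n%:R :> R by rewrite ltr0n.
have ne0 : 0 < (n%:R * e) ^+ 2 by rewrite exprn_gt0// mulr_gt0.
pose F (g : {ffun 'I_n -> X}) := (\sum_t Y t (g t)) ^+ 2.
apply: le_trans (@prodlaw_markov _ _ _ p p0 _ F _ ne0 _ _) _.
- by move=> g; exact: sqr_ge0.
- move=> g h; rewrite /F -[leRHS]real_normK ?num_real//.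
  by rewrite ler_pXn2r// nnegrE// mulr_ge0// ltW.
have -> : c ^+ 2 / (n%:R * e ^+ 2) = n%:R * c ^+ 2 / (n%:R * e) ^+ 2.
  by field; rewrite !gt_eqF.
rewrite ler_pM2r ?invr_gt0//.
have -> : \sum_g prodlaw p g * F g = \sum_t \sum_s \sum_g prodlaw p g * (Y t (g t) * Y s (g s)).
  under eq_bigr do rewrite /F expr2 sum_mul mulr_sumr.
  rewrite exchange_big; apply: eq_bigr => t _.
  under eq_bigr do rewrite mulr_sumr.
  by rewrite exchange_big.
apply: (@le_trans _ _ (\sum_(t < n) c ^+ 2)); last by rewrite sum_cst card_ord.
apply: ler_sum => t _; rewrite (bigD1 t)//= [X in _ + X]big1 ?addr0; last first.
  by move=> s st; rewrite prodlaw_expect2 1?eq_sym// EY mul0r.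
rewrite (prodlaw_expect1 p1 t (fun x => Y t x * Y t x)).
apply: (@le_trans _ _ (\sum_x p x * c ^+ 2)).
  apply: ler_sum => x _; rewrite ler_wpM2l//.
  rewrite -expr2 -real_normK ?num_real// ler_pXn2r// nnegrE (le_trans _ (Yc t x))//.
by rewrite -mulr_suml p1 mul1r.
Qed.
End DiscreteChebyshev.

Section GridLetters.
Variables (R : realType) (M : nat) (p val : 'I_M -> R) (v : R).
Hypothesis p0 : forall x, 0 <= p x.
Hypothesis p1 : \sum_x p x = 1.
Hypothesis val1 : \sum_x p x * val x = 0.
Hypothesis val2 : \sum_x p x * val x ^+ 2 = v.
Local Notation C := R[i].

Lemma letter_affine_sqr (A : finType) (h : R) (l : A -> R) :
  \sum_(x : {ffun A -> 'I_M}) prodlaw p x * (h + \sum_a l a * val (x a)) ^+ 2 =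
  h ^+ 2 + v * \sum_a l a ^+ 2.
Proof.
have -> : \sum_(x : {ffun A -> 'I_M}) prodlaw p x * (h + \sum_a l a * val (x a)) ^+ 2 =
    \sum_(x : {ffun A -> 'I_M}) prodlaw p x * h ^+ 2
    + \sum_a \sum_(x : {ffun A -> 'I_M}) prodlaw p x * (2 * h * l a * val (x a))
    + \sum_a \sum_b \sum_(x : {ffun A -> 'I_M}) prodlaw p x *
        ((l a * val (x a)) * (l b * val (x b))).
  rewrite exchange_big -big_split /=.
  under [X in _ = _ + X]eq_bigr do rewrite exchange_big.
  rewrite [X in _ = _ + X]exchange_big -big_split /=; apply: eq_bigr => x _.
  rewrite -mulr_sumr; under [X in _ = _ + X]eq_bigr do rewrite -mulr_sumr.
  rewrite -mulr_sumr -sum_mul -!mulrDr; congr (_ * _).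
  rewrite sqrrD expr2; congr (_ + _ + _).
  rewrite -mulr_natl mulrA mulr_sumr; apply: eq_bigr => a _; ring.
rewrite -mulr_suml (sum_prodlaw A p1) mul1r [X in _ + X + _]big1 ?addr0; last first.
  move=> a _; rewrite (prodlaw_expect1 p1 a (fun y => 2 * h * l a * val y)).
  under eq_bigr do rewrite mulrCA; by rewrite -mulr_sumr val1 mulr0.
congr (_ + _); rewrite mulr_sumr; apply: eq_bigr => a _.
rewrite (bigD1 a)//= [X in _ + X]big1 ?addr0; last first.
  move=> b ba; rewrite (prodlaw_expect2 p1 (fun y => l a * val y) (fun y => l b * val y)).
    under eq_bigr do rewrite mulrCA; by rewrite -mulr_sumr val1 mulr0 mul0r.
  by rewrite eq_sym.
rewrite (prodlaw_expect1 p1 a (fun y => (l a * val y) * (l a * val y))).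
rewrite -val2 mulr_suml; apply: eq_bigr => x _; ring.
Qed.

Definition cletter k (x : {ffun 'I_k * bool -> 'I_M}) (a : 'I_k) : C :=
  Complex (val (x (a, false))) (val (x (a, true))).

Lemma cpart_cletter k (x : {ffun 'I_k * bool -> 'I_M}) a b :
  cpart b (cletter x a) = val (x (a, b)).
Proof. by case: b. Qed.

Lemma letter_expect_nsq k (h : C) (L : 'I_k -> C) :
  \sum_(x : {ffun 'I_k * bool -> 'I_M}) prodlaw p x * nsq (h + \sum_a L a * cletter x a) =
  nsq h + 2 * v * \sum_a nsq (L a).
Proof.
under eq_bigr do rewrite nsq_affine mulr_sumr.
rewrite exchange_big /=.
under eq_bigr => b _.
  under eq_bigr => x _.
    under eq_bigr do rewrite cpart_cletter -surjective_pairing.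
    over.
  rewrite (letter_affine_sqr (cpart b h) (fun s => ccoef (L s.1) b s.2)); over.
rewrite big_split /= -nsqE; congr (_ + _).
by rewrite -mulr_sumr sum_ccoef2_vec; ring.
Qed.

Lemma sequence_tail n (J : finType) k (om : 'I_n -> J -> R) (h : 'I_n -> J -> C)
    (L : 'I_n -> J -> 'I_k -> C) (c e : R) : (0 < n)%N -> 0 < e ->
  (forall t (x : {ffun 'I_k * bool -> 'I_M}),
     0 <= \sum_j om t j * nsq (h t j + \sum_a L t j a * cletter x a) <= c) ->
  \sum_(g : {ffun 'I_n -> {ffun 'I_k * bool -> 'I_M}} |
     n%:R * e <= `|\sum_t \sum_j om t j * nsq (h t j + \sum_a L t j a * cletter (g t) a)
       - \sum_t \sum_j om t j * (nsq (h t j) + 2 * v * \sum_a nsq (L t j a))|)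
    prodlaw (prodlaw p) g <= c ^+ 2 / (n%:R * e ^+ 2).
Proof.
move=> n0 e0 bd.
have q0 x : 0 <= prodlaw p x :> R := @prodlaw_ge0 R ('I_k * bool)%type 'I_M p p0 x.
have q1 := @sum_prodlaw R ('I_k * bool)%type 'I_M p p1.
pose Y t (x : {ffun 'I_k * bool -> 'I_M}) :=
  \sum_j om t j * nsq (h t j + \sum_a L t j a * cletter x a).
pose m t := \sum_j om t j * (nsq (h t j) + 2 * v * \sum_a nsq (L t j a)).
have mE t : \sum_x prodlaw p x * Y t x = m t.
  rewrite /Y; under eq_bigr do rewrite mulr_sumr.
  rewrite exchange_big /=; apply: eq_bigr => j _.
  by under eq_bigr do rewrite mulrCA; rewrite -mulr_sumr letter_expect_nsq.
have mb t : 0 <= m t <= c.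
  rewrite -mE; apply/andP; split.
    by apply: sumr_ge0 => x _; rewrite mulr_ge0//; have /andP[] := bd t x.
  rewrite -[leRHS]mul1r -q1 mulr_suml; apply: ler_sum => x _.
  by rewrite ler_wpM2l//; have /andP[] := bd t x.
have := @discrete_chebyshev _ _ (prodlaw p) q0 q1 n (fun t x => Y t x - m t) c e n0 e0.
have H1 t : \sum_x prodlaw p x * (Y t x - m t) = 0.
  under eq_bigr do rewrite mulrBr.
  by rewrite sumrB mE -mulr_suml q1 mul1r subrr.
have H2 t x : `|Y t x - m t| <= c.
  by rewrite ler_norml; have /andP[] := bd t x; have /andP[] := mb t; rewrite /Y; lra.
move=> /(_ H1 H2); apply: le_trans; rewrite le_eqVlt; apply/orP; left; apply/eqP.
by apply: eq_bigl => g; rewrite sumrB.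
Qed.
End GridLetters.

Section Counting.
Variable R : realType.
Local Notation C := R[i].

Lemma card_ge_law (T : finType) (P : T -> R) (S : pred T) (q : R) :
  2^-1 <= \sum_(x | S x) P x -> (forall x, S x -> P x <= q) -> 2^-1 <= #|S|%:R * q.
Proof.
move=> h Pq; apply: le_trans h _; apply: le_trans (ler_sum _ Pq) _.
by rewrite sumr_const mulr_natl.
Qed.

(** The probability of a word depends on its energy alone: it is exp(-energy) divided by Z once per
    real coordinate. *)
Lemma prodlaw_gauss_le n k M (val : 'I_M -> R) (Z s : R)
    (g : {ffun 'I_n -> {ffun 'I_k * bool -> 'I_M}}) : 0 < Z ->
  s <= \sum_t \sum_j nsq (cletter val (g t) j) ->
  prodlaw (prodlaw (fun i => expR (- val i ^+ 2) / Z)) g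
    <= expR (- s - n%:R * (k%:R * (2 * ln Z))).
Proof.
move=> Z0 hs.
have pE i : expR (- val i ^+ 2) / Z = expR (- val i ^+ 2 - ln Z).
  by rewrite expRD [expR (- ln Z)]expRN lnK ?posrE.
have -> : prodlaw (prodlaw (fun i => expR (- val i ^+ 2) / Z)) g =
    \prod_t \prod_s expR (- val (g t s) ^+ 2 - ln Z).
  by apply: eq_bigr => t _; apply: eq_bigr => s' _; rewrite pE.
under eq_bigr do rewrite -expR_sum.
rewrite -expR_sum ler_expR.
have -> : \sum_(t < n) \sum_(s : 'I_k * bool) (- val (g t s) ^+ 2 - ln Z) =
    - (\sum_t \sum_j nsq (cletter val (g t) j)) - n%:R * (k%:R * (2 * ln Z)).
  have -> : n%:R * (k%:R * (2 * ln Z)) = \sum_(t < n) \sum_(j < k) 2 * ln Z.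
    by rewrite !sum_cst !card_ord.
  rewrite -[X in _ = X - _]sumrN -sumrB; apply: eq_bigr => t _.
  rewrite sum_pair -sumrN -sumrB; apply: eq_bigr => j _.
  rewrite big_bool /nsq /=; ring.
by rewrite lerD2r lerN2.
Qed.

(** The indicator of the ellipsoid is at most exp(th - distance), and the sum of this exponential
    over all words factors into one-dimensional grid sums. Each complex coordinate gives two of
    them, hence the factors 2. *)
Lemma ellipsoid_count n k M (B : nat) (eta del D th : R) (d : 'I_n -> 'I_k -> R)
    (y : 'I_n -> 'I_k -> C) : 0 < eta ->
  (forall d b m, 0 < d <= D ->
    eta * \sum_(i < m) expR (- (d * (eta * i%:R - b) ^+ 2)) <= expR del * Num.sqrt (pi / d)) ->
  (forall t j, 0 < d t j <= D) ->
  #|[pred u : {ffun 'I_n -> {ffun 'I_k * bool -> 'I_M}} |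
     \sum_t \sum_j d t j * nsq (cletter (fun i : 'I_M => eta * (i%:R - B%:R)) (u t) j - y t j)
       <= th]|%:R
  <= expR (th + \sum_t \sum_j (2 * del + ln pi - ln (d t j) - 2 * ln eta)).
Proof.
move=> eta0 grid dD; set val := fun i : 'I_M => _.
set S := [pred u | _].
pose w (u : {ffun 'I_n -> {ffun 'I_k * bool -> 'I_M}}) :=
  \prod_t \prod_(s : 'I_k * bool) expR (- (d t s.1 * (val (u t s) - cpart s.2 (y t s.1)) ^+ 2)).
have wE u : w u = expR (- \sum_t \sum_j d t j * nsq (cletter val (u t) j - y t j)).
  rewrite /w; under eq_bigr do rewrite -expR_sum.
  rewrite -expR_sum; congr expR; rewrite -sumrN; apply: eq_bigr => t _.
  rewrite sum_pair -sumrN; apply: eq_bigr => j _.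
  by rewrite big_bool /nsq /= raddfB /= raddfB /=; case: (y t j) => y1 y2 /=; ring.
have -> : #|S|%:R = \sum_(u | S u) (1 : R) by rewrite sumr_const.
apply: (@le_trans _ _ (\sum_u expR th * w u)).
  rewrite [leRHS](bigID S) /= -[leLHS]addr0; apply: lerD; last first.
    by apply: sumr_ge0 => u _; rewrite wE mulr_ge0 ?expR_ge0.
  apply: ler_sum => u Su; rewrite wE -expRD -[leLHS]expR0 ler_expR.
  by move: Su => /= h; rewrite subr_ge0.
rewrite -mulr_sumr expRD ler_pM2l ?expR_gt0//.
have -> : \sum_u w u = \prod_t \prod_(s : 'I_k * bool)
    \sum_(i < M) expR (- (d t s.1 * (val i - cpart s.2 (y t s.1)) ^+ 2)).
  have -> : \prod_t \prod_(s : 'I_k * bool)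
      \sum_(i < M) expR (- (d t s.1 * (val i - cpart s.2 (y t s.1)) ^+ 2)) =
    \prod_t \sum_(x : {ffun 'I_k * bool -> 'I_M}) \prod_(s : 'I_k * bool)
      expR (- (d t s.1 * (val (x s) - cpart s.2 (y t s.1)) ^+ 2)).
    by apply: eq_bigr => t _; rewrite bigA_distr_bigA.
  by rewrite bigA_distr_bigA.
rewrite expR_sum; apply: ler_prod => t _; apply/andP; split.
  by apply: prodr_ge0 => s _; apply: sumr_ge0 => i _; exact: expR_ge0.
have d0 j : 0 < d t j by have /andP[] := dD t j.
have -> : \sum_(j < k) (2 * del + ln pi - ln (d t j) - 2 * ln eta) =
    \sum_(s : 'I_k * bool) (del + ln (pi / d t s.1) / 2 - ln eta).
  rewrite sum_pair; apply: eq_bigr => j _; rewrite big_bool /= ln_div ?posrE ?pi_gt0//.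
  by field.
rewrite expR_sum; apply: ler_prod => -[j b] _ /=; apply/andP; split.
  by apply: sumr_ge0 => i _; exact: expR_ge0.
have -> : expR (del + ln (pi / d t j) / 2 - ln eta) = expR del * Num.sqrt (pi / d t j) / eta.
  rewrite expRD [expR (- ln _)]expRN lnK ?posrE// expRD; congr (_ * _ / _).
  have q0 : 0 < pi / d t j by rewrite divr_gt0 ?pi_gt0.
  apply/eqP; rewrite -(@eqrXn2 _ 2) ?expR_ge0 ?sqrtr_ge0// sqr_sqrtr ?(ltW q0)//.
  by rewrite expr2 -expRD -splitr lnK ?posrE.
rewrite ler_pdivlMr// mulrC.
have := grid (d t j) (eta * B%:R + cpart b (y t j)) M (dD t j).
apply: le_trans; rewrite ler_pM2l//; apply: ler_sum => i _; rewrite ler_expR.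
by rewrite (_ : val i - _ = eta * i%:R - (eta * B%:R + cpart b (y t j)))// /val; ring.
Qed.
End Counting.

(** * Random coding *)

Section Resample.
Variables (R : realType) (I T : finType) (p : T -> R).
Hypothesis p1 : \sum_x p x = 1.

Lemma prodlaw_avg_le (F : {ffun I -> T} -> R) (c : R) : (forall x, 0 <= p x) ->
  (forall g, F g <= c) -> \sum_g prodlaw p g * F g <= c.
Proof.
move=> p0 Fc; rewrite -[leRHS]mul1r -(sum_prodlaw I p1) mulr_suml.
by apply: ler_sum => g _; rewrite ler_wpM2l ?prodlaw_ge0.
Qed.

Definition updf (g : {ffun I -> T}) (i : I) (x : T) : {ffun I -> T} :=
  [ffun j => if j == i then x else g j].

(** Exchanging entry i with a fresh independent letter is an involution that preserves the joint
    law. It lets a wrong codeword be averaged alone, with everything else in the code fixed. *)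
Lemma prodlaw_resample i (F : {ffun I -> T} -> R) :
  \sum_g prodlaw p g * F g = \sum_g prodlaw p g * \sum_x p x * F (updf g i x).
Proof.
under [RHS]eq_bigr do rewrite mulr_sumr.
rewrite pair_bigA /=.
pose phi (gx : {ffun I -> T} * T) := (updf gx.1 i gx.2, gx.1 i).
have phiK : involutive phi.
  move=> [g x]; rewrite /phi /=; congr (_, _); last by rewrite ffunE eqxx.
  by apply/ffunP => j; rewrite !ffunE; case: eqVneq => // ->.
rewrite [RHS](reindex_inj (inv_inj phiK)) /=.
rewrite -(pair_bigA _ (fun g x => prodlaw p (updf g i x) *
  (p (g i) * F (updf (updf g i x) i (g i))))) /=.
apply: eq_bigr => g _.
have updK x : updf (updf g i x) i (g i) = g.
  by apply/ffunP => j; rewrite !ffunE; case: eqVneq => // ->.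
under eq_bigr do rewrite updK.
have e x : prodlaw p (updf g i x) * (p (g i) * F g) = p x * (prodlaw p g * F g).
  rewrite /prodlaw (bigD1 i)//= ffunE eqxx [in RHS](bigD1 i)//=.
  have -> : \prod_(j | j != i) p (updf g i x j) = \prod_(j | j != i) p (g j).
    by apply: eq_bigr => j /negbTE ji; rewrite ffunE ji.
  by ring.
by under eq_bigr do rewrite e; rewrite -mulr_suml p1 mul1r.
Qed.
End Resample.

Section RandomCoding.
Variables (R : realType) (W U : finType) (good : W -> pred U).
Variables (confp : W -> W -> U -> R) (confc : U -> W -> U -> R) (Np Nc g : R).
Hypothesis confp_le : forall w u, good w u -> \sum_w' confp w' w u <= Np.
Hypothesis confc_le : forall w u, good w u -> \sum_u' confc u' w u <= Nc.
Hypothesis W0 : (0 < #|W|)%N.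
Hypothesis U0 : (0 < #|U|)%N.
Hypothesis good_ge : forall w, g * #|U|%:R <= #|good w|%:R.
Hypothesis Np0 : 0 <= Np.
Hypothesis Nc0 : 0 <= Nc.
Variables Mp Mc L : nat.
Hypothesis Mp0 : (0 < Mp)%N.
Hypothesis Mc0 : (0 < Mc)%N.

Definition selw (cw : {ffun 'I_Mp -> W}) (cu : {ffun 'I_Mc * 'I_L -> U}) mp mc : option U :=
  omap (fun l => cu (mc, l)) [pick l | good (cw mp) (cu (mc, l))].

(** One cost for both receivers, so that a single averaging yields a code good for each. Only
    auxiliary words of other bins are charged: confusing two words of the same bin does not alter
    the decoded message. An encoding failure costs 1, the largest error probability. *)
Definition code_cost (cw : {ffun 'I_Mp -> W}) (cu : {ffun 'I_Mc * 'I_L -> U}) mp mc : R :=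
  if selw cw cu mp mc is Some u then
    \sum_(m' | m' != mp) confp (cw m') (cw mp) u
    + \sum_(i | i.1 != mc) confc (cu i) (cw mp) u
  else 1.

Let pW (_ : W) : R := #|W|%:R^-1.
Let pU (_ : U) : R := #|U|%:R^-1.
Let W0r : 0 < #|W|%:R :> R. Proof. by rewrite ltr0n. Qed.
Let U0r : 0 < #|U|%:R :> R. Proof. by rewrite ltr0n. Qed.
Let pW1 : \sum_x pW x = 1. Proof. by rewrite sum_cst mulfV// gt_eqF. Qed.
Let pU1 : \sum_x pU x = 1. Proof. by rewrite sum_cst mulfV// gt_eqF. Qed.
Let pW0 x : 0 <= pW x. Proof. by rewrite invr_ge0 ltW. Qed.
Let pU0 x : 0 <= pU x. Proof. by rewrite invr_ge0 ltW. Qed.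

Let bound : R := (1 - g) ^+ L + (Mp.-1)%:R * (Np / #|W|%:R)
  + (Mc.-1 * L)%:R * (Nc / #|U|%:R).

(** The three terms of the bound are an empty bin, a wrong primary word and an auxiliary word of a
    wrong bin. The total confusion over all candidates is at most [Np] or [Nc], so one uniformly
    drawn candidate is confused with probability at most that total over the number of
    candidates. *)
Lemma expected_code_cost mp mc :
  \sum_cw prodlaw pW cw * \sum_cu prodlaw pU cu * code_cost cw cu mp mc <= bound.
Proof.
pose none cw cu : R := (selw cw cu mp mc == None)%:R.
pose cp m' cw cu : R := if selw cw cu mp mc is Some u then confp (cw m') (cw mp) u else 0.
pose cc i cw cu : R := if selw cw cu mp mc is Some u then confc (cu i) (cw mp) u else 0.
have costE cw cu : code_cost cw cu mp mc = none cw cu +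
    \sum_(m' | m' != mp) cp m' cw cu + \sum_(i | i.1 != mc) cc i cw cu.
  rewrite /code_cost /none /cp /cc; case: selw => [u|] /=; first by rewrite add0r.
  by rewrite !big1 ?addr0.
pose EE (F : {ffun 'I_Mp -> W} -> {ffun 'I_Mc * 'I_L -> U} -> R) :=
  \sum_cw prodlaw pW cw * \sum_cu prodlaw pU cu * F cw cu.
have EEle F c : (forall cw, \sum_cu prodlaw pU cu * F cw cu <= c) -> EE F <= c.
  by move=> h; exact: prodlaw_avg_le.
have EEle' F c : (forall cu, \sum_cw prodlaw pW cw * F cw cu <= c) -> EE F <= c.
  move=> h; rewrite /EE; under eq_bigr do rewrite mulr_sumr.
  rewrite exchange_big /=.
  apply: le_trans (prodlaw_avg_le pU1 pU0 h); apply: ler_sum => cu _.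
  by rewrite mulr_sumr; apply: ler_sum => cw _; rewrite mulrCA.
have -> : \sum_cw prodlaw pW cw * \sum_cu prodlaw pU cu * code_cost cw cu mp mc =
    EE none + \sum_(m' | m' != mp) EE (cp m') + \sum_(i | i.1 != mc) EE (cc i).
  rewrite /EE exchange_big [X in _ = _ + X]exchange_big -!big_split /=.
  apply: eq_bigr => cw _; rewrite -!mulr_sumr -!mulrDr; congr (_ * _).
  rewrite exchange_big [X in _ = _ + X]exchange_big -!big_split /=.
  by apply: eq_bigr => cu _; rewrite costE -!mulr_sumr -!mulrDr.
rewrite /bound; apply: lerD; first apply: lerD.
- apply: EEle => cw.
  pose F (i : 'I_Mc * 'I_L) (u : U) : R := if i.1 == mc then (~~ good (cw mp) u)%:R else 1.
  apply: (@le_trans _ _ (\sum_cu prodlaw pU cu * \prod_i F i (cu i))).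
    apply: ler_sum => cu _; rewrite ler_wpM2l ?prodlaw_ge0//.
    rewrite /none /selw; case: pickP => [l _|h] /=.
      by apply: prodr_ge0 => i _; rewrite /F; case: ifP.
    rewrite big1// => -[m l] _; rewrite /F /=; case: eqVneq => // ->.
    by rewrite h.
  rewrite sum_prodlaw_prod.
  have -> : \prod_i \sum_x pU x * F i x =
      \prod_(m < Mc) \prod_(l < L) \sum_x pU x * F (m, l) x.
    by rewrite pair_bigA; apply: eq_bigr => -[].
  rewrite (bigD1 mc)//= [X in _ * X]big1 ?mulr1; last first.
    move=> m /negbTE nm; rewrite big1// => l _; rewrite -[RHS]pU1.
    by apply: eq_bigr => x _; rewrite /F /= nm mulr1.
  have E l : \sum_x pU x * F (mc, l) x = 1 - #|good (cw mp)|%:R / #|U|%:R.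
    rewrite /F eqxx /= -mulr_sumr.
    have -> : \sum_(x : U) ((~~ good (cw mp) x)%:R : R) = #|U|%:R - #|good (cw mp)|%:R.
      rewrite -(cardC (good (cw mp))) natrD addrAC subrr add0r.
      rewrite -sum1_card natr_sum [RHS]big_mkcond /=; apply: eq_bigr => x _.
      by rewrite inE /=; case: (x \in _) / idP => h; rewrite unfold_in in h;
        case: (good _ _) h => // /(_ isT).
    by rewrite mulrBr mulVf ?gt_eqF// mulrC.
  under eq_bigr do rewrite E.
  rewrite prodr_const card_ord; apply: lerXn2r.
  + rewrite nnegrE subr_ge0 ler_pdivrMr// mul1r ler_nat; exact: max_card.
  + rewrite nnegrE subr_ge0; have := good_ge (cw mp).
    move=> h; rewrite -(ler_pM2r U0r) mul1r (le_trans h)// ler_nat; exact: max_card.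
  + by rewrite lerD2l lerN2 ler_pdivlMr.
- have -> : (Mp.-1)%:R * (Np / #|W|%:R) = \sum_(m' : 'I_Mp | m' != mp) Np / #|W|%:R.
    rewrite sumr_const mulr_natl; congr (_ *+ _).
    by rewrite -[in LHS](card_ord Mp) -(cardC1 mp); apply: eq_card => x; rewrite !inE.
  apply: ler_sum => m' m'mp; apply: EEle' => cu.
  (* The transmitted pair does not depend on the word of m', which may therefore be redrawn. *)
  rewrite (prodlaw_resample pW1 m'); apply: prodlaw_avg_le => // cw.
  have ew x : updf cw m' x mp = cw mp by rewrite ffunE eq_sym (negbTE m'mp).
  have es x : selw (updf cw m' x) cu mp mc = selw cw cu mp mc by rewrite /selw ew.
  under eq_bigr do rewrite /cp es ew ffunE eqxx.
  case E : (selw cw cu mp mc) => [u|]; last first.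
    by rewrite big1 ?divr_ge0// => x _; rewrite mulr0.
  rewrite -mulr_sumr mulrC ler_pM2r ?invr_gt0//; apply: confp_le.
  by move: E; rewrite /selw; case: pickP => //= l hl [<-].
- have -> : (Mc.-1 * L)%:R * (Nc / #|U|%:R) =
      \sum_(i : 'I_Mc * 'I_L | i.1 != mc) Nc / #|U|%:R.
    rewrite sumr_const mulr_natl; congr (_ *+ _).
    have -> : #|(fun i : 'I_Mc * 'I_L => i.1 != mc)| = #|predX (predC1 mc) (@predT 'I_L)|.
      by apply: eq_card => -[a b]; rewrite !inE andbT.
    by rewrite cardX cardC1 card_ord cardT size_enum_ord.
  apply: ler_sum => i imc; apply: EEle => cw.
  (* The encoder inspects the bin of mc only, so redrawing a word of another bin leaves its choice
     unchanged. *)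
  rewrite (prodlaw_resample pU1 i); apply: prodlaw_avg_le => // cu.
  have eu x l : updf cu i x (mc, l) = cu (mc, l).
    by rewrite ffunE; case: eqVneq => // ei; rewrite -ei eqxx in imc.
  have es x : selw cw (updf cu i x) mp mc = selw cw cu mp mc.
    rewrite /selw; under eq_pick do rewrite eu.
    by case: pickP => //= l _; rewrite eu.
  under eq_bigr do rewrite /cc es ffunE eqxx.
  case E : (selw cw cu mp mc) => [u|]; last first.
    by rewrite big1 ?divr_ge0// => x _; rewrite mulr0.
  rewrite -mulr_sumr mulrC ler_pM2r ?invr_gt0//; apply: confc_le.
  by move: E; rewrite /selw; case: pickP => //= l hl [<-].
Qed.

Lemma good_code_exists : exists cw cu,
  \sum_mp \sum_mc code_cost cw cu mp mc <= (Mp * Mc)%:R * bound.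
Proof.
apply: contrapT => /forallNP h.
have {}h cw cu : (Mp * Mc)%:R * bound < \sum_mp \sum_mc code_cost cw cu mp mc.
  by rewrite ltNge; apply/negP => hle; apply: (h cw); exists cu.
pose TT := \sum_cw prodlaw pW cw * \sum_cu prodlaw pU cu * \sum_mp \sum_mc code_cost cw cu mp mc.
have : TT <= (Mp * Mc)%:R * bound.
  have -> : TT = \sum_mp \sum_mc \sum_cw prodlaw pW cw *
      \sum_cu prodlaw pU cu * code_cost cw cu mp mc.
    under [RHS]eq_bigr do rewrite exchange_big /=.
    rewrite [RHS]exchange_big /=; apply: eq_bigr => cw _.
    under [RHS]eq_bigr do rewrite -mulr_sumr exchange_big /=.
    rewrite -mulr_sumr exchange_big /=; congr (_ * _); apply: eq_bigr => cu _.
    rewrite mulr_sumr; apply: eq_bigr => mp _.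
    by rewrite mulr_sumr.
  apply: (@le_trans _ _ (\sum_(mp < Mp) \sum_(mc < Mc) bound)).
    by apply: ler_sum => mp _; apply: ler_sum => mc _; exact: expected_code_cost.
  by rewrite !sum_cst !card_ord natrM mulrA.
apply/negP; rewrite -ltNge.
have strict (I T : finType) (q : T -> R) (F : {ffun I -> T} -> R) c (x0 : T) :
    (forall x, 0 < q x) -> \sum_x q x = 1 -> (forall f, c < F f) ->
    c < \sum_f prodlaw q f * F f.
  move=> q0 q1 cF; rewrite -[ltLHS]mul1r -(sum_prodlaw I q1) mulr_suml.
  apply: ltr_sum.
    by apply/hasP; exists [ffun=> x0]; rewrite ?mem_index_enum.
  by move=> f _; rewrite ltr_pM2l//; apply: prodr_gt0.
apply: (strict _ _ pW _ _ (enum_val (Ordinal W0))) => //.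
  by move=> x; rewrite invr_gt0.
move=> cw; apply: (strict _ _ pU _ _ (enum_val (Ordinal U0))) => //.
by move=> x; rewrite invr_gt0.
Qed.
End RandomCoding.

Local Open Scope complex_scope.

(** * Linear algebra of the channel *)

Section ConjTranspose.
Variable R : realType.
Local Notation C := R[i].

Lemma mx_addE m n (A B : 'M[C]_(m, n)) i j : (A + B) i j = A i j + B i j.
Proof. by rewrite mxE. Qed.

Lemma mx_subE m n (A B : 'M[C]_(m, n)) i j : (A - B) i j = A i j - B i j.
Proof. by rewrite !mxE. Qed.

Lemma mx_scaleE m n c (A : 'M[C]_(m, n)) i j : (c *: A) i j = c * A i j.
Proof. by rewrite mxE. Qed.

Lemma ctrE m n (A : 'M[C]_(m, n)) i j : ctr A i j = conjc (A j i).
Proof. by rewrite !mxE. Qed.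

Lemma ctrM m n p (A : 'M[C]_(m, n)) (B : 'M[C]_(n, p)) : ctr (A *m B) = ctr B *m ctr A.
Proof. by rewrite /ctr map_mxM trmx_mul. Qed.

Lemma ctrK m n (A : 'M[C]_(m, n)) : ctr (ctr A) = A.
Proof. by apply/matrixP => i j; rewrite !mxE; case: (A i j) => a b; rewrite /= opprK. Qed.

Lemma ctrD m n (A B : 'M[C]_(m, n)) : ctr (A + B) = ctr A + ctr B.
Proof. by rewrite /ctr map_mxD linearD. Qed.

Lemma ctr1 n : ctr (1%:M : 'M[C]_n) = 1%:M.
Proof. by rewrite /ctr map_mx1 trmx1. Qed.

Lemma mul_conjc_nsq (x : C) : x * conjc x = (nsq x)%:C.
Proof.
case: x => a b; rewrite /nsq /=; apply/eqP; rewrite eq_complex /=.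
by apply/andP; split; apply/eqP; ring.
Qed.

Lemma nsqM (x y : C) : nsq (x * y) = nsq x * nsq y.
Proof. by case: x => a b; case: y => c d; rewrite /nsq /=; ring. Qed.

Lemma nsq_real (x : R) : nsq x%:C = x ^+ 2.
Proof. by rewrite /nsq /= expr0n addr0. Qed.

Lemma mulmx_ctr_diag m n (A : 'M[C]_(m, n)) i : (A *m ctr A) i i = (\sum_j nsq (A i j))%:C.
Proof.
rewrite mxE rmorph_sum; apply: eq_bigr => j _.
by rewrite !mxE mul_conjc_nsq.
Qed.

Definition frob m n (A : 'M[C]_(m, n)) : R := \sum_i \sum_j nsq (A i j).

Lemma frob_ge0 m n (A : 'M[C]_(m, n)) : 0 <= frob A.
Proof. by apply: sumr_ge0 => i _; apply: sumr_ge0 => j _; exact: nsq_ge0. Qed.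

Lemma trace_mulmx_ctr m n (A : 'M[C]_(m, n)) : \tr (A *m ctr A) = (frob A)%:C.
Proof.
by rewrite /mxtrace /frob rmorph_sum; apply: eq_bigr => i _; exact: mulmx_ctr_diag.
Qed.

Lemma frobZ m n (c : R) (A : 'M[C]_(m, n)) : frob (c%:C *: A) = c ^+ 2 * frob A.
Proof.
rewrite /frob mulr_sumr; apply: eq_bigr => i _; rewrite mulr_sumr; apply: eq_bigr => j _.
by rewrite mxE nsqM nsq_real.
Qed.

Lemma ge0_complex (x : C) : 0 <= x -> x = (complex.Re x)%:C /\ 0 <= complex.Re x.
Proof. by case: x => a b; rewrite lecE /= => /andP[/eqP -> ->]. Qed.

Lemma psd_mul_ctr m n (A : 'M[C]_(m, n)) : psd (A *m ctr A).
Proof.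
move=> v; have -> : ctr v *m (A *m ctr A) *m v = (ctr v *m A) *m ctr (ctr v *m A).
  by rewrite ctrM ctrK !mulmxA.
by rewrite mulmx_ctr_diag lecR; apply: sumr_ge0 => j _; exact: nsq_ge0.
Qed.

(** A quadratic form with real values vanishes on A - [ctr] A; polarisation along u + v and u + iv
    then kills the whole sesquilinear form. *)
Lemma psd_herm n (A : 'M[C]_n) : psd A -> ctr A = A.
Proof.
move=> pA; pose q (u v : 'cV[C]_n) := (ctr u *m (A - ctr A) *m v) 0 0.
have qvv v : q v v = 0.
  rewrite /q mulmxBr mulmxBl mx_subE.
  have [e _] := ge0_complex (pA v).
  have -> : (ctr v *m ctr A *m v) 0 0 = conjc ((ctr v *m A *m v) 0 0).
    have -> : ctr v *m ctr A *m v = ctr (ctr v *m A *m v).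
      by rewrite !ctrM ctrK mulmxA.
    by rewrite ctrE.
  by rewrite e /= oppr0 subrr.
have qD u v w z : q (u + v) (w + z) = q u w + q u z + q v w + q v z.
  by rewrite /q ctrD !mulmxDl !mulmxDr !mx_addE addrA.
have q1 u v : q u v + q v u = 0.
  by have := qvv (u + v); rewrite qD !qvv addr0 add0r.
have qZr u v c : q u (c *: v) = c * q u v by rewrite /q -scalemxAr mx_scaleE.
have qZl u v c : q (c *: u) v = conjc c * q u v.
  rewrite /q; have -> : ctr (c *: u) = conjc c *: ctr u.
    by apply/matrixP => i j; rewrite !mxE rmorphM.
  by rewrite -!scalemxAl mx_scaleE.
have q2 u v : q u v - q v u = 0.
  have := q1 u ('i%C *: v); rewrite qZr qZl.
  have -> : conjc 'i%C = - 'i%C :> C by apply/eqP; rewrite eq_complex /= oppr0 !eqxx.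
  rewrite mulNr -mulrBr => /eqP; rewrite mulf_eq0 => /orP[|/eqP//].
  by rewrite eq_complex /= oner_eq0 andbF.
have q0 u v : q u v = 0.
  have : q u v + q u v = 0.
    have := congr2 +%R (q1 u v) (q2 u v); rewrite addr0 addrACA subrr addr0; exact.
  by move=> /eqP; rewrite -mulr2n mulrn_eq0 /= => /eqP.
apply/esym/subr0_eq/matrixP => i j; rewrite [RHS]mxE -(q0 (delta_mx i 0) (delta_mx j 0)) /q.
have -> : ctr (delta_mx i 0 : 'cV[C]_n) = delta_mx 0 i.
  by apply/matrixP => a b; rewrite ctrE !mxE andbC; case: andb; rewrite /= oppr0.
by rewrite -rowE -colE !mxE.
Qed.
End ConjTranspose.

Section Spectral.
Variable R : realType.
Local Notation C := R[i].
Local Open Scope sesquilinear_scope.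

Lemma ctr_trmxC m n (A : 'M[C]_(m, n)) : ctr A = A ^t*.
Proof. by apply/matrixP => i j; rewrite !mxE. Qed.

Definition rdiag n (d : 'I_n -> R) : 'M[C]_n := diag_mx (\row_i (d i)%:C).

Lemma rdiagE n (d : 'I_n -> R) i j : rdiag d i j = (d i)%:C *+ (i == j).
Proof. by rewrite !mxE. Qed.

Lemma mul_rdiag_mx m n (d : 'I_m -> R) (A : 'M[C]_(m, n)) i j :
  (rdiag d *m A) i j = (d i)%:C * A i j.
Proof. by rewrite /rdiag mul_diag_mx !mxE. Qed.

Lemma ctr_rdiag n (d : 'I_n -> R) : ctr (rdiag d) = rdiag d.
Proof.
apply/matrixP => i j; rewrite ctrE !rdiagE eq_sym.
by case: eqP => [->|_]; rewrite /= oppr0.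
Qed.

Lemma det_rdiag n (d : 'I_n -> R) : \det (rdiag d) = (\prod_i d i)%:C.
Proof. by rewrite det_diag rmorph_prod; apply: eq_bigr => i _; rewrite mxE. Qed.

Lemma psd_diagonalize n (A : 'M[C]_n) : psd A ->
  exists (V : 'M[C]_n) (d : 'I_n -> R), [/\ V *m ctr V = 1%:M, ctr V *m V = 1%:M,
    forall i, 0 <= d i & ctr V *m A *m V = rdiag d].
Proof.
move=> pA; have hA := psd_herm pA.
have An : A \is normalmx by apply/normalmxP; rewrite -!ctr_trmxC hA.
pose P := spectralmx A; pose sp := spectral_diag A.
have /orthomx_spectralP AE := An.
have Pu := spectral_unitarymx A.
have PP : P *m ctr P = 1%:M by rewrite ctr_trmxC; apply/unitarymxP.
have PP' : ctr P *m P = 1%:M by apply: mulmx1C.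
have iP : invmx P = ctr P.
  have Pun : P \in unitmx := spectral_unit A.
  by rewrite -[LHS]mulmx1 -PP mulmxA mulVmx// mul1mx.
have D : P *m A *m ctr P = diag_mx sp.
  rewrite AE -/P -/sp iP !mulmxA PP mul1mx -mulmxA PP mulmx1//.
have spE i : sp 0 i = (P *m A *m ctr P) i i by rewrite D !mxE eqxx.
have sp0 i : 0 <= sp 0 i.
  rewrite spE; have := pA (ctr (row i P)); rewrite ctrK.
  have -> : row i P *m A *m ctr (row i P) = row i (P *m A) *m col i (ctr P).
    rewrite row_mul; congr (_ *m _); apply/matrixP => a b.
    by rewrite ctrE !mxE.
  move: (P *m A) (ctr P) => X Y.
  suff -> : (row i X *m col i Y) 0 0 = (X *m Y) i i by [].
  by rewrite !mxE; apply: eq_bigr => k _; rewrite !mxE.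
exists (ctr P), (fun i => complex.Re (sp 0 i)); split; rewrite ?ctrK//.
  by move=> i; have [] := ge0_complex (sp0 i).
rewrite D; congr diag_mx; apply/rowP => i; rewrite mxE.
by have [] := ge0_complex (sp0 i).
Qed.

Lemma psd_factor n (A : 'M[C]_n) : psd A -> exists F : 'M[C]_n, A = F *m ctr F.
Proof.
move=> /psd_diagonalize[V [d [VV VV' d0 E]]].
exists (V *m rdiag (fun i => Num.sqrt (d i))).
rewrite ctrM ctr_rdiag mulmxA -[V *m _ *m _]mulmxA.
have -> : rdiag (fun i => Num.sqrt (d i)) *m rdiag (fun i => Num.sqrt (d i)) = rdiag d.
  apply/matrixP => i j; rewrite mul_rdiag_mx !rdiagE mulrnAr -rmorphM.
  by rewrite -expr2 sqr_sqrtr.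
by rewrite -E !mulmxA VV mul1mx -mulmxA VV mulmx1.
Qed.

(** Both sides are the determinant of the block matrix with rows (1, -A) and (B, 1), factored by
    eliminating one block or the other. *)
Lemma det_1mul_comm m n (A : 'M[C]_(m, n)) (B : 'M[C]_(n, m)) :
  \det (1%:M + A *m B) = \det (1%:M + B *m A).
Proof.
have E1 : block_mx 1%:M (- A) B 1%:M =
    block_mx 1%:M 0 B 1%:M *m block_mx 1%:M (- A) 0 (1%:M + B *m A).
  by rewrite mulmx_block !mul1mx !mulmx1 !mul0mx !addr0 mulmxN addrCA addNr addr0.
have E2 : block_mx 1%:M (- A) B 1%:M =
    block_mx 1%:M (- A) 0 1%:M *m block_mx (1%:M + A *m B) 0 B 1%:M.
  by rewrite mulmx_block !mul1mx !mulmx1 !mul0mx !add0r mulNmx addrK.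
have := congr1 determinant E1; rewrite {1}E2 !det_mulmx.
by rewrite det_lblock det_ublock det_lblock det_ublock !det1 !mul1r !mulr1.
Qed.

Lemma det_1rdiag n (d : 'I_n -> R) :
  \det (1%:M + rdiag d) = (\prod_i (1 + d i))%:C.
Proof.
rewrite -det_rdiag; congr determinant.
by apply/matrixP => i j; rewrite mx_addE !rdiagE mxE rmorphD /= mulrnDl.
Qed.

Lemma det_1psd n (A : 'M[C]_n) : psd A -> exists2 x : R, 0 < x & \det (1%:M + A) = x%:C.
Proof.
move=> /psd_diagonalize[V [d [VV VV' d0 E]]].
exists (\prod_i (1 + d i)).
  by apply: prodr_gt0 => i _; rewrite ltr_wpDr.
have AE : A = V *m (rdiag d *m ctr V) by rewrite -E !mulmxA VV mul1mx -mulmxA VV mulmx1.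
by rewrite AE det_1mul_comm -mulmxA VV' mulmx1 det_1rdiag.
Qed.
End Spectral.

Section FrobCauchy.
Variable R : realType.
Local Notation C := R[i].

(** Cauchy-Schwarz: both sides are written as double sums, the right one symmetrised, and compared
    term by term with 2xy <= x^2 + y^2. *)
Lemma nsq_sum_mul (I : finType) (a b : I -> C) :
  nsq (\sum_k a k * b k) <= (\sum_k nsq (a k)) * (\sum_k nsq (b k)).
Proof.
pose re (x y : C) := complex.Re x * complex.Re y + complex.Im x * complex.Im y.
have -> : nsq (\sum_k a k * b k) = \sum_k \sum_l re (a k * b k) (a l * b l).
  set S := \sum_k a k * b k.
  transitivity (cpart false S * cpart false S + cpart true S * cpart true S).
    by rewrite /nsq !expr2.
  rewrite !cpart_sum !sum_mul -big_split /=.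
  by apply: eq_bigr => k _; rewrite -big_split.
have -> : (\sum_k nsq (a k)) * (\sum_k nsq (b k)) =
    \sum_k \sum_l (nsq (a k) * nsq (b l) + nsq (a l) * nsq (b k)) / 2.
  have e : \sum_k \sum_l nsq (a l) * nsq (b k) = (\sum_k nsq (a k)) * (\sum_k nsq (b k)).
    by rewrite sum_mul exchange_big.
  transitivity (((\sum_k nsq (a k)) * (\sum_k nsq (b k)) +
    \sum_k \sum_l nsq (a l) * nsq (b k)) / 2); first by rewrite e; field.
  rewrite sum_mul -big_split /= mulr_suml; apply: eq_bigr => k _.
  by rewrite -big_split /= mulr_suml.
apply: ler_sum => k _; apply: ler_sum => l _.
case: (a k) (b k) (a l) (b l) => a1 a2 [b1 b2] [c1 c2] [d1 d2]; rewrite /re /nsq /=.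
have := sqr_ge0 ((a1 * d1 + a2 * d2) - (c1 * b1 + c2 * b2)).
have := sqr_ge0 ((a2 * d1 - a1 * d2) - (c2 * b1 - c1 * b2)).
rewrite ler_pdivlMr//; nra.
Qed.

Lemma frob_mul m n p (A : 'M[C]_(m, n)) (B : 'M[C]_(n, p)) :
  frob (A *m B) <= frob A * frob B.
Proof.
rewrite /frob mulr_suml; apply: ler_sum => i _.
rewrite [X in _ <= _ * X]exchange_big mulr_sumr; apply: ler_sum => j _.
by rewrite mxE; exact: nsq_sum_mul.
Qed.

Lemma col_le_frob m n (A : 'M[C]_(m, n)) j : \sum_i nsq (A i j) <= frob A.
Proof.
rewrite /frob exchange_big (bigD1 j)//= lerDl; apply: sumr_ge0 => k _.
by apply: sumr_ge0 => i _; exact: nsq_ge0.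
Qed.

Lemma ln_prod (I : finType) (x : I -> R) : (forall i, 0 < x i) ->
  ln (\prod_i x i) = \sum_i ln (x i).
Proof.
move=> x0; rewrite -[RHS]expRK expR_sum; congr ln.
by apply: eq_bigr => i _; rewrite lnK ?posrE.
Qed.

(** Combines ln(1+sd) - ln(1+d) >= (s-1)d/(1+sd) with ln(1+d) <= d. The relative gain is worst at
    the largest d, so a bound D on the gains makes it uniform. *)
Lemma ln1D_boost (d D s : R) : 0 <= d -> d <= D -> 1 <= s ->
  (1 + (s - 1) / (1 + s * D)) * ln (1 + d) <= ln (1 + s * d).
Proof.
move=> d0 dD s1; have D0 : 0 <= D := le_trans d0 dD.
have sd : 0 <= s * d by rewrite mulr_ge0//; lra.
have sD : 0 <= s * D by rewrite mulr_ge0//; lra.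
have h1 : ln (1 + d) <= d by apply: le_ln1Dx; lra.
have h2 : (s - 1) / (1 + s * D) * ln (1 + d) <= (s - 1) * d / (1 + s * d).
  rewrite mulrAC ler_pdivrMr; last lra.
  rewrite mulrAC ler_pdivlMr; last lra.
  have h3 : ln (1 + d) * (1 + s * d) <= d * (1 + s * D).
    apply: ler_pM => //; first by apply: ln_ge0; lra.
    - lra.
    - by rewrite lerD2l ler_pM2l//; lra.
  rewrite -!mulrA; apply: ler_wpM2l => //; lra.
have h3 : (s - 1) * d / (1 + s * d) <= ln (1 + s * d) - ln (1 + d).
  have e : ln (1 + s * d) - ln (1 + d) = - ln ((1 + d) / (1 + s * d)).
    by rewrite ln_div ?posrE; [ring|lra..].
  have : ln (1 + ((1 + d) / (1 + s * d) - 1)) <= (1 + d) / (1 + s * d) - 1.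
    apply: le_ln1Dx; rewrite ltrBrDl addrN divr_gt0//; lra.
  rewrite addrCA subrr addr0 => h; rewrite e lerNr; apply: le_trans h _.
  rewrite le_eqVlt; apply/orP; left; apply/eqP; field; rewrite gt_eqF//; lra.
by rewrite mulrDl mul1r; lra.
Qed.
End FrobCauchy.

(* A mode is a transmission strategy for one channel use: the primary sends [mFp w] and the
   cognitive transmitter [mFcw w + mFcv v]; [mKp] and [mKc] are the linear estimators of [w] and
   of the auxiliary letter [u], and [mdp], [mdc] the inverses of the error variances of their
   coordinates, so that the rates are the sums of the logarithms of [mdp] and [mdc]. *)
Record mode (R : realType) (npt nct npr ncr a b : nat) := Mode {
  mFp : 'M[R[i]]_(npt, a);
  mFcw : 'M[R[i]]_(nct, a);
  mFcv : 'M[R[i]]_(nct, b);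
  mKp : 'M[R[i]]_(a, npr);
  mKc : 'M[R[i]]_(b, ncr);
  mdp : 'I_a -> R;
  mdc : 'I_b -> R }.

Section Modes.
Variable R : realType.
Local Notation C := R[i].
Variables (npt nct npr ncr : nat).
Variables (Hpp : 'M[C]_(npr, npt)) (Hcp : 'M[C]_(npr, nct)) (Hcc : 'M[C]_(ncr, nct)).

(** The first two sums are weighted mean square errors of the linear estimates, for unit-variance
    letters and noise: each coordinate may err by the inverse of its weight on average. The primary
    receiver suffers from v as an interferer; the cognitive error has no term in w, because the
    choice of u compensates w. *)
Definition mode_ok (a b : nat) (Pp Pc : R) (m : mode R npt nct npr ncr a b) : Prop :=
  [/\ forall j, 1 <= mdp m j, forall j, 1 <= mdc m j,
    \sum_j mdp m j * (\sum_i nsq ((1%:M - mKp m *m (Hpp *m mFp m + Hcp *m mFcw m)) j i)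
      + \sum_i nsq ((mKp m *m (Hcp *m mFcv m)) j i) + \sum_i nsq (mKp m j i)) <= a%:R &
    \sum_j mdc m j * (\sum_i nsq ((1%:M - mKc m *m (Hcc *m mFcv m)) j i)
      + \sum_i nsq (mKc m j i)) <= b%:R] /\
  frob (mFp m) <= Pp /\ frob (mFcw m) + frob (mFcv m) <= Pc.

Definition gain_bound (Pp Pc : R) : R :=
  frob (row_mx Hpp Hcp) * (Pp + Pc) + frob Hcc * Pc.

(* The decorrelating factor: rotating a square root of [S] by the eigenbasis of
   [ctr (H F) *m M *m (H F)] makes the effective channel diagonal. *)
Lemma psd_factor_diag n k (S : 'M[C]_n) (H : 'M[C]_(k, n)) (M : 'M[C]_k) : psd S ->
  (forall y : 'M[C]_(k, n), psd (ctr y *m M *m y)) ->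
  exists (F : 'M[C]_n) (d : 'I_n -> R), [/\ S = F *m ctr F, forall i, 0 <= d i &
    ctr (H *m F) *m M *m (H *m F) = rdiag d].
Proof.
move=> /psd_factor[F SF] pM.
have [V [d [VV VV' d0 E]]] := psd_diagonalize (pM (H *m F)).
exists (F *m V), d; split => //.
  by rewrite ctrM mulmxA -[F *m V *m _]mulmxA VV mulmx1.
by rewrite -E !(mulmxA, ctrM).
Qed.

(** The letters w are amplified by s but v only by the square root of s. Noise plus interference at
    the primary receiver then grows at most by the factor s, while the primary signal power grows by
    [s ^+ 2]; so all eigenvalue gains, primary and cognitive, can be multiplied by s, and
    [ln1D_boost] raises both rates by one factor. *)
Lemma Rach_mode (Pp Pc s : R) (r : R * R) : 1 <= s -> Rach_rates Hpp Hcp Hcc Pp Pc r ->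
  exists m : mode R npt nct npr ncr (npt + nct) nct,
  let g := (s - 1) / (1 + s * gain_bound Pp Pc) in
  [/\ mode_ok (s ^+ 2 * Pp) (s ^+ 2 * Pc) m,
      (1 + g) * (r.1 * ln 2) <= \sum_j ln (mdp m j),
      (1 + g) * (r.2 * ln 2) <= \sum_j ln (mdc m j) &
      [/\ 0 <= Pp, 0 <= Pc, 0 <= r.1 & 0 <= r.2]].
Proof.
move=> s1 [Sp [Scp [Scc [Q [[r10 r20 pSp pScp pScc] [pS tSp tSc hr1 hr2]]]]]].
set G := row_mx Hpp Hcp in hr1; set Snet := block_mx _ _ _ _ in pS hr1.
have s0 : 0 < s by lra.
pose sq := Num.sqrt s; have sq2 : sq ^+ 2 = s by rewrite sqr_sqrtr// ltW.
have p1 (y : 'M[C]_(ncr, nct)) : psd (ctr y *m 1%:M *m y).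
  by rewrite mulmx1; have := psd_mul_ctr (ctr y); rewrite ctrK.
have [Fc [dc0 [SccE dc0_ge0 Dc]]] := @psd_factor_diag _ _ _ Hcc 1%:M pScc p1.
rewrite mulmx1 in Dc.
(* N is the covariance of noise plus cognitive interference at the primary receiver, before
   amplification. *)
pose T := Hcp *m Fc; pose B := T *m ctr T; pose N := 1%:M + B.
have BE : Hcp *m Scc *m ctr Hcp = B by rewrite SccE /B /T ctrM !mulmxA.
have [x0 x00 detN] := det_1psd (psd_mul_ctr T).
have Nu : N \in unitmx.
  rewrite unitmxE detN unitfE; apply/eqP => /(congr1 (@complex.Re R)) /= /eqP.
  by rewrite gt_eqF.
pose M := invmx N.
have MN : M *m N = 1%:M by exact: mulVmx.
have NM : N *m M = 1%:M by exact: mulmxV.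
have Nh : ctr N = N by rewrite ctrD ctr1 /B ctrM ctrK.
have Mh : ctr M = M.
  rewrite -[LHS]mulmx1 -NM mulmxA; rewrite -{1}Nh -ctrM.
  by rewrite NM ctr1 mul1mx.
have yMy k (y : 'M[C]_(npr, k)) : ctr y *m M *m y = ctr (M *m y) *m N *m (M *m y).
  by rewrite ctrM Mh !mulmxA -[ctr y *m M *m N]mulmxA MN mulmx1.
have pM (y : 'M[C]_(npr, npt + nct)) : psd (ctr y *m M *m y).
  rewrite yMy; set Y := M *m y => v.
  have -> : ctr v *m (ctr Y *m N *m Y) *m v =
      ctr v *m (ctr Y *m Y) *m v + ctr v *m ((ctr Y *m T) *m ctr (ctr Y *m T)) *m v.
    rewrite /N /B ctrM ctrK mulmxDr mulmx1 !mulmxDl !mulmxDr !mulmxDl.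
    by rewrite !mulmxA.
  rewrite mx_addE addr_ge0//; last exact: psd_mul_ctr.
  by have := psd_mul_ctr (ctr Y) v; rewrite ctrK.
have [F [dp0 [SE dp0_ge0 Dp]]] := @psd_factor_diag _ _ _ G M pS pM.
pose Fu := usubmx F; pose Fd := dsubmx F.
have FE : F = col_mx Fu Fd by rewrite vsubmxK.
have [SpE ScpE] : Sp = Fu *m ctr Fu /\ Scp = Fd *m ctr Fd.
  have : block_mx Sp Q (ctr Q) Scp = block_mx (Fu *m ctr Fu) (Fu *m ctr Fd)
      (Fd *m ctr Fu) (Fd *m ctr Fd).
    rewrite -mul_col_row -/Snet SE {1}FE; congr (_ *m _).
    by rewrite FE /ctr map_col_mx tr_col_mx.
  by move=> /eq_block_mx[].
have tSpE : frob Fu <= Pp by move: tSp; rewrite SpE trace_mulmx_ctr.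
have tScE : frob Fd + frob Fc <= Pc.
  by move: tSc; rewrite ScpE SccE mxtraceD !trace_mulmx_ctr.
have Fu0 := frob_ge0 Fu; have Fd0 := frob_ge0 Fd; have Fc0 := frob_ge0 Fc.
have Pp0 : 0 <= Pp by lra.
have Pc0 : 0 <= Pc by lra.
pose T0 := G *m F.
have T0E : T0 = Hpp *m Fu + Hcp *m Fd by rewrite /T0 FE mul_row_col.
have frobF : frob F <= Pp + Pc.
  have -> : frob F = frob Fu + frob Fd.
    rewrite /frob big_split_ord /=; congr (_ + _); apply: eq_bigr => i _.
      by apply: eq_bigr => j _; rewrite mxE.
    by apply: eq_bigr => j _; rewrite mxE.
  lra.
have G0 := frob_ge0 G; have H0 := frob_ge0 Hcc.
have gb : gain_bound Pp Pc = frob G * (Pp + Pc) + frob Hcc * Pc by [].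
have dp0_le j : dp0 j <= gain_bound Pp Pc.
  apply: (@le_trans _ _ (frob G * (Pp + Pc))); last first.
    by rewrite gb lerDl mulr_ge0.
  apply: (@le_trans _ _ (frob T0)); last first.
    by apply: le_trans (frob_mul _ _) _; rewrite ler_wpM2l.
  apply: le_trans (col_le_frob T0 j).
  pose Y := M *m T0.
  have T0Y : T0 = N *m Y by rewrite /Y mulmxA NM mul1mx.
  (* Since M is at most the identity, whitening cannot increase a gain; the difference is displayed
     as two Gram matrices. *)
  have e1 : ctr T0 *m T0 = ctr T0 *m M *m T0
      + (ctr Y *m T) *m ctr (ctr Y *m T) + (ctr Y *m B) *m ctr (ctr Y *m B).
    rewrite yMy -/Y {1 2}T0Y ctrM Nh ![ctr (ctr Y *m _)]ctrM ctrK.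
    have Bh : ctr B = B by rewrite /B ctrM ctrK.
    have NY : N *m Y = Y + B *m Y by rewrite /N mulmxDl mul1mx.
    have YN : ctr Y *m N = ctr Y + ctr Y *m B by rewrite /N mulmxDr mulmx1.
    rewrite Bh {1}NY mulmxDr -addrA; congr (_ + _).
    by rewrite {1}YN mulmxDl; congr (_ + _); rewrite /B !mulmxA.
  have e2 : ctr T0 *m T0 = (ctr T0) *m ctr (ctr T0) by rewrite ctrK.
  have := congr1 (fun X : 'M[C]_(npt + nct) => complex.Re (X j j)) e1.
  rewrite e2 !mx_addE !mulmx_ctr_diag /T0 Dp -/T0 rdiagE eqxx mulr1n /=.
  have -> : \sum_i nsq (ctr T0 j i) = \sum_i nsq (T0 i j).
    by apply: eq_bigr => i _; rewrite ctrE /nsq; case: (T0 i j) => ? ? /=; rewrite sqrrN.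
  have h1 : 0 <= \sum_i nsq ((ctr Y *m T) j i) by apply: sumr_ge0 => i _; exact: nsq_ge0.
  have h2 : 0 <= \sum_i nsq ((ctr Y *m B) j i) by apply: sumr_ge0 => i _; exact: nsq_ge0.
  move=> h; lra.
have dc0_le j : dc0 j <= gain_bound Pp Pc.
  apply: (@le_trans _ _ (frob Hcc * Pc)); last first.
    by rewrite gb lerDr mulr_ge0// addr_ge0.
  apply: (@le_trans _ _ (frob (Hcc *m Fc))); last first.
    by apply: le_trans (frob_mul _ _) _; rewrite ler_wpM2l//; lra.
  apply: le_trans (col_le_frob _ j).
  have := congr1 (fun X : 'M[C]_nct => complex.Re (X j j)) Dc.
  rewrite -{2}[Hcc *m Fc]ctrK mulmx_ctr_diag rdiagE eqxx mulr1n /= => <-.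
  rewrite le_eqVlt; apply/orP; left; apply/eqP.
  apply: eq_bigr => i _; rewrite ctrE /nsq.
  by case: ((Hcc *m Fc) i j) => ? ? /=; rewrite sqrrN.
pose dp j := 1 + s * dp0 j; pose dc j := 1 + s * dc0 j.
have dp1 j : 1 <= dp j by rewrite lerDl mulr_ge0// ltW.
have dc1 j : 1 <= dc j by rewrite lerDl mulr_ge0// ltW.
have dpn j : 0 < dp j by apply: lt_le_trans (dp1 j).
have dcn j : 0 < dc j by apply: lt_le_trans (dc1 j).
pose X := ctr T0 *m M; pose Tc := Hcc *m Fc.
(* The minimum mean square error estimators, the primary one for the slightly pessimistic
   disturbance covariance s N in place of 1 + s B. Both have errors 1/d in the diagonalised
   coordinates. *)
pose Kp := rdiag (fun j => (dp j)^-1) *m X.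
pose Kc := rdiag (fun j => (dc j)^-1) *m (sq%:C *: ctr Tc).
exists (Mode (s%:C *: Fu) (s%:C *: Fd) (sq%:C *: Fc) Kp Kc dp dc) => g.
have gb0 : 0 <= gain_bound Pp Pc.
  by rewrite gb; apply: addr_ge0; apply: mulr_ge0 => //; exact: addr_ge0.
have g0 : 0 <= 1 + g.
  have h : 0 <= s * gain_bound Pp Pc := mulr_ge0 (ltW s0) gb0.
  by apply: addr_ge0 => //; apply: divr_ge0; lra.
have KpE j i : Kp j i = ((dp j)^-1)%:C * X j i by rewrite mul_rdiag_mx.
split => /=.
- split; first split => //=.
  + have E1 : 1%:M - Kp *m (Hpp *m (s%:C *: Fu) + Hcp *m (s%:C *: Fd)) =
        rdiag (fun j => (dp j)^-1).
      rewrite -!scalemxAr -scalerDr -T0E -scalemxAr /Kp -mulmxA /X Dp.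
      apply/matrixP => i j; rewrite mx_subE mx_scaleE mul_rdiag_mx !rdiagE mxE.
      case: eqVneq => [_|_]; rewrite ?mulr0n ?mulr0 ?subr0// !mulr1n -!rmorphM -rmorphB /=.
      by congr (_%:C); rewrite /dp; field; rewrite -/(dp i) gt_eqF.
    rewrite E1.
    have H2 j : \sum_i nsq ((Kp *m (Hcp *m (sq%:C *: Fc))) j i) + \sum_i nsq (Kp j i) <=
        s * dp0 j / (dp j) ^+ 2.
      have -> : \sum_i nsq ((Kp *m (Hcp *m (sq%:C *: Fc))) j i) =
          s / (dp j) ^+ 2 * \sum_i nsq ((X *m T) j i).
        rewrite mulr_sumr; apply: eq_bigr => i _.
        rewrite -!scalemxAr mx_scaleE -/T /Kp -mulmxA mul_rdiag_mx !nsqM !nsq_real sq2.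
        by rewrite mulrA exprVn.
      have -> : \sum_i nsq (Kp j i) = (dp j) ^- 2 * \sum_i nsq (X j i).
        by rewrite mulr_sumr; apply: eq_bigr => i _; rewrite KpE nsqM nsq_real exprVn.
      have e : \sum_i nsq (X j i) + \sum_i nsq ((X *m T) j i) = dp0 j.
        have cX : ctr X = M *m T0 by rewrite /X ctrM ctrK Mh.
        have XNX : X *m N *m ctr X = rdiag dp0.
          by rewrite cX /X -[ctr T0 *m M *m N]mulmxA MN mulmx1 mulmxA Dp.
        have := congr1 (fun Z : 'M[C]_(npt + nct) => complex.Re (Z j j)) XNX.
        rewrite mulmxDr mulmx1 mulmxDl.
        have -> : X *m B *m ctr X = (X *m T) *m ctr (X *m T).
          by rewrite ctrM /B !mulmxA.
        by rewrite mx_addE !mulmx_ctr_diag rdiagE eqxx mulr1n /=.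
      have X0 : 0 <= \sum_i nsq (X j i) by apply: sumr_ge0 => i _; exact: nsq_ge0.
      have i0 : 0 <= (dp j) ^- 2 by rewrite invr_ge0 sqr_ge0.
      have := ler_peMl (mulr_ge0 i0 X0) s1.
      by rewrite -e; lra.
    apply: (@le_trans _ _ (\sum_(j < npt + nct) (1 : R))); last first.
      by rewrite sum_cst card_ord mulr1.
    apply: ler_sum => j _; rewrite -addrA.
    have -> : \sum_i nsq (rdiag (fun j => (dp j)^-1) j i) = (dp j) ^- 2.
      rewrite (bigD1 j)//= rdiagE eqxx mulr1n nsq_real exprVn big1 ?addr0// => i /negbTE ij.
      by rewrite rdiagE eq_sym ij mulr0n /nsq /= expr0n addr0.
    apply: le_trans (ler_wpM2l (ltW (dpn j)) (lerD (lexx _) (H2 j))) _.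
    rewrite le_eqVlt; apply/orP; left; apply/eqP.
    by rewrite /dp; field; rewrite -/(dp j) gt_eqF.
  + have E1 : 1%:M - Kc *m (Hcc *m (sq%:C *: Fc)) = rdiag (fun j => (dc j)^-1).
      rewrite -scalemxAr -/Tc -scalemxAr /Kc -mulmxA -scalemxAl Dc.
      apply/matrixP => i j; rewrite mx_subE mx_scaleE mul_rdiag_mx mx_scaleE !rdiagE mxE.
      case: eqVneq => [_|_]; rewrite ?mulr0n ?mulr0 ?subr0// !mulr1n -!rmorphM -rmorphB /=.
      congr (_%:C); have -> : sq * ((dc i)^-1 * (sq * dc0 i)) = s * dc0 i / dc i.
        by rewrite -sq2; ring.
      by rewrite /dc; field; rewrite -/(dc i) gt_eqF.
    rewrite E1.
    have H2 j : \sum_i nsq (Kc j i) = s * dc0 j / (dc j) ^+ 2.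
      have e : \sum_i nsq (ctr Tc j i) = dc0 j.
        have := congr1 (fun Z : 'M[C]_nct => complex.Re (Z j j)) Dc.
        by rewrite -/Tc -{2}[Tc]ctrK mulmx_ctr_diag rdiagE eqxx mulr1n /=.
      rewrite -e mulr_sumr mulr_suml; apply: eq_bigr => i _.
      by rewrite /Kc mul_rdiag_mx mx_scaleE !nsqM !nsq_real sq2 exprVn mulrC.
    apply: (@le_trans _ _ (\sum_(j < nct) (1 : R))); last first.
      by rewrite sum_cst card_ord mulr1.
    apply: ler_sum => j _; rewrite H2.
    have -> : \sum_i nsq (rdiag (fun j => (dc j)^-1) j i) = (dc j) ^- 2.
      rewrite (bigD1 j)//= rdiagE eqxx mulr1n nsq_real exprVn big1 ?addr0// => i /negbTE ij.
      by rewrite rdiagE eq_sym ij mulr0n /nsq /= expr0n addr0.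
    rewrite le_eqVlt; apply/orP; left; apply/eqP.
    by rewrite /dc; field; rewrite -/(dc j) gt_eqF.
  + rewrite !frobZ sq2; split.
      by rewrite ler_pM2l ?exprn_gt0.
    apply: (@le_trans _ _ (s ^+ 2 * (frob Fd + frob Fc))); last first.
      by rewrite ler_pM2l ?exprn_gt0.
    rewrite mulrDr lerD2l ler_wpM2r//; nra.
- have hl : 0 < ln (2 : R) by rewrite ln_gt0// ltr1n.
  have detA : \det (1%:M + G *m Snet *m ctr G + B) = (x0 * \prod_j (1 + dp0 j))%:C.
    have -> : 1%:M + G *m Snet *m ctr G + B = N *m (1%:M + (M *m T0) *m ctr T0).
      rewrite mulmxDr mulmx1 !mulmxA NM mul1mx /N addrAC; congr (_ + _).
      by rewrite SE /T0 ctrM !mulmxA.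
    rewrite det_mulmx detN det_1mul_comm mulmxA Dp rmorphM; congr (_ * _).
    exact: det_1rdiag.
  have pr0 : 0 < \prod_j (1 + dp0 j) by apply: prodr_gt0 => j _; rewrite ltr_wpDr.
  have r1le : r.1 * ln 2 <= \sum_j ln (1 + dp0 j).
    move: hr1; rewrite BE /logdet /log2 detA -/N detN /= lnM ?posrE//.
    rewrite -mulrBl addrAC subrr add0r ler_pdivlMr// => h; apply: le_trans h _.
    by rewrite ln_prod// => j; rewrite ltr_wpDr.
  apply: le_trans (ler_wpM2l g0 r1le) _.
  by rewrite mulr_sumr; apply: ler_sum => j _; exact: ln1D_boost.
- have hl : 0 < ln (2 : R) by rewrite ln_gt0// ltr1n.
  have detA : \det (1%:M + Hcc *m Scc *m ctr Hcc) = (\prod_j (1 + dc0 j))%:C.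
    have -> : Hcc *m Scc *m ctr Hcc = Tc *m ctr Tc by rewrite SccE /Tc ctrM !mulmxA.
    by rewrite det_1mul_comm Dc det_1rdiag.
  have r2le : r.2 * ln 2 <= \sum_j ln (1 + dc0 j).
    move: hr2; rewrite /logdet /log2 detA /= ler_pdivlMr// => h; apply: le_trans h _.
    by rewrite ln_prod// => j; rewrite ltr_wpDr.
  apply: le_trans (ler_wpM2l g0 r2le) _.
  by rewrite mulr_sumr; apply: ler_sum => j _; exact: ln1D_boost.
- by split.
Qed.
End Modes.

(** * Threshold decoding *)

(** Stronger than [meas_decoder] because error events involve a translated noise, and [gauss_tuple]
    is known to be a probability on measurable sets only. *)
Definition shift_measurable (R : realType) (k n M : nat) (D : 'M[R[i]]_(k, n) -> 'I_M) : Prop :=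
  forall (Q : pred 'I_M) cl, measurable [set z | Q (D (cl + noise_mx z))].

Lemma shift_measurable_decoder (R : realType) (k n M : nat) (D : 'M[R[i]]_(k, n) -> 'I_M) :
  shift_measurable D -> meas_decoder D.
Proof.
move=> mD m0; have := mD (pred1 m0) 0.
congr measurable; apply/seteqP; split=> z /=; rewrite add0r.
  by move/eqP.
by move=> ->.
Qed.

Section ThresholdDecoder.
Variable R : realType.
Local Notation C := R[i].

Lemma measurable_bool_fun d (T : measurableType d) (I : finType) (P : I -> T -> bool)
    (Phi : {ffun I -> bool} -> bool) :
  (forall i, measurable [set x | P i x]) -> measurable [set x | Phi [ffun i => P i x]].
Proof.
move=> mP.
have -> : [set x | Phi [ffun i => P i x]] =
    \bigcup_(f in [set f : {ffun I -> bool} | Phi f]) \bigcap_(i in [set: I]) [set x | P i x = f i].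
  apply/seteqP; split=> x /=.
    by move=> h; exists [ffun i => P i x] => //= i _; rewrite /= ffunE.
  move=> [f /= Pf h]; rewrite (_ : [ffun i => P i x] = f)//.
  by apply/ffunP => i; rewrite ffunE; exact: h.
apply: fin_bigcup_measurable; first exact: finite_finset.
move=> f _; apply: fin_bigcap_measurable; first exact: finite_finset.
move=> i _; case: (f i).
  exact: mP.
have -> : [set x | P i x = false] = ~` [set x | P i x].
  by apply/seteqP; split=> x /=; [move=> ->|move=> /negP/negbTE].
exact: measurableC.
Qed.

(** Integrates the number of events that occur. It turns a count of the grid words near each
    received word into a bound on the total probability of confusion. *)
Lemma sum_measure_le d (T : measurableType d) (mu : probability T R) (I : finType)
    (A : I -> set T) (N : R) : (forall i, measurable (A i)) ->
  (forall x, \sum_i (\1_(A i) x : R) <= N) -> \sum_i fine (mu (A i)) <= N.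
Proof.
move=> mA h; rewrite -lee_fin -sumEFin.
have -> : (\sum_i (fine (mu (A i)))%:E = \sum_i \int[mu]_x (\1_(A i) x)%:E)%E.
  apply: eq_bigr => i _; rewrite integral_indic// setIT fineK//.
  exact: fin_num_measure.
rewrite -ge0_integral_sum//; last first.
  by move=> i; apply/measurable_EFinP; exact: measurable_indic.
have -> : N%:E = (\int[mu]_x N%:E)%E.
  by rewrite integral_cst//= probability_setT mule1.
have N0 : 0 <= N.
  have [x _] : exists x : T, True by exists point.
  by apply: le_trans (h x); apply: sumr_ge0.
apply: ge0_le_integral => //.
- by move=> x _; apply: sume_ge0 => i _; rewrite lee_fin.
- by apply: emeasurable_sum => i; apply/measurable_EFinP; exact: measurable_indic.
- by move=> x _; rewrite sumEFin lee_fin.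
Qed.

Variables (m k n : nat) (I : finType) (om : 'I_n -> 'I_m -> R).
Variables (L : 'I_n -> 'M[C]_(m, k)) (x : I -> 'I_n -> 'I_m -> C) (th : R).

Definition dec_metric (i : I) (y : 'M[C]_(k, n)) : R :=
  \sum_t \sum_j om t j * nsq (x i t j - (L t *m col t y) j 0).

Definition near_word i y : bool := dec_metric i y <= th.

Lemma dec_metricE i (cl : 'M[C]_(k, n)) z :
  dec_metric i (cl + noise_mx z) =
  \sum_t \sum_j om t j * nsq ((x i t j - (L t *m col t cl) j 0)
    + (- L t *m col t (noise_mx z)) j 0).
Proof.
apply: eq_bigr => t _; apply: eq_bigr => j _; congr (_ * nsq _).
have oppE (A : 'cV[C]_m) : (- A) j 0 = - A j 0 by rewrite mxE.
by rewrite linearD /= mulmxDr mulNmx mx_addE oppE opprD addrA.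
Qed.

Lemma measurable_near_word i (cl : 'M[C]_(k, n)) :
  measurable [set z | near_word i (cl + noise_mx z)].
Proof.
rewrite -[X in measurable X]setTI; apply: measurable_fun_le => //.
under eq_fun do rewrite dec_metricE; exact: measurable_noise_metric.
Qed.

Variables (M : nat) (lab : I -> 'I_M) (dflt : 'I_M).

Definition thr_decoder (y : 'M[C]_(k, n)) : 'I_M :=
  if [pick i | near_word i y] is Some i then lab i else dflt.

Lemma measurable_thr_decoder : shift_measurable thr_decoder.
Proof.
move=> Q cl.
pose Phi (f : {ffun I -> bool}) := Q (if [pick i | f i] is Some i then lab i else dflt).
have E z : [pick i | near_word i (cl + noise_mx z)] =
    [pick i | [ffun i => near_word i (cl + noise_mx z)] i].
  by apply: eq_pick => i /=; rewrite ffunE.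
have -> : [set z | Q (thr_decoder (cl + noise_mx z))] =
    [set z | Phi [ffun i => near_word i (cl + noise_mx z)]].
  by apply/seteqP; split=> z /=; rewrite /Phi /thr_decoder E.
apply: measurable_bool_fun => i; exact: measurable_near_word.
Qed.

Local Notation mu := (gauss_prob R (k * n + k * n)).

(** An error forces the sent word to be far or some word with another label to be near; which near
    word is picked does not matter, and words sharing the label are harmless. *)
Lemma thr_decoder_err i0 (cl : 'M[C]_(k, n)) (e : R) :
  (mu [set z | ~~ near_word i0 (cl + noise_mx z)] <= e%:E)%E ->
  (gauss_tuple [set z | thr_decoder (cl + noise_mx z) != lab i0] <=
   (e + \sum_(i | lab i != lab i0) fine (mu [set z | near_word i (cl + noise_mx z)]))%:E)%E.
Proof.
move=> he.
pose E := [set z | thr_decoder (cl + noise_mx z) != lab i0].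
have mE : measurable E by exact: (measurable_thr_decoder (predC1 (lab i0)) cl).
pose A0 := [set z | ~~ near_word i0 (cl + noise_mx z)].
pose A i := if lab i != lab i0 then [set z | near_word i (cl + noise_mx z)] else set0.
have mA0 : measurable A0.
  have -> : A0 = ~` [set z | near_word i0 (cl + noise_mx z)].
    by apply/seteqP; split=> z /= /negP.
  apply: measurableC; exact: measurable_near_word.
have mA i : measurable (A i) by rewrite /A; case: ifP => // _; exact: measurable_near_word.
rewrite gauss_tupleE//.
apply: (@le_trans _ _ (mu (A0 `|` \big[setU/set0]_i A i))).
  apply: le_measure; rewrite ?inE//.
    by apply: measurableU => //; apply: bigsetU_measurable.
  move=> z; rewrite /E /= /thr_decoder; case: pickP => [i Ti|no] h.
    right; rewrite -bigcup_seq; exists i; first exact: mem_index_enum.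
    by rewrite /A h.
  by left; rewrite /A0 /= no.
have sub (s : seq I) : (mu (\big[setU/set0]_(i <- s) A i) <= \sum_(i <- s) mu (A i))%E.
  elim: s => [|i s IH]; first by rewrite !big_nil measure0.
  rewrite !big_cons; apply: le_trans (measureU2 _ _ _) _ => //.
    exact: bigsetU_measurable.
  exact: leeD2l.
apply: le_trans (measureU2 _ _ _) _ => //; first exact: bigsetU_measurable.
rewrite EFinD; apply: leeD => //; apply: le_trans (sub _) _.
rewrite -sumEFin [leRHS]big_mkcond; apply: lee_sum => i _; rewrite /A.
case: ifP => _; last by rewrite measure0.
by rewrite fineK//; apply: fin_num_measure; exact: measurable_near_word.
Qed.
End ThresholdDecoder.

(** * Typical words *)

Section StateTails.
Variable R : realType.
Local Notation C := R[i].

Lemma term_le_sum (S : finType) (F : S -> R) s : (forall s, 0 <= F s) -> F s <= \sum_s F s.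
Proof. by move=> F0; rewrite (bigD1 s)//= lerDl sumr_ge0. Qed.

Lemma sum_pred_le (S : finType) (P Q : pred S) (F : S -> R) :
  (forall s, P s -> Q s) -> (forall s, 0 <= F s) -> \sum_(s | P s) F s <= \sum_(s | Q s) F s.
Proof.
move=> PQ F0; rewrite [leLHS]big_mkcond [leRHS]big_mkcond; apply: ler_sum => s _.
by case: ifP => [/PQ ->//|_]; case: ifP.
Qed.

Lemma ex_inv_le (c e : R) : 0 <= c -> 0 < e ->
  exists N0, forall n, (N0 <= n)%N -> (0 < n)%N /\ c / n%:R <= e.
Proof.
move=> c0 e0; exists (Num.truncn (c / e)).+1 => n hn.
have n0 : (0 < n)%N by apply: leq_trans hn.
split=> //; rewrite ler_pdivrMr ?ltr0n// mulrC -ler_pdivrMr//.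
apply: le_trans (ltW (truncnS_gt _)) _; by rewrite ler_nat.
Qed.

Section Letters.
Variables (M : nat) (p val : 'I_M -> R) (v : R).
Hypothesis p0 : forall x, 0 <= p x.
Hypothesis p1 : \sum_x p x = 1.
Hypothesis val1 : \sum_x p x * val x = 0.
Hypothesis val2 : \sum_x p x * val x ^+ 2 = v.

(** There are finitely many states and letters, so one constant bounds all summands and N0 does not
    depend on the state sequence. This gives the uniformity in the time-sharing pattern and in the
    interfering word. *)
Lemma state_tail2 (S J : finType) k (om : S -> J -> R) (h : S -> J -> C)
    (L : S -> J -> 'I_k -> C) (e : R) : (forall s j, 0 <= om s j) -> 0 < e ->
  exists N0, forall n, (N0 <= n)%N -> forall sg : 'I_n -> S,
  \sum_(g : {ffun 'I_n -> {ffun 'I_k * bool -> 'I_M}} | n%:R * e <=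
     `|\sum_t \sum_j om (sg t) j * nsq (h (sg t) j + \sum_a L (sg t) j a * cletter val (g t) a)
       - \sum_t \sum_j om (sg t) j * (nsq (h (sg t) j) + 2 * v * \sum_a nsq (L (sg t) j a))|)
    prodlaw (prodlaw p) g <= 8^-1.
Proof.
move=> om0 e0.
pose F s (x : {ffun 'I_k * bool -> 'I_M}) :=
  \sum_j om s j * nsq (h s j + \sum_a L s j a * cletter val x a).
have F0 s x : 0 <= F s x by apply: sumr_ge0 => j _; rewrite mulr_ge0 ?nsq_ge0.
pose c := \sum_s \sum_x F s x.
have Fc s x : F s x <= c.
  apply: le_trans (term_le_sum s _); first exact: (term_le_sum x (F0 s)).
  by move=> s'; apply: sumr_ge0.
have c0 : 0 <= c by apply: sumr_ge0 => s _; apply: sumr_ge0.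
have ce0 : 0 <= c ^+ 2 / e ^+ 2 by rewrite divr_ge0 ?sqr_ge0.
have e8 : (0 : R) < 8^-1 by rewrite invr_gt0.
have [N0 HN] := ex_inv_le ce0 e8.
exists N0 => n hn sg; have [n0 hc] := HN n hn.
have := @sequence_tail R M p val v p0 p1 val1 val2 n J k (fun t => om (sg t))
  (fun t => h (sg t)) (fun t => L (sg t)) c e n0 e0.
move=> /(_ (fun t x => introT andP (conj (F0 (sg t) x) (Fc (sg t) x)))) /le_trans; apply.
apply: le_trans hc; rewrite le_eqVlt; apply/orP; left; apply/eqP; field.
by rewrite pnatr_eq0 -lt0n n0 gt_eqF.
Qed.

(* The case [e = 0] covers a vanishing power budget, where the letters do not enter. *)
Lemma state_tail (S J : finType) k (om : S -> J -> R) (h : S -> J -> C)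
    (L : S -> J -> 'I_k -> C) (e : R) : (forall s j, 0 <= om s j) ->
  0 < e \/ e = 0 /\ (forall s j a, L s j a = 0) ->
  exists N0, forall n, (N0 <= n)%N -> forall sg : 'I_n -> S,
  \sum_(g : {ffun 'I_n -> {ffun 'I_k * bool -> 'I_M}} |
     ~~ (\sum_t \sum_j om (sg t) j * nsq (h (sg t) j + \sum_a L (sg t) j a * cletter val (g t) a)
       <= \sum_t \sum_j om (sg t) j * (nsq (h (sg t) j) + 2 * v * \sum_a nsq (L (sg t) j a))
         + n%:R * e))
    prodlaw (prodlaw p) g <= 8^-1.
Proof.
move=> om0 [e0|[-> L0]].
  have [N0 HN] := state_tail2 h L om0 e0; exists N0 => n hn sg.
  apply: le_trans (HN n hn sg); apply: sum_pred_le => g.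
    by rewrite -ltNge => /ltW hg; apply: le_trans (ler_norm _); rewrite lerBrDl.
  by apply: prodlaw_ge0 => ?; exact: prodlaw_ge0.
exists 0%N => n _ sg; rewrite big_pred0 ?invr_ge0// => g.
apply/negbTE; rewrite negbK mulr0 addr0; apply: ler_sum => t _; apply: ler_sum => j _.
rewrite ler_wpM2l// [X in nsq (_ + X)]big1 ?addr0 => [|a _]; last by rewrite L0 mul0r.
rewrite lerDl big1 ?mulr0// => a _; by rewrite L0 /nsq /= expr0n addr0.
Qed.

(** A lower bound on the energy makes each typical word improbable, so that there must be many of
    them. *)
Lemma energy_tail k (e : R) : 0 < e -> exists N0, forall n, (N0 <= n)%N ->
  \sum_(g : {ffun 'I_n -> {ffun 'I_k * bool -> 'I_M}} |
     ~~ (n%:R * (2 * v * k%:R) - n%:R * e <= \sum_t \sum_j nsq (cletter val (g t) j)))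
    prodlaw (prodlaw p) g <= 8^-1.
Proof.
move=> e0; have [|N0 HN] := @state_tail2 unit 'I_k k (fun _ _ => 1) (fun _ _ => 0)
  (fun _ j a => (j == a)%:R) e _ e0 => //.
exists N0 => n hn; have := HN n hn (fun=> tt); apply: le_trans.
have E1 (g : {ffun 'I_n -> {ffun 'I_k * bool -> 'I_M}}) :
    \sum_t \sum_j 1 * nsq (0 + \sum_a (j == a)%:R * cletter val (g t) a) =
    \sum_t \sum_j nsq (cletter val (g t) j).
  apply: eq_bigr => t _; apply: eq_bigr => j _; rewrite mul1r add0r (bigD1 j)//= eqxx mul1r.
  by rewrite big1 ?addr0// => a /negbTE; rewrite eq_sym => ->; rewrite mul0r.
have E2 : \sum_(t < n) \sum_(j < k) 1 * (nsq (0 : C) + 2 * v * \sum_(a < k) nsq ((j == a)%:R : C)) =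
    n%:R * (2 * v * k%:R).
  rewrite (eq_bigr (fun=> 2 * v * k%:R)) ?sum_cst ?card_ord// => t _.
  rewrite (eq_bigr (fun=> 2 * v)) ?sum_cst ?card_ord ?(mulrC k%:R)// => j _.
  rewrite mul1r (bigD1 j)//= eqxx big1 => [|a /negbTE]; last first.
    by rewrite eq_sym => ->; rewrite /nsq /= expr0n addr0.
  by rewrite /nsq /= !expr0n expr1n !addr0 add0r mulr1.
rewrite E2; apply: sum_pred_le => g.
  rewrite E1 -ltNge => /ltW; rewrite ler_normr opprB => hg; apply/orP; right; lra.
by apply: prodlaw_ge0 => ?; exact: prodlaw_ge0.
Qed.
End Letters.

Lemma nsqN (x : C) : nsq (- x) = nsq x.
Proof. by case: x => a b; rewrite /nsq /= !sqrrN. Qed.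

Lemma state_noise_tail (S : finType) m k (om : S -> 'I_m -> R) (h : S -> 'I_m -> C)
    (L : S -> 'M[C]_(m, k)) (e eps : R) : (forall s j, 0 <= om s j) -> 0 < e -> 0 < eps ->
  exists N0, forall n, (N0 <= n)%N -> forall sg : 'I_n -> S,
  (gauss_prob R (k * n + k * n) [set z |
    \sum_t \sum_j om (sg t) j * (nsq (h (sg t) j) + \sum_a nsq (L (sg t) j a)) + n%:R * e <=
    \sum_t \sum_j om (sg t) j * nsq (h (sg t) j + (L (sg t) *m col t (noise_mx z)) j 0)]%R
  <= eps%:E)%E.
Proof.
move=> om0 e0 eps0.
have Hge0 s j : 0 <= nsq (h s j) by exact: nsq_ge0.
have omS s j : om s j <= \sum_s \sum_j om s j.
  apply: le_trans (term_le_sum s _); first exact: (term_le_sum j (om0 s)).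
  by move=> s'; apply: sumr_ge0.
have hS s j : nsq (h s j) <= \sum_s \sum_j nsq (h s j).
  apply: le_trans (term_le_sum s _); first exact: (term_le_sum j (Hge0 s)).
  by move=> s'; apply: sumr_ge0.
have LS s j a : nsq (L s j a) <= \sum_s frob (L s).
  apply: le_trans (term_le_sum s _); last by move=> s'; exact: frob_ge0.
  apply: le_trans (term_le_sum j _); last by move=> j'; apply: sumr_ge0 => ? _; exact: nsq_ge0.
  by apply: (@term_le_sum _ (fun a => nsq (L s j a))) => ?; exact: nsq_ge0.
have S1 : 0 <= \sum_s \sum_j om s j by apply: sumr_ge0 => s _; apply: sumr_ge0.
have S2 : 0 <= \sum_s \sum_j nsq (h s j) by apply: sumr_ge0 => s _; apply: sumr_ge0.
have S3 : 0 <= \sum_s frob (L s) by apply: sumr_ge0 => s _; exact: frob_ge0.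
have [Cst C0 HC] := @noise_tail R m k _ _ _ S1 S2 S3.
have ce0 : 0 <= Cst / e ^+ 2 by rewrite divr_ge0 ?sqr_ge0.
have [N0 HN] := ex_inv_le ce0 eps0.
exists N0 => n hn sg; have [n0 hc] := HN n hn.
have ne0 : 0 < n%:R * e by rewrite mulr_gt0 ?ltr0n.
apply: le_trans (HC n (fun t => om (sg t)) (fun t => h (sg t)) (fun t => L (sg t)) _ _ _ _ ne0) _.
- by move=> t j; rewrite om0 omS.
- by move=> t j; exact: hS.
- by move=> t j a; exact: LS.
rewrite lee_fin; apply: le_trans hc; rewrite le_eqVlt; apply/orP; left; apply/eqP; field.
by rewrite pnatr_eq0 -lt0n n0 gt_eqF.
Qed.

Lemma ex_quantizer (S : finType) (x : S -> R) (eta : R) : 0 < eta ->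
  exists (B : nat) (q : S -> nat), forall s,
  (q s <= 2 * B)%N /\ `|eta * ((q s)%:R - B%:R) - x s| <= eta.
Proof.
move=> eta0; pose X := \sum_s `|x s|.
have xX s : `|x s| <= X by apply: (@term_le_sum _ (fun s => `|x s|)).
pose B := (Num.truncn (X / eta)).+1.
have XB : X < eta * B%:R by rewrite mulrC -ltr_pdivrMr//; exact: truncnS_gt.
exists B, (fun s => Num.truncn ((x s + eta * B%:R) / eta)) => s.
have := xX s; rewrite ler_norml => /andP[x1 x2].
have y0 : 0 <= (x s + eta * B%:R) / eta by rewrite divr_ge0 ?(ltW eta0)//; lra.
have /andP[q1 q2] := truncn_itv y0.
move: q1 q2; set q := Num.truncn _; rewrite ler_pdivlMr// ltr_pdivrMr// -natr1 => q1 q2.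
split; last by rewrite ler_norml; apply/andP; split; nra.
rewrite -(@ler_nat R) natrM -(ler_pM2r eta0); nra.
Qed.

(** Four exceptional sets of probability at most 1/8 leave probability at least 1/2, carried by
    words of small individual probability. *)
Lemma typ_count n k M (val : 'I_M -> R) (Z s : R)
    (P1 P2 P3 : pred {ffun 'I_n -> {ffun 'I_k * bool -> 'I_M}}) :
  let P := prodlaw (prodlaw (fun i => expR (- val i ^+ 2) / Z)) in
  0 < Z -> \sum_i expR (- val i ^+ 2) / Z = 1 ->
  \sum_(g : {ffun 'I_n -> {ffun 'I_k * bool -> 'I_M}} |
    ~~ (s <= \sum_t \sum_j nsq (cletter val (g t) j))) P g <= 8^-1 ->
  \sum_(g | ~~ P1 g) P g <= 8^-1 -> \sum_(g | ~~ P2 g) P g <= 8^-1 ->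
  \sum_(g | ~~ P3 g) P g <= 8^-1 ->
  2^-1 * expR (s + n%:R * (k%:R * (2 * ln Z))) <= #|[pred g | [&& P1 g, P2 g & P3 g]]|%:R.
Proof.
move=> P Z0 p1 h0 h1 h2 h3.
pose P0 (g : {ffun 'I_n -> {ffun 'I_k * bool -> 'I_M}}) :=
  s <= \sum_t \sum_j nsq (cletter val (g t) j).
have Pge0 g : 0 <= P g.
  by apply: prodlaw_ge0 => x; apply: prodlaw_ge0 => i; rewrite divr_ge0 ?expR_ge0// ltW.
have P1E : \sum_g P g = 1 by do 2 apply: sum_prodlaw.
pose T := [pred g | [&& P0 g, P1 g, P2 g & P3 g]].
have hT : 2^-1 <= \sum_(g | T g) P g.
  have hC : \sum_(g | ~~ T g) P g <= \sum_(g | ~~ P0 g) P g + \sum_(g | ~~ P1 g) P g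
      + \sum_(g | ~~ P2 g) P g + \sum_(g | ~~ P3 g) P g.
    rewrite [leLHS]big_mkcond [X in _ <= X + _ + _ + _]big_mkcond
      [X in _ <= _ + X + _ + _]big_mkcond [X in _ <= _ + _ + X + _]big_mkcond
      [X in _ <= _ + _ + _ + X]big_mkcond /= -!big_split; apply: ler_sum => g _ /=.
    have := Pge0 g; case: (P0 g); case: (P1 g); case: (P2 g); case: (P3 g) => /=; lra.
  have E : \sum_g P g = \sum_(g | T g) P g + \sum_(g | ~~ T g) P g by rewrite (bigID T).
  by rewrite P1E in E; rewrite /P0 in hC; lra.
have := card_ge_law hT (fun g Tg => prodlaw_gauss_le Z0 (proj1 (andP Tg))).
have sub : #|T|%:R <= #|[pred g | [&& P1 g, P2 g & P3 g]]|%:R :> R.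
  rewrite ler_nat; apply: subset_leq_card; apply/fintype.subsetP => g.
  by rewrite !inE => /andP[].
rewrite -opprD expRN ler_pdivlMr ?expR_gt0// => h; exact: le_trans h sub.
Qed.
End StateTails.

(** * Exponents of the random-coding bound *)

Section ExponentBounds.
Variable R : realType.
Local Notation C := R[i].

Lemma expR_decay (d eps : R) : 0 < d -> 0 < eps -> exists N0, forall n, (N0 <= n)%N ->
  (n.+1)%:R * expR (- (n%:R * d)) <= eps.
Proof.
move=> d0 e0.
have c0 : 0 <= 8 / d ^+ 2 by rewrite divr_ge0 ?sqr_ge0.
have [N0 HN] := ex_inv_le c0 e0; exists N0 => n /HN[n0]; apply: le_trans.
have x0 : 0 < n%:R * d / 2 by rewrite divr_gt0// mulr_gt0// ltr0n.
have n1 : (1 : R) <= n%:R by rewrite ler1n.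
set x := n%:R * d / 2 in x0.
have h1 : expR (- x) <= x^-1.
  by rewrite expRN lef_pV2 ?posrE ?expR_gt0//; apply: le_trans (expR_ge1Dx x); lra.
have -> : - (n%:R * d) = - x - x by rewrite /x; field.
rewrite expRD.
have h2 : expR (- x) * expR (- x) <= x^-1 * x^-1 by apply: ler_pM => //; exact: expR_ge0.
have h3 : n.+1%:R <= 2 * n%:R :> R by rewrite -natr1; lra.
have h4 : 0 <= expR (- x) * expR (- x) by rewrite mulr_ge0 ?expR_ge0.
apply: le_trans (ler_pM (ler0n _ _) h4 h3 h2) _.
rewrite le_eqVlt; apply/orP; left; apply/eqP; rewrite /x; field.
by rewrite !gt_eqF// ltr0n.
Qed.

Lemma count_ratio n k (d1 eta Z v : R) (d : 'I_n -> 'I_k -> R) : 0 < eta -> 0 < Z ->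
  expR (- d1) * Num.sqrt pi <= eta * Z -> 2^-1 - d1 <= v ->
  expR (n%:R * (k%:R + 2 * k%:R * d1 + 3 * d1)
      + \sum_t \sum_j (2 * d1 + ln pi - ln (d t j) - 2 * ln eta)) <=
  2 * expR (n%:R * (d1 * (8 * k%:R + 4)) - \sum_t \sum_j ln (d t j)) *
  (2^-1 * expR (n%:R * (2 * v * k%:R) - n%:R * d1 + n%:R * (k%:R * (2 * ln Z)))).
Proof.
move=> eta0 Z0 hZ hv.
have sp0 : 0 < Num.sqrt pi :> R by rewrite sqrtr_gt0 pi_gt0.
have lnpi : ln (Num.sqrt pi) = ln pi / 2 :> R.
  apply: (mulIf (_ : (2 : R) != 0)); first by rewrite pnatr_eq0.
  by rewrite divfK ?pnatr_eq0// mulr_natr -lnXn// sqr_sqrtr// pi_ge0.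
have hlnZ : ln pi / 2 - d1 - ln eta <= ln Z.
  have : ln (expR (- d1) * Num.sqrt pi) <= ln (eta * Z).
    by rewrite ler_ln ?posrE// ?mulr_gt0 ?expR_gt0.
  by rewrite !lnM ?posrE ?expR_gt0// expRK lnpi; lra.
rewrite mulrACA divff ?pnatr_eq0// mul1r -expRD ler_expR.
have -> : \sum_t \sum_j (2 * d1 + ln pi - ln (d t j) - 2 * ln eta) =
    n%:R * (k%:R * (2 * d1 + ln pi - 2 * ln eta)) - \sum_t \sum_j ln (d t j).
  have -> : n%:R * (k%:R * (2 * d1 + ln pi - 2 * ln eta)) =
      \sum_(t < n) \sum_(j < k) (2 * d1 + ln pi - 2 * ln eta) by rewrite !sum_cst !card_ord.
  rewrite -sumrB; apply: eq_bigr => t _; rewrite -sumrB; apply: eq_bigr => j _; ring.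
set S := \sum_t _.
have nk : 0 <= n%:R * k%:R :> R by rewrite mulr_ge0.
have : 0 <= n%:R * k%:R * (2 * (v - (2^-1 - d1)) + 2 * (ln Z - (ln pi / 2 - d1 - ln eta))).
  by rewrite mulr_ge0//; lra.
lra.
Qed.

(** The margin del pays for the O(d1) losses and leaves del/2 as decay. A single message has no
    competitor, whatever S is. *)
Lemma rate_cost n k M (del d1 S : R) : (0 < M)%N -> (M = 1)%N \/ ln M%:R <= S - n%:R * del ->
  d1 * (8 * k%:R + 4) <= del / 2 ->
  M.-1%:R * (2 * expR (n%:R * (d1 * (8 * k%:R + 4)) - S)) <= 2 * expR (- (n%:R * (del / 2))).
Proof.
move=> M0 [->|hM] hd /=; first by rewrite mul0r mulr_ge0 ?expR_ge0.
rewrite mulrCA ler_pM2l//; apply: (@le_trans _ _ (M%:R * expR (n%:R * (d1 * (8 * k%:R + 4)) - S))).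
  by rewrite ler_wpM2r ?expR_ge0// ler_nat leq_pred.
rewrite -[M%:R]lnK ?posrE ?ltr0n// -expRD ler_expR.
have : 0 <= n%:R * (del / 2 - d1 * (8 * k%:R + 4)) by rewrite mulr_ge0// subr_ge0.
lra.
Qed.

(** About n U/G independent trials, each succeeding with probability G/U, all fail with probability
    at most exp(-n). *)
Lemma covering_le n (U : nat) (G : R) : 0 < G -> G <= U%:R -> (0 < n)%N ->
  (1 - G / U%:R) ^+ (Num.truncn (n%:R * U%:R / G)).+1 <= expR (- n%:R).
Proof.
move=> G0 GU n0.
have U0 : (0 : R) < U%:R := lt_le_trans G0 GU.
have g1 : G / U%:R <= 1 by rewrite ler_pdivrMr// mul1r.
set L := (_).+1.
have hL : n%:R <= G / U%:R * L%:R.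
  rewrite mulrAC ler_pdivlMr// -ler_pdivrMl// mulrC; apply/ltW; exact: truncnS_gt.
apply: (@le_trans _ _ (expR (- (G / U%:R)) ^+ L)).
  rewrite lerXn2r ?nnegrE ?expR_ge0 ?subr_ge0//; exact: expR_ge1Dx.
by rewrite -expRM_natr ler_expR mulNr lerN2.
Qed.

Lemma covering_size n (U : nat) (G : R) : 0 < G -> G <= U%:R ->
  (Num.truncn (n%:R * U%:R / G)).+1%:R <= n.+1%:R * (U%:R / G).
Proof.
move=> G0 GU; rewrite -2!natr1 [leRHS]mulrDl mul1r lerD//.
  by rewrite mulrA truncn_le// divr_ge0 ?mulr_ge0// ltW.
by rewrite ler_pdivlMr// mul1r.
Qed.

Lemma err_prob_le k n Mp Mc M (clean : 'I_Mp -> 'I_Mc -> 'M[C]_(k, n))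
    (D : 'M[C]_(k, n) -> 'I_M) (target : 'I_Mp -> 'I_Mc -> 'I_M) (f : 'I_Mp -> 'I_Mc -> R) (e : R) :
  (0 < Mp * Mc)%N ->
  (forall mp mc,
    (gauss_tuple [set t | D (clean mp mc + noise_mx t)%R != target mp mc] <= (f mp mc)%:E)%E) ->
  \sum_mp \sum_mc f mp mc <= (Mp * Mc)%:R * e ->
  (err_prob clean D target <= e%:E)%E.
Proof.
move=> M0 hf hs; rewrite /err_prob.
apply: (@le_trans _ _ (((Mp * Mc)%:R^-1)%:E * (\sum_mp \sum_mc f mp mc)%:E)%E).
  apply: lee_wpmul2l; first by rewrite lee_fin invr_ge0.
  rewrite -sumEFin; apply: lee_sum => mp _; rewrite -sumEFin; apply: lee_sum => mc _.
  exact: hf.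
by rewrite -EFinM lee_fin ler_pdivrMl// ltr0n.
Qed.
End ExponentBounds.

(** * From counting bounds to a code with decoders *)

Section CodeFromTypicalWords.
Variable R : realType.
Local Notation C := R[i].
Variables (npt nct npr ncr n a b : nat).
Variables (Hpp : 'M[C]_(npr, npt)) (Hcp : 'M[C]_(npr, nct)).
Variables (Hpc : 'M[C]_(ncr, npt)) (Hcc : 'M[C]_(ncr, nct)).
Variables (W U : finType) (good : W -> pred U).
Variables (encp : W -> 'M[C]_(npt, n)) (encc : W -> U -> 'M[C]_(nct, n)).
Variables (omp : 'I_n -> 'I_a -> R) (Lp : 'I_n -> 'M[C]_(a, npr)).
Variables (xw : W -> 'I_n -> 'I_a -> C) (thp : R).
Variables (omc : 'I_n -> 'I_b -> R) (Lc : 'I_n -> 'M[C]_(b, ncr)).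
Variables (xu : U -> 'I_n -> 'I_b -> C) (thc : R).
Variables (Np Nc g e e' : R) (Mp Mc L : nat).
Let clp w u := Hpp *m encp w + Hcp *m encc w u.
Let clc w u := Hpc *m encp w + Hcc *m encc w u.
Local Notation near_p := (near_word omp Lp xw thp).
Local Notation near_c := (near_word omc Lc xu thc).

(** The error of either receiver is at most the noise term e plus [code_cost], so a code of small
    average cost serves both. When no good auxiliary word is found the cognitive transmitter sends
    0, which the cost 1 already covers. *)
Lemma code_from_typical_words :
  (forall w u, good w u ->
    (gauss_prob R (npr * n + npr * n) [set z | ~~ near_p w (clp w u + noise_mx z)] <= e%:E)%E) ->
  (forall w u, good w u ->
    (gauss_prob R (ncr * n + ncr * n) [set z | ~~ near_c u (clc w u + noise_mx z)] <= e%:E)%E) ->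
  (forall cl, \sum_w fine (gauss_prob R (npr * n + npr * n)
    [set z | near_p w (cl + noise_mx z)]) <= Np) ->
  (forall cl, \sum_u fine (gauss_prob R (ncr * n + ncr * n)
    [set z | near_c u (cl + noise_mx z)]) <= Nc) ->
  (0 < #|W|)%N -> (0 < #|U|)%N -> (forall w, g * #|U|%:R <= #|good w|%:R) ->
  0 <= e -> 0 <= Np -> 0 <= Nc -> (0 < Mp)%N -> (0 < Mc)%N ->
  (1 - g) ^+ L + Mp.-1%:R * (Np / #|W|%:R) + (Mc.-1 * L)%:R * (Nc / #|U|%:R) <= e' ->
  exists (Ep : 'I_Mp -> 'M[C]_(npt, n)) (Ec : 'I_Mp -> 'I_Mc -> 'M[C]_(nct, n))
    (Dp : 'M[C]_(npr, n) -> 'I_Mp) (Dc : 'M[C]_(ncr, n) -> 'I_Mc),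
  [/\ forall mp, exists w, Ep mp = encp w,
      forall mp mc, Ec mp mc = 0 \/ exists w u, good w u /\ Ec mp mc = encc w u,
      shift_measurable Dp /\ shift_measurable Dc,
      (err_prob (fun mp mc => (Hpp *m Ep mp + Hcp *m Ec mp mc)%R) Dp (fun mp _ => mp)
         <= (e + e')%:E)%E &
      (err_prob (fun mp mc => (Hpc *m Ep mp + Hcc *m Ec mp mc)%R) Dc (fun _ mc => mc)
         <= (e + e')%:E)%E].
Proof.
move=> noiseP noiseC confP confC W0 U0 good_ge e0 Np0 Nc0 Mp0 Mc0 he'.
pose confp w' w u : R := fine (gauss_prob R (npr * n + npr * n)
  [set z | near_p w' (clp w u + noise_mx z)]).
pose confc u' w u : R := fine (gauss_prob R (ncr * n + ncr * n)
  [set z | near_c u' (clc w u + noise_mx z)]).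
have [cw [cu hcost]] := good_code_exists (confp := confp) (confc := confc)
  (fun w u _ => confP (clp w u)) (fun w u _ => confC (clc w u)) W0 U0 good_ge Np0 Nc0 Mp Mc L.
have confp0 w' w u : 0 <= confp w' w u by exact: fine_ge0.
have confc0 w' w u : 0 <= confc w' w u by exact: fine_ge0.
pose sel := selw good cw cu.
pose Ep mp := encp (cw mp).
pose Ec mp mc := if sel mp mc is Some u then encc (cw mp) u else 0.
pose Dp := thr_decoder omp Lp (fun mp => xw (cw mp)) thp id (Ordinal Mp0).
pose Dc := thr_decoder omc Lc (fun i => xu (cu i)) thc (@fst 'I_Mc 'I_L) (Ordinal Mc0).
have selP mp mc u : sel mp mc = Some u -> good (cw mp) u /\ exists l, u = cu (mc, l).
  by rewrite /sel /selw; case: pickP => //= l hl [<-]; split=> //; exists l.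
have costS : \sum_(mp < Mp) \sum_(mc < Mc) (e + code_cost good confp confc cw cu mp mc) <=
    (Mp * Mc)%:R * (e + e').
  under eq_bigr do rewrite big_split.
  rewrite big_split /= !sum_cst !card_ord mulrDr lerD//; first by rewrite natrM mulrA.
  by apply: le_trans hcost _; rewrite ler_wpM2l.
have MM : (0 < Mp * Mc)%N by rewrite muln_gt0 Mp0.
have le1 k (E : set ((k * n + k * n).-tuple R)) x : measurable E -> 1 <= x ->
    (gauss_tuple E <= x%:E)%E.
  move=> mE x1; rewrite gauss_tupleE//; apply: le_trans (probability_le1 _ mE) _.
  by rewrite lee_fin.
exists Ep, Ec, Dp, Dc; split.
- by move=> mp; exists (cw mp).
- move=> mp mc; rewrite /Ec; case E : (sel mp mc) => [u|]; last by left.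
  by right; exists (cw mp), u; have [] := selP _ _ _ E.
- split; exact: measurable_thr_decoder.
- apply: err_prob_le MM _ costS => mp mc.
  have mD cl : measurable [set z | Dp (cl + noise_mx z) != mp].
    exact: (@measurable_thr_decoder _ _ _ _ _ _ _ _ _ _ _ _ (predC1 mp)).
  rewrite /code_cost -/(sel mp mc) /Ec; case E : (sel mp mc) => [u|].
    have [gu _] := selP _ _ _ E.
    apply: le_trans (@thr_decoder_err R a npr n 'I_Mp omp Lp _ thp Mp id _ mp
      (clp (cw mp) u) e (noiseP _ _ gu)) _.
    rewrite lee_fin lerD2l lerDl; apply: sumr_ge0 => i _; exact: confc0.
  by apply: le1 => //; rewrite lerDr.
- apply: err_prob_le MM _ costS => mp mc.
  have mD cl : measurable [set z | Dc (cl + noise_mx z) != mc].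
    exact: (@measurable_thr_decoder _ _ _ _ _ _ _ _ _ _ _ _ (predC1 mc)).
  rewrite /code_cost -/(sel mp mc) /Ec; case E : (sel mp mc) => [u|].
    have [gu [l ul]] := selP _ _ _ E; rewrite ul in gu *.
    apply: le_trans (@thr_decoder_err R b ncr n ('I_Mc * 'I_L)%type omc Lc _ thc Mc fst _ (mc, l)
      (clc (cw mp) (cu (mc, l))) e (noiseC _ _ gu)) _.
    rewrite lee_fin lerD2l lerDr; apply: sumr_ge0 => i _; exact: confp0.
  by apply: le1 => //; rewrite lerDr.
Qed.
End CodeFromTypicalWords.

Definition gval (R : realType) M B (eta : R) (i : 'I_M) : R := eta * (i%:R - B%:R).

Section NearWords.
Variable R : realType.
Local Notation C := R[i].

(** The noiseless residual at each time must be a function of the state only; the threshold then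
    exceeds its energy plus that of the filtered noise by n e, and the noise is large enough to
    cross it with small probability. *)
Lemma state_near_word (S : finType) m k (om : S -> 'I_m -> R) (h : S -> 'I_m -> C)
    (L : S -> 'M[C]_(m, k)) (e eps : R) : (forall s j, 0 <= om s j) -> 0 < e -> 0 < eps ->
  exists N0, forall n, (N0 <= n)%N -> forall (sg : 'I_n -> S) (I : finType)
    (x : I -> 'I_n -> 'I_m -> C) (i : I) (th : R) (cl : 'M[C]_(k, n)),
  (forall t j, x i t j - (L (sg t) *m col t cl) j 0 = h (sg t) j) ->
  \sum_t \sum_j om (sg t) j * (nsq (h (sg t) j) + \sum_a nsq (L (sg t) j a)) + n%:R * e <= th ->
  (gauss_prob R (k * n + k * n) [set z | ~~ near_word (fun t => om (sg t)) (fun t => L (sg t))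
     x th i (cl + noise_mx z)]%R <= eps%:E)%E.
Proof.
move=> om0 e0 eps0.
have [N0 HN] := state_noise_tail h (fun s => - L s) om0 e0 eps0.
exists N0 => n hn sg I x i th cl hx hth; apply: le_trans (HN n hn sg).
apply: le_measure; rewrite ?inE.
- have -> : [set z |
      ~~ near_word (fun t => om (sg t)) (fun t => L (sg t)) x th i (cl + noise_mx z)] =
      ~` [set z | near_word (fun t => om (sg t)) (fun t => L (sg t)) x th i (cl + noise_mx z)].
    by apply/seteqP; split=> z /= /negP.
  apply: measurableC; exact: measurable_near_word.
- rewrite -[X in measurable X]setTI; apply: measurable_fun_le => //.
  exact: (measurable_noise_metric (fun t => om (sg t)) (fun t => h (sg t)) (fun t => - L (sg t))).
- move=> z /=; rewrite /near_word -ltNge dec_metricE => /ltW hz.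
  under [leRHS]eq_bigr do under eq_bigr do rewrite -hx.
  apply: le_trans hz; apply: le_trans hth; rewrite lerD2r.
  apply: ler_sum => t _; apply: ler_sum => j _; rewrite ler_wpM2l// lerD2l.
  by apply: ler_sum => a _; rewrite [(- L _) _ _]mxE nsqN.
Qed.

Lemma near_word_sum_le n k r M B (eta del D th : R) (d : 'I_n -> 'I_k -> R) (I : finType)
    (f : I -> {ffun 'I_n -> {ffun 'I_k * bool -> 'I_M}}) (L : 'I_n -> 'M[C]_(k, r)) cl :
  injective f -> 0 < eta ->
  (forall d b m, 0 < d <= D ->
    eta * \sum_(i < m) expR (- (d * (eta * i%:R - b) ^+ 2)) <= expR del * Num.sqrt (pi / d)) ->
  (forall t j, 0 < d t j <= D) ->
  \sum_i fine (gauss_prob R (r * n + r * n) [set z | near_word d L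
      (fun i t j => cletter (gval B eta) (f i t) j) th i (cl + noise_mx z)])
  <= expR (th + \sum_t \sum_j (2 * del + ln pi - ln (d t j) - 2 * ln eta)).
Proof.
move=> fI eta0 grid dD; apply: sum_measure_le => [i|z].
  exact: measurable_near_word.
pose y t j := (L t *m col t (cl + noise_mx z)) j 0.
apply: le_trans (@ellipsoid_count R n k M B eta del D th d y eta0 grid dD).
rewrite (eq_bigr (fun i => (near_word d L
      (fun i t j => cletter (gval B eta) (f i t) j) th i (cl + noise_mx z))%:R)); last first.
  move=> i _; rewrite indicE; congr (_%:R); congr nat_of_bool.
  by apply/idP/idP; rewrite inE.
rewrite -natr_sum ler_nat -big_mkcond /= sum1dep_card -(fintype.card_image fI).
apply: subset_leq_card; apply/fintype.subsetP => u /fintype.imageP[i hi ->].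
by move: hi; rewrite !inE.
Qed.
End NearWords.

(** Power is bounded for every codeword, so that silencing a fraction of the messages reduces the
    average by that fraction. *)
Definition bounded_code (R : realType) (npt nct npr ncr : nat)
    (Hpp : 'M[R[i]]_(npr, npt)) (Hcp : 'M[R[i]]_(npr, nct))
    (Hpc : 'M[R[i]]_(ncr, npt)) (Hcc : 'M[R[i]]_(ncr, nct))
    n Mp Mc (Ep_max Ec_max eps : R) : Prop :=
  exists (Ep : 'I_Mp -> 'M[R[i]]_(npt, n)) (Ec : 'I_Mp -> 'I_Mc -> 'M[R[i]]_(nct, n))
    (Dp : 'M[R[i]]_(npr, n) -> 'I_Mp) (Dc : 'M[R[i]]_(ncr, n) -> 'I_Mc),
  [/\ forall mp, frob (Ep mp) <= Ep_max, forall mp mc, frob (Ec mp mc) <= Ec_max,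
      shift_measurable Dp /\ shift_measurable Dc,
      (err_prob (fun mp mc => (Hpp *m Ep mp + Hcp *m Ec mp mc)%R) Dp (fun mp _ => mp)
         <= eps%:E)%E &
      (err_prob (fun mp mc => (Hpc *m Ep mp + Hcc *m Ec mp mc)%R) Dc (fun _ mc => mc)
         <= eps%:E)%E].

(** * Dirty-paper codes for a finite family of modes *)

Section CodeConstruction.
Variable R : realType.
Local Notation C := R[i].
Variables (npt nct npr ncr : nat).
Variables (Hpp : 'M[C]_(npr, npt)) (Hcp : 'M[C]_(npr, nct)).
Variables (Hpc : 'M[C]_(ncr, npt)) (Hcc : 'M[C]_(ncr, nct)).
Variables (a b q : nat) (md : 'I_q -> mode R npt nct npr ncr a b).
Variables (Pp Pc del d1 D eta Z v : R) (B B2 : nat).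
Local Notation Wl := {ffun 'I_a * bool -> 'I_(2 * B).+1}.
Local Notation Vl := {ffun 'I_b * bool -> 'I_(2 * B).+1}.
Local Notation Ul := {ffun 'I_b * bool -> 'I_(2 * (B + B2)).+1}.
(* Grid indices of the quantised interference: they keep [u = v + qvec] on the grid. *)
Variable qz : 'I_q * Wl * ('I_b * bool) -> nat.
Local Notation val := (@gval R (2 * B).+1 B eta).
Local Notation valU := (@gval R (2 * (B + B2)).+1 (B + B2) eta).
Local Notation law := (fun i : 'I_(2 * B).+1 => expR (- val i ^+ 2) / Z).

(** Up to filtered noise, the primary residual is [wres] w - [vleak] v and the cognitive one is (u -
    v - [wshift] w) + [vres] v. Taking u - v close to [wshift] w removes the interference from the
    latter. *)
Definition wres i := 1%:M - mKp (md i) *m (Hpp *m mFp (md i) + Hcp *m mFcw (md i)).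
Definition vleak i := mKp (md i) *m (Hcp *m mFcv (md i)).
Definition vres i := 1%:M - mKc (md i) *m (Hcc *m mFcv (md i)).
Definition wshift i := mKc (md i) *m (Hpc *m mFp (md i) + Hcc *m mFcw (md i)).

Definition wvec (x : Wl) : 'cV[C]_a := \col_j cletter val x j.
Definition vvec (x : Vl) : 'cV[C]_b := \col_j cletter val x j.
Definition uvec (x : Ul) : 'cV[C]_b := \col_j cletter valU x j.
Definition qvec i (x : Wl) : 'cV[C]_b :=
  \col_j Complex (eta * ((qz (i, x, (j, false)))%:R - B2%:R))
                 (eta * ((qz (i, x, (j, true)))%:R - B2%:R)).

Lemma mulmx_colE m k (A : 'M[C]_(m, k)) (f : 'I_k -> C) j :
  (A *m \col_i f i) j 0 = \sum_i A j i * f i.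
Proof. by rewrite mxE; apply: eq_bigr => i _; rewrite mxE. Qed.

Lemma cpartB bb (x y : C) : cpart bb (x - y) = cpart bb x - cpart bb y.
Proof. by case: bb x y => -[? ?] [? ?]. Qed.

Lemma mulmx_vvecE m (A : 'M[C]_(m, b)) x j :
  (A *m vvec x) j 0 = \sum_i A j i * cletter val x i.
Proof. exact: mulmx_colE. Qed.

Section Sequences.
Variables (n : nat) (c : 'I_n -> 'I_q).

Definition typ_pow (w : {ffun 'I_n -> Wl}) :=
  \sum_t \sum_j nsq ((mFp (md (c t)) *m wvec (w t)) j 0) <= n%:R * ((1 + del) * Pp).
Definition typ_cpow (w : {ffun 'I_n -> Wl}) :=
  \sum_t \sum_j nsq ((mFcw (md (c t)) *m wvec (w t)) j 0) <=
    \sum_t 2 * v * frob (mFcw (md (c t))) + n%:R * (del / 4 * Pc).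
Definition typ_res (w : {ffun 'I_n -> Wl}) :=
  \sum_t \sum_j mdp (md (c t)) j * nsq ((wres (c t) *m wvec (w t)) j 0) <=
    \sum_t \sum_j mdp (md (c t)) j * (2 * v * \sum_i nsq (wres (c t) j i)) + n%:R * d1.
Definition typ_w w := [&& typ_pow w, typ_cpow w & typ_res w].

(** Conditions on v for a given typical w. Variances with 2v <= 1 + 2 d1 account for the terms 2 a
    d1 and 2 b d1 below; of the remaining 2 d1, one is the fluctuation of v, the other that of w at
    the primary receiver or the quantisation error at the cognitive one. *)
Definition good_pow (w : {ffun 'I_n -> Wl}) (V : 'I_n -> 'cV[C]_b) :=
  \sum_t \sum_j nsq ((mFcw (md (c t)) *m wvec (w t) + mFcv (md (c t)) *m V t) j 0) <=
    n%:R * ((1 + del) * Pc).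
Definition good_resp (w : {ffun 'I_n -> Wl}) (V : 'I_n -> 'cV[C]_b) :=
  \sum_t \sum_j mdp (md (c t)) j *
    (nsq ((wres (c t) *m wvec (w t) - vleak (c t) *m V t) j 0)
     + \sum_i nsq (mKp (md (c t)) j i)) <= n%:R * (a%:R + 2 * a%:R * d1 + 2 * d1).
Definition good_resc (w : {ffun 'I_n -> Wl}) (V : 'I_n -> 'cV[C]_b) :=
  \sum_t \sum_j mdc (md (c t)) j *
    (nsq (((qvec (c t) (w t) - wshift (c t) *m wvec (w t)) + vres (c t) *m V t) j 0)
     + \sum_i nsq (mKc (md (c t)) j i)) <= n%:R * (b%:R + 2 * b%:R * d1 + 2 * d1).
Definition good_v w V := [&& good_pow w V, good_resp w V & good_resc w V].

Definition vseq (w : {ffun 'I_n -> Wl}) (u : {ffun 'I_n -> Ul}) t :=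
  uvec (u t) - qvec (c t) (w t).
Definition good_u w u := good_v w (vseq w u).
End Sequences.

Hypothesis okm : forall i, mode_ok Hpp Hcp Hcc Pp Pc (md i).
Hypothesis Pp0 : 0 <= Pp.
Hypothesis Pc0 : 0 <= Pc.
Hypothesis del0 : 0 < del.
Hypothesis d10 : 0 < d1.
Hypothesis d1del : d1 <= del / 4.
Hypothesis sumdp_le : forall i, \sum_j mdp (md i) j <= D.
Hypothesis sumdc_le : forall i, \sum_j mdc (md i) j <= D.
Hypothesis d1D : d1 * (2 * D) <= 1.
Hypothesis eta0 : 0 < eta.
Hypothesis eta_le : eta <= d1.
Hypothesis Z0 : 0 < Z.
Hypothesis p1 : \sum_i expR (- val i ^+ 2) / Z = 1.
Hypothesis val1 : \sum_i expR (- val i ^+ 2) / Z * val i = 0.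
Hypothesis val2 : \sum_i expR (- val i ^+ 2) / Z * val i ^+ 2 = v.
Hypothesis v_ge : 2^-1 - d1 <= v.
Hypothesis v_le : v <= 2^-1 + d1.
Hypothesis grid_le : forall d x m, 0 < d <= D ->
  eta * \sum_(i < m) expR (- (d * (eta * i%:R - x) ^+ 2)) <= expR d1 * Num.sqrt (pi / d).
Hypothesis Z_ge : expR (- d1) * Num.sqrt pi <= eta * Z.
Hypothesis d1a : d1 * (8 * a%:R + 4) <= del / 2.
Hypothesis d1b : d1 * (8 * b%:R + 4) <= del / 2.
Hypothesis qz_le : forall s, (qz s <= 2 * B2)%N.
Hypothesis qz_near : forall i x j bb,
  `|eta * ((qz (i, x, (j, bb)))%:R - B2%:R) - cpart bb ((wshift i *m wvec x) j 0)| <= eta.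

Let p0 : forall i, 0 <= expR (- val i ^+ 2) / Z.
Proof. by move=> i; rewrite divr_ge0 ?expR_ge0// ltW. Qed.
Let v0 : 0 <= v.
Proof.
rewrite -val2; apply: sumr_ge0 => i _; rewrite mulr_ge0 ?sqr_ge0//; exact: p0.
Qed.
Let dp_ge1 i j : 1 <= mdp (md i) j. Proof. by have [[]] := okm i. Qed.
Let dc_ge1 i j : 1 <= mdc (md i) j. Proof. by have [[]] := okm i. Qed.
Let dp_ge0 i j : 0 <= mdp (md i) j. Proof. exact: le_trans (dp_ge1 i j). Qed.
Let dc_ge0 i j : 0 <= mdc (md i) j. Proof. exact: le_trans (dc_ge1 i j). Qed.

Lemma frob_eq0 m k (A : 'M[C]_(m, k)) : frob A <= 0 -> forall i j, A i j = 0.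
Proof.
move=> A0 i j; have h : nsq (A i j) <= 0.
  apply: le_trans A0.
  apply: le_trans (term_le_sum i _); last by move=> i'; apply: sumr_ge0 => ? _; exact: nsq_ge0.
  by apply: (@term_le_sum _ _ (fun j => nsq (A i j))) => ?; exact: nsq_ge0.
case: (A i j) h => x y; rewrite /nsq /= => h.
have /eqP : x ^+ 2 + y ^+ 2 = 0 by apply/le_anti; rewrite h addr_ge0 ?sqr_ge0.
by rewrite paddr_eq0 ?sqr_ge0// !sqrf_eq0 => /andP[/eqP -> /eqP ->].
Qed.

Lemma row_nsq_ge0 m k (A : 'M[C]_(m, k)) r : 0 <= \sum_i nsq (A r i).
Proof. by apply: sumr_ge0 => i _; exact: nsq_ge0. Qed.

Lemma bad_words_le n k (P Q : pred {ffun 'I_n -> {ffun 'I_k * bool -> 'I_(2 * B).+1}}) (x : R) :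
  \sum_(g | ~~ Q g) prodlaw (prodlaw law) g <= x -> (forall g, Q g -> P g) ->
  \sum_(g | ~~ P g) prodlaw (prodlaw law) g <= x.
Proof.
move=> hx QP; apply: le_trans hx; apply: sum_pred_le => g; first exact/contra/QP.
by apply: prodlaw_ge0 => ?; exact: prodlaw_ge0.
Qed.

Lemma scaled_power_cases (S : finType) m k (F : S -> 'M[C]_(m, k)) (x P : R) :
  0 < x -> 0 <= P -> (forall s, frob (F s) <= P) ->
  0 < x * P \/ x * P = 0 /\ (forall s i j, F s i j = 0).
Proof.
move=> x0; rewrite le_eqVlt => /predU1P[<-|P0] hF; last by left; rewrite mulr_gt0.
by right; rewrite mulr0; split=> // s; exact: frob_eq0.
Qed.

Let Fp_le i : frob (mFp (md i)) <= Pp. Proof. by have [_ []] := okm i. Qed.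
Let Fcw_le i : frob (mFcw (md i)) <= Pc.
Proof. by have [_ [_]] := okm i; apply: le_trans; rewrite lerDl; exact: frob_ge0. Qed.
Let Fcv_le i : frob (mFcv (md i)) <= Pc.
Proof. by have [_ [_]] := okm i; apply: le_trans; rewrite lerDr; exact: frob_ge0. Qed.

Lemma nsq0 : nsq (0 : C) = 0.
Proof. by rewrite /nsq /= expr0n addr0. Qed.

Lemma mean_frob m k (F : 'M[C]_(m, k)) :
  \sum_j 1 * (nsq 0 + 2 * v * \sum_i nsq (F j i)) = 2 * v * frob F.
Proof. by rewrite /frob mulr_sumr; apply: eq_bigr => j _; rewrite mul1r nsq0 add0r. Qed.

Lemma sum_time_le n (F : 'I_n -> R) (x : R) : (forall t, F t <= x) -> \sum_t F t <= n%:R * x.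
Proof.
by move=> Fx; apply: le_trans (ler_sum _ (fun t _ => Fx t)) _; rewrite sum_cst card_ord.
Qed.

Lemma wsumD n k (d f g : 'I_n -> 'I_k -> R) :
  \sum_t \sum_j d t j * (f t j + g t j) =
  \sum_t \sum_j d t j * f t j + \sum_t \sum_j d t j * g t j.
Proof.
rewrite -big_split; apply: eq_bigr => t _ /=; rewrite -big_split.
by apply: eq_bigr => j _; rewrite mulrDr.
Qed.

Lemma typ_w_count : exists N0, forall n, (N0 <= n)%N -> forall c : 'I_n -> 'I_q,
  2^-1 * expR (n%:R * (2 * v * a%:R) - n%:R * d1 + n%:R * (a%:R * (2 * ln Z)))
    <= #|[pred w | typ_w c w]|%:R.
Proof.
have vle := v_le; have d1le := d1del; have d1p := d10; have delp := del0.
have [N1 H1] := energy_tail p0 p1 val1 val2 a d10.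
have e2 := scaled_power_cases (divr_gt0 del0 (ltr0n R 2)) Pp0 Fp_le.
have [|N2 H2] := state_tail p0 p1 val1 val2 (S := 'I_q) (J := 'I_npt)
  (om := fun _ _ => 1) (fun _ _ => 0) _ e2 => //.
have e3 := scaled_power_cases (divr_gt0 del0 (ltr0n R 4)) Pc0 Fcw_le.
have [|N3 H3] := state_tail p0 p1 val1 val2 (S := 'I_q) (J := 'I_nct)
  (om := fun _ _ => 1) (fun _ _ => 0) _ e3 => //.
have [N4 H4] := state_tail p0 p1 val1 val2 (S := 'I_q) (J := 'I_a)
  (om := fun i => mdp (md i)) (L := wres) (fun _ _ => 0) dp_ge0 (or_introl d10).
exists (maxn (maxn N1 N2) (maxn N3 N4)) => n; rewrite !geq_max.
move=> /andP[/andP[n1 n2] /andP[n3 n4]] c.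
apply: (@typ_count _ _ _ _ val _ _ (typ_pow c) (typ_cpow c) (typ_res c)) => //.
- exact: (H1 n n1).
- apply: (bad_words_le (H2 n n2 c)) => g h; rewrite /typ_pow.
  under eq_bigr do under eq_bigr do rewrite mulmx_colE -[X in nsq X]add0r -[nsq _]mul1r.
  apply: le_trans h _; under eq_bigr do rewrite mean_frob.
  rewrite [in leRHS](_ : (1 + del) * Pp = (1 + del / 2) * Pp + del / 2 * Pp); last by field.
  rewrite [leRHS]mulrDr lerD2r; apply: sum_time_le => t.
  by apply: ler_pM; rewrite ?mulr_ge0 ?frob_ge0//; lra.
- apply: (bad_words_le (H3 n n3 c)) => g h; rewrite /typ_cpow.
  under eq_bigr do under eq_bigr do rewrite mulmx_colE -[X in nsq X]add0r -[nsq _]mul1r.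
  by apply: le_trans h _; under eq_bigr do rewrite mean_frob.
- apply: (bad_words_le (H4 n n4 c)) => g h; rewrite /typ_res.
  under eq_bigr do under eq_bigr do rewrite mulmx_colE -[X in nsq X]add0r.
  by apply: le_trans h _; under eq_bigr do under eq_bigr do rewrite nsq0 add0r.
Qed.

(** For fixed w the letters of w are part of the state and enter only as offsets, so the tail bounds
    for v hold with one N0 for all w; typicality of w then controls the offsets. *)
Lemma good_v_count : exists N0, forall n, (N0 <= n)%N -> forall (c : 'I_n -> 'I_q) w,
  typ_w c w ->
  2^-1 * expR (n%:R * (2 * v * b%:R) - n%:R * d1 + n%:R * (b%:R * (2 * ln Z)))
    <= #|[pred g : {ffun 'I_n -> Vl} | good_v c w (fun t => vvec (g t))]|%:R.
Proof.
have vle := v_le; have d1le := d1del; have d1p := d10; have delp := del0.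
have [N1 H1] := energy_tail p0 p1 val1 val2 b d10.
have e2 := scaled_power_cases (divr_gt0 del0 (ltr0n R 4)) Pc0 (fun s : 'I_q * Wl => Fcv_le s.1).
have [|N2 H2] := state_tail p0 p1 val1 val2 (J := 'I_nct)
  (om := fun _ _ => 1) (fun s j => (mFcw (md s.1) *m wvec s.2) j 0) _ e2 => //.
have [N3 H3] := state_tail p0 p1 val1 val2 (S := ('I_q * Wl)%type) (J := 'I_a)
  (om := fun s => mdp (md s.1)) (L := fun s j k => (- vleak s.1) j k)
  (fun s j => (wres s.1 *m wvec s.2) j 0)
  (fun s j => dp_ge0 s.1 j) (or_introl d10).
have [N4 H4] := state_tail p0 p1 val1 val2 (S := ('I_q * Wl)%type) (J := 'I_b)
  (om := fun s => mdc (md s.1)) (L := fun s => vres s.1)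
  (fun s j => (qvec s.1 s.2 - wshift s.1 *m wvec s.2) j 0)
  (fun s j => dc_ge0 s.1 j) (or_introl d10).
exists (maxn (maxn N1 N2) (maxn N3 N4)) => n; rewrite !geq_max.
move=> /andP[/andP[n1 n2] /andP[n3 n4]] c w /and3P[_ tc tr].
pose sg t := (c t, w t).
apply: (@typ_count _ _ _ _ val _ _ (fun g => good_pow c w (fun t => vvec (g t)))
  (fun g => good_resp c w (fun t => vvec (g t)))
  (fun g => good_resc c w (fun t => vvec (g t)))) => //.
- exact: (H1 n n1).
- apply: (bad_words_le (H2 n n2 sg)) => g h; rewrite /good_pow.
  under eq_bigr do under eq_bigr do rewrite mx_addE mulmx_vvecE -[nsq _]mul1r.
  apply: le_trans h _.
  have -> : \sum_t \sum_j 1 * (nsq ((mFcw (md (sg t).1) *m wvec (sg t).2) j 0) +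
        2 * v * \sum_i nsq (mFcv (md (sg t).1) j i)) =
      \sum_t \sum_j nsq ((mFcw (md (c t)) *m wvec (w t)) j 0) +
      \sum_t 2 * v * frob (mFcv (md (c t))).
    rewrite -big_split; apply: eq_bigr => t _ /=; rewrite -mean_frob -big_split.
    by apply: eq_bigr => j _ /=; rewrite !mul1r nsq0 add0r.
  have h3 : \sum_t 2 * v * frob (mFcw (md (c t))) + \sum_t 2 * v * frob (mFcv (md (c t))) <=
      n%:R * ((1 + del / 2) * Pc).
    rewrite -big_split; apply: sum_time_le => t /=; rewrite -mulrDr.
    apply: ler_pM; rewrite ?mulr_ge0 ?addr_ge0 ?frob_ge0//; first lra.
    by have [_ []] := okm (c t).
  rewrite [in leRHS](_ : (1 + del) * Pc = (1 + del / 2) * Pc + (del / 4 * Pc + del / 4 * Pc));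
    last by field.
  move: tc; rewrite /typ_cpow; rewrite !mulrDr in h3 *; lra.
- apply: (bad_words_le (H3 n n3 sg)) => g; rewrite /good_resp /sg /= => h; rewrite [leLHS]wsumD.
  rewrite [X in _ <= X + _]wsumD in h.
  under eq_bigr do under eq_bigr do rewrite mx_addE -mulNmx mulmx_vvecE.
  rewrite [X in _ <= _ + X + _](_ : _ =
    \sum_t \sum_j mdp (md (c t)) j * (2 * v * \sum_i nsq (vleak (c t) j i))) in h; last first.
    apply: eq_bigr => t _; apply: eq_bigr => j _; congr (_ * (_ * _)).
    by apply: eq_bigr => i _; rewrite [(- vleak _) _ _]mxE nsqN.
  have h3 : \sum_t \sum_j mdp (md (c t)) j * (2 * v * \sum_i nsq (wres (c t) j i)) +
      \sum_t \sum_j mdp (md (c t)) j * (2 * v * \sum_i nsq (vleak (c t) j i)) +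
      \sum_t \sum_j mdp (md (c t)) j * \sum_i nsq (mKp (md (c t)) j i) <=
      n%:R * ((1 + 2 * d1) * a%:R).
    rewrite -!big_split; apply: sum_time_le => t /=; rewrite -!big_split /=.
    have [[_ _ hp _] _] := okm (c t).
    apply: le_trans (ler_wpM2l _ hp); last lra.
    rewrite mulr_sumr; apply: ler_sum => j _; rewrite -!mulrDr mulrCA ler_wpM2l//.
    rewrite !mulrDr -!/(wres _) -!/(vleak _).
    have := row_nsq_ge0 (wres (c t)) j; have := row_nsq_ge0 (vleak (c t)) j.
    have := row_nsq_ge0 (mKp (md (c t))) j; nra.
  move: tr h; rewrite /typ_res; lra.
- apply: (bad_words_le (H4 n n4 sg)) => g; rewrite /good_resc /sg /= => h; rewrite [leLHS]wsumD.
  rewrite [X in _ <= X + _]wsumD in h.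
  under eq_bigr do under eq_bigr do rewrite mx_addE mulmx_vvecE.
  have h3 : \sum_t \sum_j mdc (md (c t)) j * (2 * v * \sum_i nsq (vres (c t) j i)) +
      \sum_t \sum_j mdc (md (c t)) j * \sum_i nsq (mKc (md (c t)) j i) <=
      n%:R * ((1 + 2 * d1) * b%:R).
    rewrite -!big_split; apply: sum_time_le => t /=; rewrite -!big_split /=.
    have [[_ _ _ hc] _] := okm (c t).
    apply: le_trans (ler_wpM2l _ hc); last lra.
    rewrite mulr_sumr; apply: ler_sum => j _; rewrite -!mulrDr mulrCA ler_wpM2l//.
    rewrite !mulrDr -!/(vres _).
    have := row_nsq_ge0 (vres (c t)) j.
    have := row_nsq_ge0 (mKc (md (c t))) j; nra.
  have h4 : \sum_t \sum_j mdc (md (c t)) j *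
      nsq ((qvec (c t) (w t) - wshift (c t) *m wvec (w t)) j 0) <= n%:R * d1.
    (* Rounding errs by at most eta in each real part; eta <= d1 and 2 D d1 <= 1 make the weighted
       error at most d1. *)
    apply: sum_time_le => t; apply: (@le_trans _ _ (D * (2 * eta ^+ 2))).
      apply: le_trans (ler_wpM2r _ (sumdc_le (c t))); last by rewrite mulr_ge0 ?sqr_ge0.
      rewrite mulr_suml; apply: ler_sum => j _; rewrite ler_wpM2l// mx_subE nsqE.
      have part bb : cpart bb (qvec (c t) (w t) j 0 - (wshift (c t) *m wvec (w t)) j 0) ^+ 2 <=
          eta ^+ 2.
        have -> : cpart bb (qvec (c t) (w t) j 0 - (wshift (c t) *m wvec (w t)) j 0) =
            eta * ((qz (c t, w t, (j, bb)))%:R - B2%:R)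
            - cpart bb ((wshift (c t) *m wvec (w t)) j 0).
          by rewrite cpartB [qvec _ _ _ _]mxE; case: bb.
        by rewrite -real_normK ?num_real// lerXn2r ?nnegrE// ?ltW//; exact: qz_near.
      by rewrite big_bool mulr_natl mulr2n lerD.
    have D0 : 0 <= D by apply: le_trans (sumdc_le (c t)); apply: sumr_ge0.
    have h5 : eta ^+ 2 <= d1 ^+ 2 by rewrite lerXn2r// nnegrE ltW.
    apply: le_trans (_ : d1 * (2 * D) * d1 <= _).
      rewrite (_ : d1 * (2 * D) * d1 = D * (2 * d1 ^+ 2)); last by ring.
      by rewrite ler_wpM2l// ler_wpM2l.
    by rewrite -[leRHS]mul1r ler_pM2r//; exact: d1D.
  lra.
Qed.

(** Translation by the quantised interference embeds the good v injectively into the good u, so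
    their guaranteed number does not depend on w. *)
Lemma good_u_count : exists N0, forall n, (N0 <= n)%N -> forall (c : 'I_n -> 'I_q) w,
  typ_w c w ->
  2^-1 * expR (n%:R * (2 * v * b%:R) - n%:R * d1 + n%:R * (b%:R * (2 * ln Z)))
    <= #|[pred u | good_u c w u]|%:R.
Proof.
have [N0 HN] := good_v_count; exists N0 => n hn c w tw; apply: le_trans (HN n hn c w tw) _.
pose sh (g : {ffun 'I_n -> Vl}) : {ffun 'I_n -> Ul} :=
  [ffun t => [ffun s => inord (g t s + qz (c t, w t, s))]].
(* The grid of u is wider by 2 [B2] points, so the sum of indices never overflows and [inord] is
   exact. *)
have shE g t s : sh g t s = (g t s + qz (c t, w t, s))%N :> nat.
  rewrite !ffunE inordK// ltnS mulnDr leq_add//; exact: (ltn_ord (g t s)).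
have shI : injective sh.
  move=> g g' e; apply/ffunP => t; apply/ffunP => s; apply: val_inj => /=.
  by apply/eqP; rewrite -(eqn_add2r (qz (c t, w t, s))) -!shE e.
rewrite ler_nat -(fintype.card_image shI).
apply: subset_leq_card; apply/fintype.subsetP => u /fintype.imageP[g hg ->].
move: hg; rewrite !inE /good_u.
suff -> : vseq c w (sh g) = fun t => vvec (g t) by [].
apply/funext => t; apply/matrixP => j k; rewrite mx_subE !mxE /cletter /gval.
by rewrite !shE !natrD; apply/eqP; rewrite eq_complex /=; apply/andP; split; apply/eqP; ring.
Qed.

Definition enc_p n (c : 'I_n -> 'I_q) (w : {ffun 'I_n -> Wl}) : 'M[C]_(npt, n) :=
  \matrix_(r, t) (mFp (md (c t)) *m wvec (w t)) r 0.
Definition enc_c n (c : 'I_n -> 'I_q) (w : {ffun 'I_n -> Wl}) (u : {ffun 'I_n -> Ul}) :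
    'M[C]_(nct, n) :=
  \matrix_(r, t) (mFcw (md (c t)) *m wvec (w t) + mFcv (md (c t)) *m vseq c w u t) r 0.
Definition clean_p n (c : 'I_n -> 'I_q) w u := Hpp *m enc_p c w + Hcp *m enc_c c w u.
Definition clean_c n (c : 'I_n -> 'I_q) w u := Hpc *m enc_p c w + Hcc *m enc_c c w u.
(** The third d1, here and in [thr_c], is the allowance for the noise. *)
Definition thr_p n : R := n%:R * (a%:R + 2 * a%:R * d1 + 3 * d1).
Definition thr_c n : R := n%:R * (b%:R + 2 * b%:R * d1 + 3 * d1).

Lemma col_enc n (c : 'I_n -> 'I_q) w u t r (A : 'M[C]_(r, npt)) (A' : 'M[C]_(r, nct)) :
  col t (A *m enc_p c w + A' *m enc_c c w u) = A *m (mFp (md (c t)) *m wvec (w t)) +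
    A' *m (mFcw (md (c t)) *m wvec (w t) + mFcv (md (c t)) *m vseq c w u t).
Proof.
have colM k (X : 'M[C]_(r, k)) (Y : 'M[C]_(k, n)) : col t (X *m Y) = X *m col t Y.
  by rewrite !colE mulmxA.
have Ep : col t (enc_p c w) = mFp (md (c t)) *m wvec (w t).
  by apply/matrixP => i j; rewrite mxE [LHS]mxE !ord1.
have Ec : col t (enc_c c w u) = mFcw (md (c t)) *m wvec (w t) + mFcv (md (c t)) *m vseq c w u t.
  by apply/matrixP => i j; rewrite mxE [LHS]mxE !ord1.
by rewrite linearD /= 2!colM Ep Ec.
Qed.

Lemma noise_p_ok (eps : R) : 0 < eps -> exists N0, forall n, (N0 <= n)%N ->
  forall (c : 'I_n -> 'I_q) (I : finType) (f : I -> {ffun 'I_n -> Wl}) i u,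
  good_u c (f i) u ->
  (gauss_prob R (npr * n + npr * n) [set z | ~~ near_word (fun t => mdp (md (c t)))
     (fun t => mKp (md (c t))) (fun i t j => cletter val (f i t) j) (thr_p n) i
     (clean_p c (f i) u + noise_mx z)]%R <= eps%:E)%E.
Proof.
move=> eps0.
have [N0 HN] := @state_near_word R ('I_q * Wl * Ul)%type a npr (fun s => mdp (md s.1.1))
  (fun s j => (wres s.1.1 *m wvec s.1.2 - vleak s.1.1 *m (uvec s.2 - qvec s.1.1 s.1.2)) j 0)
  (fun s => mKp (md s.1.1)) d1 eps (fun s j => dp_ge0 s.1.1 j) d10 eps0.
exists N0 => n hn c I f i u /and3P[_ gp _].
apply: (HN n hn (fun t => (c t, f i t, u t))) => /=.
  move=> t j; rewrite col_enc /wres /vleak -/(vseq c (f i) u t).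
  have -> : cletter val (f i t) j = (wvec (f i t)) j 0 by rewrite mxE.
  rewrite -mx_subE; congr (fun_of_matrix _ _ _).
  by move: (vseq _ _ _ _) => V; rewrite mulmxBl mul1mx !(mulmxDr, mulmxDl, mulmxA) !opprD !addrA.
apply: le_trans (_ : n%:R * (a%:R + 2 * a%:R * d1 + 2 * d1) + n%:R * d1 <= _).
  by rewrite lerD2r.
by rewrite /thr_p -mulrDr; lra.
Qed.

Lemma noise_c_ok (eps : R) : 0 < eps -> exists N0, forall n, (N0 <= n)%N ->
  forall (c : 'I_n -> 'I_q) w (I : finType) (f : I -> {ffun 'I_n -> Ul}) i,
  good_u c w (f i) ->
  (gauss_prob R (ncr * n + ncr * n) [set z | ~~ near_word (fun t => mdc (md (c t)))
     (fun t => mKc (md (c t))) (fun i t j => cletter valU (f i t) j) (thr_c n) i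
     (clean_c c w (f i) + noise_mx z)]%R <= eps%:E)%E.
Proof.
move=> eps0.
have [N0 HN] := @state_near_word R ('I_q * Wl * Ul)%type b ncr (fun s => mdc (md s.1.1))
  (fun s j => ((qvec s.1.1 s.1.2 - wshift s.1.1 *m wvec s.1.2)
     + vres s.1.1 *m (uvec s.2 - qvec s.1.1 s.1.2)) j 0)
  (fun s => mKc (md s.1.1)) d1 eps (fun s j => dc_ge0 s.1.1 j) d10 eps0.
exists N0 => n hn c w I f i /and3P[_ _ gc].
apply: (HN n hn (fun t => (c t, w t, f i t))) => /=.
  move=> t j; rewrite col_enc /vres /wshift -/(vseq c w (f i) t).
  have -> : cletter valU (f i t) j = (vseq c w (f i) t + qvec (c t) (w t)) j 0.
    by rewrite subrK mxE.
  rewrite -mx_subE; congr (fun_of_matrix _ _ _).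
  move: (vseq _ _ _ _) => V; rewrite mulmxBl mul1mx !(mulmxDr, mulmxDl, mulmxA) !opprD.
  rewrite [V + _]addrC -!addrA; congr (_ + _).
  by rewrite [LHS]addrCA; congr (_ + _); exact: addrCA.
apply: le_trans (_ : n%:R * (b%:R + 2 * b%:R * d1 + 2 * d1) + n%:R * d1 <= _).
  by rewrite lerD2r.
by rewrite /thr_c -mulrDr; lra.
Qed.

(** Half of eps goes to the noise pushing the sent word out of its ellipsoid, half to the
    random-coding cost. *)
Lemma codes_exist (eps : R) : 0 < eps -> exists N0, forall n, (N0 <= n)%N ->
  forall (c : 'I_n -> 'I_q) Mp Mc, (0 < Mp)%N -> (0 < Mc)%N ->
  (Mp = 1)%N \/ ln Mp%:R <= \sum_t \sum_j ln (mdp (md (c t)) j) - n%:R * del ->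
  (Mc = 1)%N \/ ln Mc%:R <= \sum_t \sum_j ln (mdc (md (c t)) j) - n%:R * del ->
  bounded_code Hpp Hcp Hpc Hcc n Mp Mc (n%:R * ((1 + del) * Pp)) (n%:R * ((1 + del) * Pc)) eps.
Proof.
move=> eps0.
have split_eps : eps / 16 + 2 * (eps / 16) + 2 * (eps / 16) <= eps / 2 by lra.
have eps2 : 0 < eps / 2 by rewrite divr_gt0.
have eps16 : 0 < eps / 16 by rewrite divr_gt0.
have [N1 HW] := typ_w_count.
have [N2 HU] := good_u_count.
have [N3 HP] := noise_p_ok eps2.
have [N4 HC] := noise_c_ok eps2.
have del2 : 0 < del / 2 by rewrite divr_gt0.
have [N5 H5] := expR_decay del2 eps16.
have [N6 H6] := expR_decay (@ltr01 R) eps16.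
exists (maxn 1 (maxn (maxn N1 N2) (maxn (maxn N3 N4) (maxn N5 N6)))) => n.
rewrite !geq_max => /and3P[n0 /andP[n1 n2] /andP[/andP[n3 n4] /andP[n5 n6]]].
move=> c Mp Mc Mp0 Mc0 hMp hMc.
pose W := {w : {ffun 'I_n -> Wl} | typ_w c w}.
pose U := {ffun 'I_n -> Ul}.
pose GW := 2^-1 * expR (n%:R * (2 * v * a%:R) - n%:R * d1 + n%:R * (a%:R * (2 * ln Z))).
pose GU := 2^-1 * expR (n%:R * (2 * v * b%:R) - n%:R * d1 + n%:R * (b%:R * (2 * ln Z))).
have GW0 : 0 < GW by rewrite mulr_gt0 ?invr_gt0 ?expR_gt0.
have GU0 : 0 < GU by rewrite mulr_gt0 ?invr_gt0 ?expR_gt0.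
have hGW : GW <= #|{: W}|%:R by rewrite card_sig; exact: HW.
have W0 : (0 < #|{: W}|)%N by rewrite -(@ltr0n R); exact: lt_le_trans hGW.
have hgood (w : W) : GU <= #|[pred u : U | good_u c (sval w) u]|%:R.
  exact: (HU n n2 c _ (svalP w)).
have hGU : GU <= #|{: U}|%:R.
  apply: le_trans (hgood (enum_val (Ordinal W0))) _; rewrite ler_nat; exact: max_card.
have U0 : (0 < #|{: U}|)%N by rewrite -(@ltr0n R); exact: lt_le_trans hGU.
have U0R : 0 < #|{: U}|%:R :> R by rewrite ltr0n.
pose Np := expR (thr_p n + \sum_t \sum_j (2 * d1 + ln pi - ln (mdp (md (c t)) j) - 2 * ln eta)).
pose Nc := expR (thr_c n + \sum_t \sum_j (2 * d1 + ln pi - ln (mdc (md (c t)) j) - 2 * ln eta)).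
pose L := (Num.truncn (n%:R * #|{: U}|%:R / GU)).+1.
have hge (w : W) : GU / #|{: U}|%:R * #|{: U}|%:R <= #|[pred u : U | good_u c (sval w) u]|%:R.
  by rewrite divfK ?gt_eqF.
have dpD t j : 0 < mdp (md (c t)) j <= D.
  rewrite (lt_le_trans ltr01 (dp_ge1 _ _)) /=; apply: le_trans (sumdp_le (c t)).
  exact: (term_le_sum j (dp_ge0 (c t))).
have dcD t j : 0 < mdc (md (c t)) j <= D.
  rewrite (lt_le_trans ltr01 (dc_ge1 _ _)) /=; apply: le_trans (sumdc_le (c t)).
  exact: (term_le_sum j (dc_ge0 (c t))).
have hNp cl : \sum_(w : W) fine (gauss_prob R (npr * n + npr * n) [set z |
    near_word (fun t => mdp (md (c t))) (fun t => mKp (md (c t)))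
      (fun (w : W) t j => cletter val (sval w t) j) (thr_p n) w (cl + noise_mx z)]) <= Np.
  exact: (@near_word_sum_le R n a npr _ B eta d1 D (thr_p n) (fun t => mdp (md (c t))) W sval
    (fun t => mKp (md (c t))) cl val_inj eta0 grid_le dpD).
have hNc cl : \sum_(u : U) fine (gauss_prob R (ncr * n + ncr * n) [set z |
    near_word (fun t => mdc (md (c t))) (fun t => mKc (md (c t)))
      (fun (u : U) t j => cletter valU (u t) j) (thr_c n) u (cl + noise_mx z)]) <= Nc.
  exact: (@near_word_sum_le R n b ncr _ (B + B2) eta d1 D (thr_c n) (fun t => mdc (md (c t))) U id
    (fun t => mKc (md (c t))) cl (@inj_id U) eta0 grid_le dcD).
have hcost : (1 - GU / #|{: U}|%:R) ^+ L + Mp.-1%:R * (Np / #|{: W}|%:R)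
    + (Mc.-1 * L)%:R * (Nc / #|{: U}|%:R) <= eps / 2.
  have le_succ x : expR x <= n.+1%:R * expR x :> R.
    by rewrite ler_peMl ?expR_ge0// ler1n.
  have b1 : (1 - GU / #|{: U}|%:R) ^+ L <= eps / 16.
    apply: le_trans (covering_le GU0 hGU n0) _; apply: le_trans (H6 n n6).
    by rewrite mulr1; exact: le_succ.
  have b2 : Mp.-1%:R * (Np / #|{: W}|%:R) <= 2 * (eps / 16).
    apply: (@le_trans _ _ (Mp.-1%:R * (2 * expR (n%:R * (d1 * (8 * a%:R + 4))
        - \sum_t \sum_j ln (mdp (md (c t)) j))))).
      rewrite ler_wpM2l// ler_pdivrMr ?ltr0n//.
      apply: le_trans (count_ratio _ eta0 Z0 Z_ge v_ge) _.
      by rewrite ler_wpM2l// mulr_ge0 ?expR_ge0.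
    apply: le_trans (rate_cost Mp0 hMp d1a) _; rewrite ler_wpM2l//.
    exact: le_trans (le_succ _) (H5 n n5).
  have b3 : (Mc.-1 * L)%:R * (Nc / #|{: U}|%:R) <= 2 * (eps / 16).
    apply: (@le_trans _ _ (n.+1%:R * (Mc.-1%:R * (2 * expR (n%:R * (d1 * (8 * b%:R + 4))
        - \sum_t \sum_j ln (mdc (md (c t)) j)))))).
      rewrite natrM [leRHS]mulrCA -mulrA ler_wpM2l//.
      (* The bin size brings a factor |U|/GU, and |U| cancels: what remains is Nc/GU, as if there
         were no interference, up to the factor n + 1. *)
      apply: le_trans (ler_wpM2r _ (covering_size n GU0 hGU)) _.
        by rewrite divr_ge0 ?expR_ge0.
      rewrite -[leLHS]mulrA ler_wpM2l// [leLHS]mulrC [leLHS]mulrA divfK ?gt_eqF// ler_pdivrMr//.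
      exact: (count_ratio _ eta0 Z0 Z_ge v_ge).
    apply: le_trans (ler_wpM2l _ (rate_cost Mc0 hMc d1b)) _ => //.
    by rewrite mulrCA ler_wpM2l//; exact: H5.
  exact: le_trans (lerD (lerD b1 b2) b3) split_eps.
have [Ep [Ec [Dp [Dc [hEp hEc mD eP eC]]]]] := code_from_typical_words
  (good := fun (w : W) (u : U) => good_u c (sval w) u) (encp := fun w : W => enc_p c (sval w))
  (encc := fun w u => enc_c c (sval w) u) (e := eps / 2)
  (fun w u => HP n n3 c W sval w u) (fun w u => HC n n4 c (sval w) U id u)
  hNp hNc W0 U0 hge (ltW eps2) (expR_ge0 _) (expR_ge0 _) Mp0 Mc0 hcost.
exists Ep, Ec, Dp, Dc; split=> //.
- move=> mp; have [w ->] := hEp mp; have /and3P[hw _ _] := svalP w.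
  rewrite /frob exchange_big; under eq_bigr do under eq_bigr do rewrite mxE; exact: hw.
- move=> mp mc; have [->|[w [u [/and3P[gu _ _] ->]]]] := hEc mp mc.
    rewrite /frob big1 => [|i _]; last by rewrite big1// => j _; rewrite mxE nsq0.
    by rewrite !mulr_ge0// addr_ge0// ltW.
  rewrite /frob exchange_big; under eq_bigr do under eq_bigr do rewrite mxE; exact: gu.
- by move: eP; rewrite -splitr.
- by move: eC; rewrite -splitr.
Qed.

End CodeConstruction.

Section ModeCodes.
Variable R : realType.
Local Notation C := R[i].

Lemma grid_law_mean (eta : R) B :
  \sum_(i < (2 * B).+1) expR (- gval B eta i ^+ 2) * gval B eta i = 0.
Proof.
set S := \sum_(i < _) _.
suff : S = - S by lra.
rewrite {1}/S (reindex_inj rev_ord_inj) /= -sumrN; apply: eq_bigr => i _.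
have -> : gval B eta (rev_ord i) = - gval B eta i.
  have iB : (i <= 2 * B)%N by rewrite -ltnS.
  by rewrite /gval /= subSS natrB// natrM; ring.
by rewrite sqrrN mulrN.
Qed.

Variables (npt nct npr ncr : nat).
Variables (Hpp : 'M[C]_(npr, npt)) (Hcp : 'M[C]_(npr, nct)).
Variables (Hpc : 'M[C]_(ncr, npt)) (Hcc : 'M[C]_(ncr, nct)).

Lemma mode_codes (a b q : nat) (md : 'I_q -> mode R npt nct npr ncr a b) (Pp Pc del eps : R) :
  (forall i, mode_ok Hpp Hcp Hcc Pp Pc (md i)) -> 0 <= Pp -> 0 <= Pc -> 0 < del -> 0 < eps ->
  exists N0, forall n, (N0 <= n)%N ->
  forall (c : 'I_n -> 'I_q) Mp Mc, (0 < Mp)%N -> (0 < Mc)%N ->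
  (Mp = 1)%N \/ ln Mp%:R <= \sum_t \sum_j ln (mdp (md (c t)) j) - n%:R * del ->
  (Mc = 1)%N \/ ln Mc%:R <= \sum_t \sum_j ln (mdc (md (c t)) j) - n%:R * del ->
  bounded_code Hpp Hcp Hpc Hcc n Mp Mc (n%:R * ((1 + del) * Pp)) (n%:R * ((1 + del) * Pc)) eps.
Proof.
move=> okm Pp0 Pc0 del0 eps0.
have dp0 i j : 0 <= mdp (md i) j by have [[h _ _ _] _] := okm i; exact: le_trans (h j).
have dc0 i j : 0 <= mdc (md i) j by have [[_ h _ _] _] := okm i; exact: le_trans (h j).
(* D dominates all weights of all modes; the 2 leaves room for the exponential moments that control
   the grid variance. *)
pose D := 2 + (\sum_i \sum_j mdp (md i) j + \sum_i \sum_j mdc (md i) j).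
have S1 : 0 <= \sum_i \sum_j mdp (md i) j by apply: sumr_ge0 => i _; apply: sumr_ge0.
have S2 : 0 <= \sum_i \sum_j mdc (md i) j by apply: sumr_ge0 => i _; apply: sumr_ge0.
have D2 : 2 <= D by rewrite /D lerDl addr_ge0.
have D0 : 0 < 2 * D by rewrite mulr_gt0//; apply: lt_le_trans D2.
have sumdp i : \sum_j mdp (md i) j <= D.
  apply: le_trans (_ : \sum_i \sum_j mdp (md i) j <= _); last by rewrite /D; lra.
  by apply: (@term_le_sum _ _ (fun i => \sum_j mdp (md i) j)) => i'; apply: sumr_ge0.
have sumdc i : \sum_j mdc (md i) j <= D.
  apply: le_trans (_ : \sum_i \sum_j mdc (md i) j <= _); last by rewrite /D; lra.
  by apply: (@term_le_sum _ _ (fun i => \sum_j mdc (md i) j)) => i'; apply: sumr_ge0.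
have ka k : (0 : R) < 8 * k%:R + 4 by rewrite ltr_wpDl// mulr_ge0.
pose d1 := Num.min (del / 4) (Num.min (1 / (2 * D))
  (Num.min (del / 2 / (8 * a%:R + 4)) (del / 2 / (8 * b%:R + 4)))).
have d10 : 0 < d1 by rewrite !lt_min !divr_gt0.
have d1del : d1 <= del / 4 by rewrite ge_min lexx.
have d1D : d1 * (2 * D) <= 1 by rewrite -ler_pdivlMr// !ge_min lexx orbT.
have d1a : d1 * (8 * a%:R + 4) <= del / 2 by rewrite -ler_pdivlMr// !ge_min lexx !orbT.
have d1b : d1 * (8 * b%:R + 4) <= del / 2 by rewrite -ler_pdivlMr// !ge_min lexx !orbT.
have [eta [B [/andP[eta0 eta_le] Zge /andP[v_ge v_le] grid]]] := ex_grid d10 D2.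
pose Z := \sum_(i < (2 * B).+1) expR (- gval B eta i ^+ 2).
pose v := (\sum_(i < (2 * B).+1) gval B eta i ^+ 2 * expR (- gval B eta i ^+ 2)) / Z.
have Z0 : 0 < Z.
  rewrite /Z (bigD1 ord0)//= ltr_pwDl ?expR_gt0//; apply: sumr_ge0 => i _; exact: expR_ge0.
have [B2 [qz hqz]] := @ex_quantizer R
  ('I_q * {ffun 'I_a * bool -> 'I_(2 * B).+1} * ('I_b * bool))%type
  (fun s => cpart s.2.2 ((wshift Hpc Hcc md s.1.1 *m wvec eta s.1.2) s.2.1 0)) eta eta0.
apply: (@codes_exist R npt nct npr ncr Hpp Hcp Hpc Hcc a b q md Pp Pc del d1 D eta Z v B B2 qz)
  => //.
- by rewrite -mulr_suml divff// gt_eqF.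
- by under eq_bigr do rewrite mulrAC; rewrite -mulr_suml grid_law_mean mul0r.
- by rewrite /v mulr_suml; apply: eq_bigr => i _; rewrite mulrAC [_ * expR _]mulrC.
- by move=> s; have [] := hqz s.
- by move=> i x j bb; have [_] := hqz (i, x, (j, bb)).
Qed.
End ModeCodes.

(** * Power, time sharing and the closure *)

Section Assembly.
Variable R : realType.
Local Notation C := R[i].

Lemma sum_sqr_centered_le (I : finType) (f : I -> R) :
  \sum_x (f x - #|I|%:R^-1 * \sum_y f y) ^+ 2 <= \sum_x f x ^+ 2.
Proof.
have [I0|I0] := posnP #|I|.
  by rewrite !big1// => x; have := card0_eq I0 x; rewrite inE.
set m := _^-1 * _.
have e : \sum_y f y = #|I|%:R * m by rewrite mulrA divff ?mul1r// pnatr_eq0 -lt0n.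
have -> : \sum_x (f x - m) ^+ 2 = \sum_x f x ^+ 2 - #|I|%:R * m ^+ 2.
  have -> : \sum_x (f x - m) ^+ 2 = \sum_x f x ^+ 2 - 2 * m * \sum_x f x + \sum_(x : I) m ^+ 2.
    rewrite mulr_sumr -sumrN -!big_split /=; apply: eq_bigr => x _; ring.
  by rewrite sum_cst e; ring.
by rewrite gerBl mulr_ge0 ?sqr_ge0.
Qed.

Lemma sum_nsq_centered_le (I : finType) (f : I -> C) :
  \sum_x nsq (f x - #|I|%:R^-1 * \sum_y f y) <= \sum_x nsq (f x).
Proof.
have part bb x : cpart bb (f x - #|I|%:R^-1 * \sum_y f y) =
    cpart bb (f x) - #|I|%:R^-1 * \sum_y cpart bb (f y).
  rewrite cpartB -cpart_sum; congr (_ - _).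
  have -> : #|I|%:R^-1 = (#|I|%:R^-1 : R)%:C by rewrite fmorphV rmorph_nat.
  by case: (\sum_y f y) => u v; case: bb => /=; ring.
under eq_bigr do rewrite nsqE. under [leRHS]eq_bigr do rewrite nsqE.
rewrite exchange_big [leRHS]exchange_big; apply: ler_sum => bb _.
under eq_bigr do rewrite part; exact: sum_sqr_centered_le.
Qed.

Lemma Re_cov_trace (I : finType) m n (X : I -> 'M[C]_(m, n)) t :
  complex.Re (\tr (cov_at X t)) =
  #|I|%:R^-1 * \sum_x \sum_j nsq (X x j t - #|I|%:R^-1 * \sum_y X y j t).
Proof.
rewrite /cov_at /avg linearZ /= linear_sum /=.
under eq_bigr do rewrite trace_mulmx_ctr.
rewrite -rmorph_sum.
have -> : #|I|%:R^-1 = (#|I|%:R^-1 : R)%:C by rewrite fmorphV rmorph_nat.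
rewrite -rmorphM /=; congr (_ * _); apply: eq_bigr => x _; rewrite /frob.
apply: eq_bigr => j _; rewrite big_ord_recl big_ord0 addr0 mx_subE mx_scaleE summxE mxE.
by congr (nsq (_ - _ * _)); apply: eq_bigr => y _; rewrite mxE.
Qed.

Lemma power_ok_of_avg (I : finType) m n (X : I -> 'M[C]_(m, n)) (P : R) : (0 < #|I|)%N ->
  \sum_x frob (X x) <= #|I|%:R * (n%:R * P) -> power_ok X P.
Proof.
move=> I0 h; rewrite /power_ok raddf_sum /=.
under eq_bigr do rewrite Re_cov_trace.
rewrite -mulr_sumr ler_pdivrMl ?ltr0n//; apply: le_trans h.
rewrite exchange_big; apply: (@le_trans _ _ (\sum_x \sum_t \sum_j nsq (X x j t))); last first.
  by apply: ler_sum => x _; rewrite /frob exchange_big.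
rewrite exchange_big [leRHS]exchange_big; apply: ler_sum => t _.
rewrite exchange_big [leRHS]exchange_big; apply: ler_sum => j _.
exact: sum_nsq_centered_le.
Qed.

(** Power is measured by covariances, and a deterministic signal has none. *)
Lemma power_ok_single (I : finType) m n (X : I -> 'M[C]_(m, n)) (P : R) :
  #|I| = 1%N -> 0 <= P -> power_ok X P.
Proof.
move=> I1 P0; have [x0 hx0] := fintype1 I1.
have sum1 (V : nmodType) (F : I -> V) : \sum_y F y = F x0.
  by rewrite (bigD1 x0)//= big1 ?addr0// => y; rewrite (hx0 y) eqxx.
rewrite /power_ok raddf_sum /= big1 ?mulr_ge0// => t _.
rewrite Re_cov_trace sum1 big1 ?mulr0// => j _.
by rewrite sum1 I1 invr1 mul1r subrr nsq0.
Qed.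

(** Message pairs whose signal is changed are counted as errors with probability 1; all others keep
    their error probability, since the decoder is the same. *)
Lemma err_prob_thin k n Mp Mc M (clean clean' : 'I_Mp -> 'I_Mc -> 'M[C]_(k, n))
    (D : 'M[C]_(k, n) -> 'I_M) (target : 'I_Mp -> 'I_Mc -> 'I_M) (act : 'I_Mp -> 'I_Mc -> bool)
    (e f : R) : (0 < Mp * Mc)%N -> shift_measurable D ->
  (forall mp mc, act mp mc -> clean' mp mc = clean mp mc) ->
  \sum_mp \sum_mc (~~ act mp mc)%:R <= (Mp * Mc)%:R * f ->
  (err_prob clean D target <= e%:E)%E -> (err_prob clean' D target <= (e + f)%:E)%E.
Proof.
move=> M0 mD hcl hact herr.
pose pr mp mc cl := fine (gauss_prob R (k * n + k * n)
  [set z | D (cl + noise_mx z) != target mp mc]).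
have prE mp mc cl : gauss_tuple [set z | D (cl + noise_mx z) != target mp mc] =
    (pr mp mc cl)%:E.
  have mE : measurable [set z | D (cl + noise_mx z) != target mp mc].
    exact: (mD (predC1 (target mp mc)) cl).
  by rewrite gauss_tupleE// fineK//; exact: fin_num_measure.
have pr_le1 mp mc cl : pr mp mc cl <= 1.
  rewrite -lee_fin -prE gauss_tupleE; first apply: probability_le1.
    exact: (mD (predC1 (target mp mc)) cl).
  exact: (mD (predC1 (target mp mc)) cl).
have pr_ge0 mp mc cl : 0 <= pr mp mc cl by exact: fine_ge0.
have M0R : (0 : R) < (Mp * Mc)%:R by rewrite ltr0n.
apply: (err_prob_le (f := fun mp mc => pr mp mc (clean mp mc) + (~~ act mp mc)%:R)) => //.
  move=> mp mc; rewrite prE lee_fin; case: (boolP (act mp mc)) => [/hcl ->|_].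
    by rewrite addr0.
  by rewrite (le_trans (pr_le1 _ _ _))// lerDr.
under eq_bigr do rewrite big_split.
rewrite big_split /= mulrDr lerD//.
move: herr; rewrite /err_prob.
have -> : (\sum_mp \sum_mc
    gauss_tuple [set z | D (clean mp mc + noise_mx z)%R != target mp mc] =
    (\sum_mp \sum_mc pr mp mc (clean mp mc))%:E)%E.
  rewrite -sumEFin; apply: eq_bigr => mp _; rewrite -sumEFin; apply: eq_bigr => mc _.
  exact: prE.
by rewrite -EFinM lee_fin ler_pdivrMl.
Qed.

Lemma sum_ord_lt M A : (A <= M)%N -> \sum_(i < M) ((i < A)%N%:R : R) = A%:R.
Proof.
move=> AM; transitivity (\sum_(i < A) (1 : R)); last by rewrite sum_cst card_ord mulr1.
rewrite (big_ord_widen M (fun=> 1 : R))// [RHS]big_mkcond; apply: eq_bigr => i _.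
by case: ifP.
Qed.

Lemma sum_ord_nlt M A : (A <= M)%N -> \sum_(i < M) ((~~ (i < A)%N)%:R : R) = M%:R - A%:R.
Proof.
move=> AM; rewrite -(sum_ord_lt AM); apply/eqP; rewrite -subr_eq opprK -big_split /=; apply/eqP.
rewrite (eq_bigr (fun=> 1)) ?sum_cst ?card_ord ?mulr1// => i _.
by case: (i < A)%N; rewrite ?addr0 ?add0r.
Qed.

(** Option i occupies the integer part of n lam_i time slots. Rounding loses less than one slot per
    option, which the subtracted sum covers; the leftover slots go to a default option and their
    contribution is dropped. *)
Lemma time_sharing k (lam : 'I_k -> R) n : (forall i, 0 <= lam i) -> \sum_i lam i = 1 ->
  exists c : 'I_n -> 'I_k, forall r : 'I_k -> R, (forall i, 0 <= r i) ->
  n%:R * (\sum_i lam i * r i) - \sum_i r i <= \sum_t r (c t).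
Proof.
move=> lam0 lam1.
pose N i := Num.truncn (lam i * n%:R).
have Nle i : (N i)%:R <= lam i * n%:R by rewrite truncn_le mulr_ge0.
have Nge i : lam i * n%:R - 1 <= (N i)%:R.
  by rewrite lerBlDr natr1; apply/ltW; exact: truncnS_gt.
have Nn : (\sum_i N i <= n)%N.
  rewrite -(@ler_nat R) natr_sum; apply: le_trans (ler_sum _ (fun i _ => Nle i)) _.
  by rewrite -mulr_suml lam1 mul1r.
have [i0 _] : exists i0 : 'I_k, True.
  case: k lam lam0 lam1 N Nle Nge Nn => [lam _|k]; last by exists ord0.
  by rewrite big_ord0 => /eqP; rewrite eq_sym oner_eq0.
pose s := flatten [seq nseq (N i) i | i <- enum 'I_k].
have ss : size s = (\sum_i N i)%N.
  rewrite size_flatten /shape -map_comp sumnE big_map big_enum /=.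
  by apply: eq_bigr => i _; rewrite size_nseq.
exists (fun t => nth i0 s t) => r r0.
have rs : \sum_(x <- s) r x = \sum_i (N i)%:R * r i.
  rewrite big_flatten big_map big_enum /=; apply: eq_bigr => i _.
  by rewrite big_nseq iter_addr addr0 mulr_natl.
apply: (@le_trans _ _ (\sum_i (N i)%:R * r i)).
  rewrite mulr_sumr -sumrB; apply: ler_sum => i _.
  rewrite mulrCA mulrA -[X in _ - X]mul1r -mulrBl ler_wpM2r//; exact: Nge.
rewrite -rs (big_nth i0) big_mkord ss (big_ord_widen n (fun t => r (nth i0 s t)))//.
by rewrite big_mkcond; apply: ler_sum => t _; case: ifP.
Qed.

Lemma closure_near (S : set (R * R)) z : closure (S : set (R^o * R^o)) z ->
  forall e : R, 0 < e -> exists z', [/\ S z', `|z.1 - z'.1| < e & `|z.2 - z'.2| < e].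
Proof.
move=> cz e e0; have [z' [Sz' [h1 h2]]] := cz _ (nbhsx_ballx z e e0).
by exists z'; split.
Qed.

Lemma ln_ceil_pow2_le (x : R) : 0 <= x ->
  ln ((Num.truncn (2 `^ x)).+1%:R : R) <= (x + 1) * ln 2.
Proof.
move=> x0; rewrite -ln_powR ler_ln ?posrE ?ltr0n ?powR_gt0// powRD; last first.
  by apply/implyP => _; rewrite pnatr_eq0.
have h1 : 1 <= 2 `^ x :> R by rewrite -[leLHS](powRr0 2) ler_powR// ler1n.
rewrite powRr1// -natr1.
have : (Num.truncn (2 `^ x))%:R <= 2 `^ x :> R by rewrite truncn_le powR_ge0.
lra.
Qed.
End Assembly.

Section Achievability.
Variable R : realType.
Local Notation C := R[i].

(** How the relative gain gam is spent: half on the distance from z to a point x of the hull, a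
    quarter on the coding margin del, a quarter on the constants Cr and ln 2 divided by n. *)
Lemma boosted_rate (gam z x del Cr S : R) n : 0 < gam -> 0 < z ->
  `|z - x| < gam * z / (2 * (1 + gam)) -> del <= gam * z * ln 2 / 4 ->
  (Cr + ln 2) / n%:R <= gam * z * ln 2 / 4 -> (0 < n)%N ->
  n%:R * ((1 + gam) * (x * ln 2)) - Cr <= S -> (n%:R * z + 1) * ln 2 <= S - n%:R * del.
Proof.
move=> g0 z0 hx hdel hn n0 hS.
have l0 : 0 < ln 2 :> R by rewrite ln_gt0// ltr1n.
have nR : 0 < n%:R :> R by rewrite ltr0n.
have g2 : 0 < 2 * (1 + gam) by lra.
have hx' : (1 + gam / 2) * z <= (1 + gam) * x.
  by move: hx; rewrite ltr_norml => /andP[_]; rewrite ltr_pdivlMr//; lra.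
have h1 : n%:R * ln 2 * ((1 + gam / 2) * z) <= n%:R * ln 2 * ((1 + gam) * x).
  by rewrite ler_wpM2l// ltW// mulr_gt0.
have h2 : Cr + ln 2 <= n%:R * (gam * z * ln 2 / 4) by rewrite mulrC -ler_pdivrMr.
have h3 : n%:R * del <= n%:R * (gam * z * ln 2 / 4) by rewrite ler_wpM2l// ltW.
lra.
Qed.

(** A is the integer part of M/S: a share 1 - 1/S of the messages is lost on purpose and less than
    one more by rounding, which is negligible once M is large. *)
Lemma thin_count (S f : R) M : 1 <= S -> 1 - S^-1 <= f / 2 -> 0 < f -> 2 / f <= M%:R ->
  exists A : nat, [/\ (A <= M)%N, A%:R * S <= M%:R & M%:R - A%:R <= M%:R * f].
Proof.
move=> S1 hS f0 hM; have S0 : 0 < S by lra.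
exists (Num.truncn (M%:R / S)).
have MS : 0 <= M%:R / S by rewrite divr_ge0// ltW.
have t1 : (Num.truncn (M%:R / S))%:R <= M%:R / S by rewrite truncn_le.
have t2 : M%:R / S < (Num.truncn (M%:R / S))%:R + 1 by rewrite natr1 truncnS_gt.
have MM : M%:R / S <= M%:R by rewrite ler_pdivrMr// ler_peMr.
split; first by rewrite -(@ler_nat R); exact: le_trans MM.
  by rewrite -ler_pdivlMr.
have h1 : M%:R * (1 - S^-1) <= M%:R * (f / 2) by rewrite ler_wpM2l.
have h2 : 1 <= M%:R * (f / 2) by move: hM; rewrite ler_pdivrMr//; lra.
lra.
Qed.

Lemma power_ok_thin (I : finType) m n (X : I -> 'M[C]_(m, n)) (act : I -> bool) (P S : R) :
  (0 < #|I|)%N -> 0 <= P -> (forall x, frob (X x) <= n%:R * (S * P)) ->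
  (\sum_x (act x)%:R) * S <= #|I|%:R -> power_ok (fun x => if act x then X x else 0) P.
Proof.
move=> I0 P0 hX hA; apply: power_ok_of_avg => //.
apply: (@le_trans _ _ (\sum_x (act x)%:R * (n%:R * (S * P)))).
  apply: ler_sum => x _; case: (act x); first by rewrite mul1r.
  by rewrite mul0r /frob big1// => i _; rewrite big1// => j _; rewrite mxE nsq0.
rewrite -mulr_suml (_ : n%:R * (S * P) = S * (n%:R * P)); last by ring.
by rewrite mulrA ler_wpM2r// mulr_ge0.
Qed.

Variables (npt nct npr ncr : nat).
Variables (Hpp : 'M[C]_(npr, npt)) (Hcp : 'M[C]_(npr, nct)).
Variables (Hpc : 'M[C]_(ncr, npt)) (Hcc : 'M[C]_(ncr, nct)).
Variables (Pp Pc : R).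

Lemma hull_power_ge0 z : conv_hull2 (Rach_rates Hpp Hcp Hcc Pp Pc) z -> 0 <= Pp /\ 0 <= Pc.
Proof.
case=> -[|k] [lam [s [_ l1 hs _]]].
  by move: l1; rewrite big_ord0 => /eqP; rewrite eq_sym oner_eq0.
by have [m [_ _ _ []]] := Rach_mode (lexx 1) (hs ord0).
Qed.

(** Codes at the exact target rates with [s ^+ 3] times the power. The boost comes from the modes at
    power [s ^+ 2], and del <= s - 1 keeps the typicality slack within one more factor s. *)
Lemma region_codes z (s eps : R) : R_in Hpp Hcp Hcc Pp Pc z -> 1 < s -> 0 < eps ->
  [/\ 0 <= Pp, 0 <= Pc & exists N0, forall n, (N0 <= n)%N ->
  forall Mp Mc, (0 < Mp)%N -> (0 < Mc)%N ->
  (Mp = 1)%N \/ 0 < z.1 /\ ln Mp%:R <= (n%:R * z.1 + 1) * ln 2 ->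
  (Mc = 1)%N \/ 0 < z.2 /\ ln Mc%:R <= (n%:R * z.2 + 1) * ln 2 ->
  bounded_code Hpp Hcp Hpc Hcc n Mp Mc (n%:R * (s ^+ 3 * Pp)) (n%:R * (s ^+ 3 * Pc)) eps].
Proof.
move=> /closure_near zin s1 eps0.
have [z0 [hz0 _ _]] := zin 1 ltr01.
have [Pp0 Pc0] := hull_power_ge0 hz0; split=> //.
have l0 : 0 < ln 2 :> R by rewrite ln_gt0// ltr1n.
pose gam := (s - 1) / (1 + s * gain_bound Hpp Hcp Hcc Pp Pc).
have gb0 : 0 <= gain_bound Hpp Hcp Hcc Pp Pc.
  by rewrite /gain_bound addr_ge0// mulr_ge0 ?frob_ge0// addr_ge0.
have gam0 : 0 < gam.
  rewrite divr_gt0 ?subr_gt0// ltr_pwDl// mulr_ge0//; lra.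
(* A coordinate that is not positive uses a single message and needs no margin; the value 1 merely
   keeps the tolerances positive. *)
pose pos (x : R) := if 0 < x then x else 1.
have pos0 x : 0 < pos x by rewrite /pos; case: ifP.
have posE x : 0 < x -> pos x = x by rewrite /pos => ->.
pose del := Num.min (s - 1) (Num.min (gam * pos z.1 * ln 2 / 4) (gam * pos z.2 * ln 2 / 4)).
have kp0 x : 0 < gam * pos x * ln 2 / 4.
  by apply: divr_gt0 => //; apply: mulr_gt0 => //; apply: mulr_gt0.
have del0 : 0 < del by rewrite !lt_min subr_gt0 s1 !kp0.
pose e := Num.min (gam * pos z.1 / (2 * (1 + gam))) (gam * pos z.2 / (2 * (1 + gam))).
have ke0 x : 0 < gam * pos x / (2 * (1 + gam)).
  by apply: divr_gt0; apply: mulr_gt0 => //; exact: addr_gt0.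
have e0 : 0 < e by rewrite lt_min !ke0.
have [z' [[k [lam [pts [lam0 lam1 hpts z'E]]]] h1 h2]] := zin e e0.
have [md hmd] := fin_all_exists (fun i => Rach_mode (ltW s1) (hpts i)).
have okm i : mode_ok Hpp Hcp Hcc (s ^+ 2 * Pp) (s ^+ 2 * Pc) (md i) by have [] := hmd i.
have s2P P : 0 <= P -> 0 <= s ^+ 2 * P by move=> P0; rewrite mulr_ge0 ?sqr_ge0.
have [N1 H1] := @mode_codes R npt nct npr ncr Hpp Hcp Hpc Hcc _ _ k md _ _ del eps okm
  (s2P _ Pp0) (s2P _ Pc0) del0 eps0.
pose rp i := \sum_j ln (mdp (md i) j).
pose rc i := \sum_j ln (mdc (md i) j).
have rp0 i : 0 <= rp i.
  by apply: sumr_ge0 => j _; apply: ln_ge0; have [[]] := okm i.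
have rc0 i : 0 <= rc i.
  by apply: sumr_ge0 => j _; apply: ln_ge0; have [[]] := okm i.
have Cp0 : 0 <= \sum_i rp i + ln 2 by rewrite addr_ge0 ?(ltW l0)// sumr_ge0.
have Cc0 : 0 <= \sum_i rc i + ln 2 by rewrite addr_ge0 ?(ltW l0)// sumr_ge0.
have [N2 H2] := ex_inv_le Cp0 (kp0 z.1).
have [N3 H3] := ex_inv_le Cc0 (kp0 z.2).
exists (maxn N1 (maxn N2 N3)) => n; rewrite !geq_max => /and3P[n1 n2 n3] Mp Mc Mp0 Mc0 hMp hMc.
have [n0 hn2] := H2 n n2; have [_ hn3] := H3 n n3.
have del1 : del <= gam * pos z.1 * ln 2 / 4 by rewrite !ge_min lexx orbT.
have del2 : del <= gam * pos z.2 * ln 2 / 4 by rewrite !ge_min lexx !orbT.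
have {}h1 : `|z.1 - z'.1| < gam * pos z.1 / (2 * (1 + gam)).
  by apply: lt_le_trans h1 _; rewrite ge_min lexx.
have {}h2 : `|z.2 - z'.2| < gam * pos z.2 / (2 * (1 + gam)).
  by apply: lt_le_trans h2 _; rewrite ge_min lexx orbT.
have [c hc] := time_sharing n lam0 lam1.
have dels : 1 + del <= s by rewrite -lerBrDl ge_min lexx.
have [||Ep [Ec [Dp [Dc [hEp hEc mD eP eC]]]]] := H1 n n1 c Mp Mc Mp0 Mc0.
- case: hMp => [->|[z10 hMp]]; [by left|right; apply: le_trans hMp _].
  rewrite posE// in h1 del1 hn2; apply: (@boosted_rate gam z.1 z'.1 del (\sum_i rp i)) => //.
  apply: le_trans (hc rp rp0); rewrite lerD2r ler_wpM2l// z'E /= mulr_suml mulr_sumr.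
  apply: ler_sum => i _; have [_ hr _ _] := hmd i.
  by rewrite -mulrA mulrCA ler_wpM2l.
- case: hMc => [->|[z10 hMc]]; [by left|right; apply: le_trans hMc _].
  rewrite posE// in h2 del2 hn3; apply: (@boosted_rate gam z.2 z'.2 del (\sum_i rc i)) => //.
  apply: le_trans (hc rc rc0); rewrite lerD2r ler_wpM2l// z'E /= mulr_suml mulr_sumr.
  apply: ler_sum => i _; have [_ _ hr _] := hmd i.
  by rewrite -mulrA mulrCA ler_wpM2l.
exists Ep, Ec, Dp, Dc; split=> //.
- move=> mp; apply: le_trans (hEp mp) _.
  by rewrite ler_wpM2l// exprS -[leRHS]mulrA ler_wpM2r ?s2P.
- move=> mp mc; apply: le_trans (hEc mp mc) _.
  by rewrite ler_wpM2l// exprS -[leRHS]mulrA ler_wpM2r ?s2P.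
Qed.
Definition rate_size (x : R) (n : nat) : nat :=
  if 0 < x then (Num.truncn (2 `^ (n%:R * x))).+1 else 1.

Lemma rate_size_gt0 x n : (0 < rate_size x n)%N.
Proof. by rewrite /rate_size; case: ifP. Qed.

Lemma rate_size_ge x n : 2 `^ (n%:R * x) <= (rate_size x n)%:R.
Proof.
rewrite /rate_size; case: ifP => x0; first by apply/ltW; exact: truncnS_gt.
rewrite -[leRHS](powRr0 2) ler_powR ?ler1n// mulr_ge0_le0// leNgt x0//.
Qed.

Lemma rate_size_ln x n : rate_size x n = 1%N \/
  0 < x /\ ln (rate_size x n)%:R <= (n%:R * x + 1) * ln 2.
Proof.
rewrite /rate_size; case: ifP => x0; [right|by left].
by split=> //; apply: ln_ceil_pow2_le; rewrite mulr_ge0// ltW.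
Qed.

Lemma ex_rate_size_ge x (K : R) : 0 < x -> 0 <= K ->
  exists N0, forall n, (N0 <= n)%N -> K <= (rate_size x n)%:R.
Proof.
move=> x0 K0; have l0 : 0 < ln 2 :> R by rewrite ln_gt0// ltr1n.
have [N0 HN] := ex_inv_le K0 (mulr_gt0 x0 l0); exists N0 => n /HN[n0].
rewrite ler_pdivrMr ?ltr0n// => hK; apply: le_trans (rate_size_ge x n).
rewrite /powR pnatr_eq0 /=; apply: le_trans (expR_ge1Dx _); lra.
Qed.

(** Thinning needs a codebook that grows with n, whence the cases. If the primary rate is positive,
    silencing primary messages restores both power constraints, as both transmitters know them.
    Otherwise the primary sends a constant word of zero covariance, and only cognitive messages need
    thinning. *)
Lemma region_achievable z : R_in Hpp Hcp Hcc Pp Pc z -> achievable Hpp Hcp Hpc Hcc Pp Pc z.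
Proof.
move=> zin eps eps0.
(* With x = s - 1 <= 1, [s ^+ 3] is at most 1 + 7x, and 7/32 <= 1/4 keeps the silenced share below
   eps/4, half of what thinning may cost. *)
pose s := 1 + Num.min 1 eps / 32.
have m0 : 0 < Num.min 1 eps by rewrite lt_min ltr01.
have m1 : Num.min 1 eps <= 1 by rewrite ge_min lexx.
have me : Num.min 1 eps <= eps by rewrite ge_min lexx orbT.
have s1 : 1 < s by rewrite /s; lra.
have S1 : 1 <= s ^+ 3 by apply: exprn_ege1; exact: ltW.
have hS : 1 - (s ^+ 3)^-1 <= eps / 2 / 2.
  have S0 : 0 < s ^+ 3 by lra.
  rewrite -(ler_pM2r S0) mulrBl mulVf ?gt_eqF// mul1r.
  have : s ^+ 3 <= 1 + 7 * (Num.min 1 eps / 32).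
    rewrite /s; set x := _ / 32; have x0 : 0 < x by rewrite /x divr_gt0.
    have x1 : x <= 1 by rewrite /x; lra.
    rewrite (_ : (1 + x) ^+ 3 = 1 + x * (3 + 3 * x + x ^+ 2)); last by ring.
    by rewrite lerD2l [leRHS]mulrC ler_wpM2l// ?(ltW x0)//; nra.
  have : eps / 2 / 2 * 1 <= eps / 2 / 2 * s ^+ 3 by rewrite ler_wpM2l//; lra.
  lra.
have eps2 : 0 < eps / 2 by rewrite divr_gt0.
have [Pp0 Pc0 [N1 H1]] := region_codes zin s1 eps2.
have K0 : 0 <= 2 / (eps / 2) by rewrite divr_ge0// ltW.
have [z1|z1] := ltP 0 z.1.
  have [N2 H2] := ex_rate_size_ge z1 K0.
  exists (maxn N1 N2) => n; rewrite geq_max => /andP[n1 n2].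
  set Mp := rate_size z.1 n; set Mc := rate_size z.2 n.
  have Mp0 : (0 < Mp)%N := rate_size_gt0 _ _; have Mc0 : (0 < Mc)%N := rate_size_gt0 _ _.
  have MM : (0 < Mp * Mc)%N by rewrite muln_gt0 Mp0.
  have [A [AM AS Af]] := thin_count S1 hS eps2 (H2 n n2).
  have [Ep [Ec [Dp [Dc [hEp hEc [mP mC] eP eC]]]]] :=
    H1 n n1 Mp Mc Mp0 Mc0 (rate_size_ln _ _) (rate_size_ln _ _).
  exists Mp, Mc, (fun mp : 'I_Mp => if (mp < A)%N then Ep mp else 0),
    (fun (mp : 'I_Mp) mc => if (mp < A)%N then Ec mp mc else 0), Dp, Dc.
  have hA : \sum_(mp < Mp) \sum_(mc < Mc) (~~ (mp < A)%N)%:R <= (Mp * Mc)%:R * (eps / 2).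
    rewrite exchange_big sum_cst card_ord natrM [Mp%:R * _]mulrC -mulrA ler_wpM2l//.
    by rewrite sum_ord_nlt.
  split; [split|split].
  - exact: rate_size_ge.
  - exact: rate_size_ge.
  - apply: (@power_ok_thin _ _ _ Ep (fun mp : 'I_Mp => (mp < A)%N) _ (s ^+ 3)) => //.
      by rewrite card_ord.
    by rewrite sum_ord_lt// card_ord.
  - apply: (@power_ok_thin _ _ _ (fun m : 'I_Mp * 'I_Mc => Ec m.1 m.2)
      (fun m : 'I_Mp * 'I_Mc => (m.1 < A)%N) _ (s ^+ 3)) => //.
      by rewrite card_prod !card_ord.
    rewrite sum_pair exchange_big /= sum_cst card_prod !card_ord sum_ord_lt//.
    by rewrite natrM [leRHS]mulrC -mulrA ler_wpM2l.
  - by split; exact: shift_measurable_decoder.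
  - rewrite [eps]splitr; apply: (err_prob_thin MM mP _ hA eP) => mp mc /= ->//.
  - rewrite [eps]splitr; apply: (err_prob_thin MM mC _ hA eC) => mp mc /= ->//.
have [z2|z2] := ltP 0 z.2.
  have [N2 H2] := ex_rate_size_ge z2 K0.
  exists (maxn N1 N2) => n; rewrite geq_max => /andP[n1 n2].
  have Mp1 : rate_size z.1 n = 1%N by rewrite /rate_size ltNge z1.
  set Mc := rate_size z.2 n.
  have Mc0 : (0 < Mc)%N := rate_size_gt0 _ _.
  have MM : (0 < 1 * Mc)%N by rewrite mul1n.
  have [A [AM AS Af]] := thin_count S1 hS eps2 (H2 n n2).
  have [Ep [Ec [Dp [Dc [hEp hEc [mP mC] eP eC]]]]] :=
    H1 n n1 1%N Mc (ltn0Sn 0) Mc0 (or_introl erefl) (rate_size_ln _ _).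
  exists 1%N, Mc, Ep, (fun mp (mc : 'I_Mc) => if (mc < A)%N then Ec mp mc else 0), Dp, Dc.
  have hA : \sum_(mp < 1) \sum_(mc < Mc) (~~ (mc < A)%N)%:R <= (1 * Mc)%:R * (eps / 2).
    by rewrite big_ord1 mul1n sum_ord_nlt.
  split; [split|split].
  - by have := rate_size_ge z.1 n; rewrite Mp1.
  - exact: rate_size_ge.
  - by apply: power_ok_single => //; rewrite card_ord.
  - apply: (@power_ok_thin _ _ _ (fun m : 'I_1 * 'I_Mc => Ec m.1 m.2)
      (fun m : 'I_1 * 'I_Mc => (m.2 < A)%N) _ (s ^+ 3)) => //.
      by rewrite card_prod !card_ord.
    by rewrite sum_pair big_ord1 /= card_prod !card_ord sum_ord_lt// mul1n.
  - by split; exact: shift_measurable_decoder.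
  - rewrite [eps]splitr; apply: (err_prob_thin MM mP _ hA eP) => mp mc /= ->//.
  - rewrite [eps]splitr; apply: (err_prob_thin MM mC _ hA eC) => mp mc /= ->//.
exists N1 => n n1.
have [Ep [Ec [Dp [Dc [hEp hEc [mP mC] eP eC]]]]] :=
  H1 n n1 1%N 1%N (ltn0Sn 0) (ltn0Sn 0) (or_introl erefl) (or_introl erefl).
have size1 x : x <= 0 -> 2 `^ (n%:R * x) <= 1%:R :> R.
  by move=> x0; have := rate_size_ge x n; rewrite /rate_size ltNge x0.
exists 1%N, 1%N, Ep, Ec, Dp, Dc; split; [split|split].
- exact: size1.
- exact: size1.
- by apply: power_ok_single => //; rewrite card_ord.
- by apply: power_ok_single => //; rewrite card_prod !card_ord.
- by split; exact: shift_measurable_decoder.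
- by apply: le_trans eP _; rewrite lee_fin; lra.
- by apply: le_trans eC _; rewrite lee_fin; lra.
Qed.
End Achievability.

Theorem theorem1 (R : realType) (npt nct npr ncr : nat)
  (Hpp : 'M[R[i]]_(npr, npt)) (Hcp : 'M[R[i]]_(npr, nct))
  (Hpc : 'M[R[i]]_(ncr, npt)) (Hcc : 'M[R[i]]_(ncr, nct)) (Pp Pc : R) :
  R_in Hpp Hcp Hcc Pp Pc `<=` C_MCC Hpp Hcp Hpc Hcc Pp Pc.
Proof. by move=> z; exact: region_achievable. Qed.
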